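(* Let $n\ge1$ and let $A$ be a real symmetric positive definite $n\times n$ matrix with eigenvalues $w_1^2,\dots,w_n^2$ (counted with multiplicity), where $w_i>0$. Let $K=-\Delta+\langle Ax,x\rangle_{\mathbb{R}^n}$ be the harmonic oscillator on $L^2(\mathbb{R}^n)$. Then the spectrum of $K$ consists of eigenvalues and is given by $$\sigma(K)=\left\{\sum_{i=1}^n(2n_i+1)w_i\;:\; n_i\in\{0,1,2,\dots\}\right\}.$$
   Context: $\langle Ax,x\rangle_{\mathbb{R}^n}=\sum_{i,j=1}^n a_{ij}x_ix_j$. $K$ denotes the self-adjoint operator on $L^2(\mathbb{R}^n)$ obtained as the closure of $-\Delta+\langle Ax,x\rangle$ defined on $C_0^\infty(\mathbb{R}^n)$ (essentially self-adjoint there). *)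

(* Defs.v *)
From HB Require Import structures.
From mathcomp Require Import all_boot all_order all_algebra.
From mathcomp Require Import all_classical all_reals all_analysis.
From mathcomp Require Import measurable_realfun complex.

Set Implicit Arguments.
Unset Strict Implicit.
Unset Printing Implicit Defensive.

Import Order.TTheory GRing.Theory Num.Theory.
Import numFieldNormedType.Exports.

Local Open Scope classical_set_scope.
Local Open Scope ring_scope.

Section matrix_measurable.
Context {d : measure_display} {T : measurableType d} (m n : nat).

(* sigma-algebra generated by the entries; for real matrices it is the Borel one *)
Definition mx_measurable : set (set 'M[T]_(m, n)) :=
  <<s \bigcup_(ij in [set: 'I_m * 'I_n])
        preimage_set_system setT (fun M : 'M[T]_(m, n) => M ij.1 ij.2)
          measurable >>.

Let mx0 : mx_measurable set0.
Proof. exact: sigma_algebra0. Qed.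

Let mxC A : mx_measurable A -> mx_measurable (~` A).
Proof. exact: sigma_algebraC. Qed.

Let mxU (F : _^nat) : (forall i, mx_measurable (F i)) ->
  mx_measurable (\bigcup_i (F i)).
Proof. exact: sigma_algebra_bigcup. Qed.

HB.instance Definition _ :=
  @isMeasurable.Build default_measure_display 'M[T]_(m, n)
    mx_measurable mx0 mxC mxU.

Lemma measurable_mx_coord (i : 'I_m) (j : 'I_n) :
  measurable_fun setT (fun M : 'M[T]_(m, n) => M i j).
Proof.
move=> _ Y mY; apply: sub_sigma_algebra.
by exists (i, j) => //; exists Y.
Qed.

Lemma measurable_fun_mx d' (U : measurableType d') (f : U -> 'M[T]_(m, n)) :
  (forall i j, measurable_fun setT (fun u => f u i j)) -> measurable_fun setT f.
Proof.
move=> mf; apply: (@measurability _ _ _ _ setT f _ erefl).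
move=> _ [_ [[i j] _ [Y mY <-]] <-] /=; rewrite !setTI.
by rewrite -[X in measurable X]setTI; exact: (mf i j).
Qed.

End matrix_measurable.

Section lebesgue_rV.
Context {R : realType}.

Definition consrV n (p : measurableTypeR R * 'rV[R]_n) : 'rV[R]_n.+1 :=
  row_mx (const_mx p.1 : 'rV_1) p.2.

Lemma consrV0 n (p : measurableTypeR R * 'rV[R]_n) : consrV p 0 ord0 = p.1.
Proof.
rewrite (_ : ord0 = lshift n (0 : 'I_1)); last exact/val_inj.
by apply: etrans (row_mxEl _ _ _ _) _; rewrite mxE.
Qed.

Lemma consrVS n (p : measurableTypeR R * 'rV[R]_n) j :
  consrV p 0 (lift ord0 j) = p.2 0 j.
Proof.
rewrite (_ : lift ord0 j = rshift 1 j); last exact/val_inj.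
exact: row_mxEr.
Qed.

Lemma measurable_consrV n : measurable_fun setT (@consrV n).
Proof.
apply: measurable_fun_mx => i j; rewrite ord1.
case: (unliftP ord0 j) => [k|] ->.
  under eq_fun do rewrite consrVS.
  exact: (measurableT_comp (measurable_mx_coord 0 k) measurable_snd).
under eq_fun do rewrite consrV0.
exact: measurable_fst.
Qed.

Section step.
Variables (n : nat) (mu : {sigma_finite_measure set 'rV[R]_n -> \bar R}).

Definition lebesgue_rVS : set 'rV[R]_n.+1 -> \bar R :=
  pushforward ((@lebesgue_measure R) \x mu)%E (@consrV n).

Let preim A : measurable A -> measurable (@consrV n @^-1` A).
Proof. by move=> mA; rewrite -[X in measurable X]setTI; exact: measurable_consrV. Qed.

Let leb0 : lebesgue_rVS set0 = 0%E.
Proof. by rewrite /lebesgue_rVS /pushforward preimage_set0 measure0. Qed.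

Let leb_ge0 A : (0 <= lebesgue_rVS A)%E.
Proof. by rewrite /lebesgue_rVS /pushforward; exact: measure_ge0. Qed.

Let leb_sigma_additive : semi_sigma_additive lebesgue_rVS.
Proof.
move=> F mF tF mUF; rewrite /lebesgue_rVS /pushforward preimage_bigcup.
apply: measure_semi_sigma_additive.
- by move=> k; exact: preim.
- apply/trivIsetP => /= i j _ _ ij; rewrite -preimage_setI.
  by move/trivIsetP : tF => /(_ _ _ _ _ ij) ->//; rewrite preimage_set0.
- by rewrite -preimage_bigcup; exact: preim.
Qed.

HB.instance Definition _ := isMeasure.Build _ _ _ lebesgue_rVS
  leb0 leb_ge0 leb_sigma_additive.

Let leb_sigma_finite : sigma_finite setT lebesgue_rVS.
Proof.
have /sigma_finiteP[F [TF ndF Foo]] := sigma_finiteT (@lebesgue_measure R).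
have /sigma_finiteP[G [TG ndG Goo]] := sigma_finiteT mu.
pose un (v : 'rV[R]_n.+1) : measurableTypeR R * 'rV[R]_n :=
  (v 0 0, (rsubmx (v : 'rV_(1 + n)) : 'rV_n)).
have unK p : un (consrV p) = p.
  rewrite /un; case: p => a v; congr pair; first exact: consrV0.
  exact: row_mxKr.
have mun : measurable_fun setT un.
  apply/measurable_fun_pairP; split; first exact: measurable_mx_coord.
  apply: measurable_fun_mx => i j; rewrite ord1.
  under eq_fun do rewrite /= mxE; exact: measurable_mx_coord.
exists (fun k => un @^-1` (F k `*` G k)).
  rewrite predeqE => v; split=> // _.
  have [k _ Fk] : (\bigcup_i F i) (un v).1 by rewrite -TF.
  have [l _ Gl] : (\bigcup_i G i) (un v).2 by rewrite -TG.
  exists (maxn k l) => //; split.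
  - by move: Fk; exact/subsetPset/ndF/leq_maxl.
  - by move: Gl; exact/subsetPset/ndG/leq_maxr.
move=> k; have [mFk Fk] := Foo k; have [mGk Gk] := Goo k; split.
  by rewrite -[X in measurable X]setTI; apply: mun => //; exact: measurableX.
rewrite /lebesgue_rVS /pushforward -comp_preimage.
rewrite (_ : un \o _ = id) ?preimage_id; last exact/funext.
by rewrite product_measure1E// lte_mul_pinfty// ge0_fin_numE.
Qed.

HB.instance Definition _ := Measure_isSigmaFinite.Build _ _ _ lebesgue_rVS
  leb_sigma_finite.

End step.

(* Lebesgue measure on R^n, as the n-fold product of the measure on R transported
   along R * R^n -> R^(n.+1); lebesgue_rV_box gives its values on boxes. *)
Fixpoint lebesgue_rV n : {sigma_finite_measure set 'rV[R]_n -> \bar R} :=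
  match n with
  | 0 => \d_(0 : 'rV[R]_0)
  | n'.+1 => lebesgue_rVS (lebesgue_rV n')
  end.

Lemma lebesgue_rV_box n (X : 'I_n -> set (measurableTypeR R)) :
  (forall i, measurable (X i)) ->
  lebesgue_rV n [set x | forall i, X i (x 0 i)] =
    (\prod_(i < n) lebesgue_measure (X i))%E.
Proof.
elim: n X => [|n IH] X mX.
  rewrite big_ord0 /= diracE mem_set// => i; by case: i.
rewrite big_ord_recl /= /lebesgue_rVS /pushforward.
pose Y := [set x : 'rV[R]_n | forall i, X (lift ord0 i) (x 0 i)].
have mY : measurable Y.
  rewrite (_ : Y = \bigcap_(i in [set: 'I_n])
    ((fun x : 'rV[R]_n => x 0 i) @^-1` X (lift ord0 i))).
    apply: fin_bigcap_measurable => [|i _]; first exact: finite_finset.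
    rewrite -[X in measurable X]setTI.
    exact: (measurable_mx_coord ord0 i _ (mX _)).
  by apply/seteqP; split=> x /= h i; [move=> _|]; exact: h.
transitivity ((lebesgue_measure \x lebesgue_rV n)%E (X ord0 `*` Y)); last first.
  by rewrite product_measure1E//; congr (_ * _)%E; exact: IH.
congr (_ _).
apply/seteqP; split=> [[a v]|[a v]] /=.
  move=> h; split; first by have := h ord0; rewrite consrV0.
  by move=> i; have := h (lift ord0 i); rewrite consrVS.
move=> [h1 h2] i; case: (unliftP ord0 i) => [j|] ->; first by rewrite consrVS.
by rewrite consrV0.
Qed.

End lebesgue_rV.

Section L2_space.
Context {d : measure_display} {T : measurableType d} {R : realType}.
Variable mu : {measure set T -> \bar R}.
Local Notation C := R[i].

(* R-valued modulus; the norm `|z| of z : R[i] is itself R[i]-valued *)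
Definition cabs (f : T -> C) (x : T) : R := Normc.normc (f x).

Definition square_integrable (f : T -> C) : Prop :=
  [/\ measurable_fun setT (fun x => complex.Re (f x)),
      measurable_fun setT (fun x => complex.Im (f x))
    & finite_norm mu 2%:E (cabs f)].

Definition sqint : {pred T -> C} := mem [set f | square_integrable f].

Lemma measurable_cabs (f : T -> C) :
  measurable_fun setT (fun x => complex.Re (f x)) ->
  measurable_fun setT (fun x => complex.Im (f x)) ->
  measurable_fun setT (cabs f).
Proof.
move=> mr mi; rewrite (_ : cabs f = (@Num.sqrt R) \o
  (fun x => complex.Re (f x) ^+ 2 + complex.Im (f x) ^+ 2)); last first.
  by apply/funext => x; rewrite /cabs /=; case: (f x).
apply: measurableT_comp.
  by apply: continuous_measurable_fun; exact: sqrt_continuous.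
by apply: measurable_funD; exact: measurable_funX.
Qed.

Lemma cabs_ge0 f x : 0 <= cabs f x.
Proof. by rewrite /cabs; case: (f x) => a b; exact: sqrtr_ge0. Qed.

Lemma cabs_Lfun f : square_integrable f -> cabs f \in Lfun mu 2%:E.
Proof.
move=> [mr mi fin]; rewrite inE; apply/andP; split; rewrite inE//=.
exact: measurable_cabs.
Qed.

Lemma cabsD f g x : cabs (f + g) x <= cabs f x + cabs g x.
Proof. exact: le_normcD. Qed.

Lemma cabsZ a f x : cabs (a *: f) x = Normc.normc a * cabs f x.
Proof. exact: Normc.normcM. Qed.

Lemma measurable_EFin_sqr (h : T -> R) : measurable_fun setT h ->
  measurable_fun setT (fun x => (`|(EFin \o h) x| `^ 2)%E).
Proof.
move=> mh; apply: (measurableT_comp (measurable_poweR _)) => //.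
by apply: measurableT_comp => //; exact: measurableT_comp.
Qed.

Lemma le_Lnorm2 (f g : T -> R) :
  measurable_fun setT f -> measurable_fun setT g ->
  (forall x, 0 <= f x <= g x) ->
  ('N[mu]_2%:E[EFin \o f] <= 'N[mu]_2%:E[EFin \o g])%E.
Proof.
move=> mf mg fg; rewrite unlock /Lnorm.
rewrite gt0_ler_poweR//.
- by rewrite in_itv/= leey integral_ge0.
- by rewrite in_itv/= leey integral_ge0.
- apply: ge0_le_integral => //; try exact: measurable_EFin_sqr.
  by move=> x _; exact: poweR_ge0.
  move=> x _ /=; have /andP[f0 fgx] := fg x.
  rewrite lee_fin ge0_ler_powR ?nnegrE//.
  by rewrite !ger0_norm// (le_trans f0).
Qed.

Lemma ae_eq_Lnorm2 (f g : T -> R) :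
  measurable_fun setT f -> measurable_fun setT g ->
  {ae mu, forall x, f x = g x} ->
  ('N[mu]_2%:E[EFin \o f] = 'N[mu]_2%:E[EFin \o g])%E.
Proof.
move=> mf mg fg; rewrite unlock /Lnorm.
congr (_ `^ _)%E; apply: ge0_ae_eq_integral => //;
  try exact: measurable_EFin_sqr; try by move=> x _; exact: poweR_ge0.
by apply: filterS fg => x /= -> _.
Qed.

Lemma square_integrable_submod : submod_closed sqint.
Proof.
split.
  rewrite inE; split; [exact: measurable_cst|exact: measurable_cst|].
  rewrite /finite_norm (_ : _ \o _ = cst 0%E) ?Lnorm0//.
  by apply/funext => x /=; rewrite /cabs Normc.normc0.
move=> a f g; rewrite !inE => sf sg.
have [mrf mif ff] := sf; have [mrg mig fg] := sg.
have mr : measurable_fun setT (fun x => complex.Re ((a *: f + g) x)).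
  rewrite (_ : (fun x => _) = (fun x => complex.Re a * complex.Re (f x)
      - complex.Im a * complex.Im (f x) + complex.Re (g x))); last first.
    apply/funext => x; rewrite /GRing.add /GRing.scale /=.
    by case: a (f x) (g x) => [? ?] [? ?] [? ?].
  apply: measurable_funD => //; apply: measurable_funB;
    by apply: measurable_funM => //; exact: measurable_cst.
have mi : measurable_fun setT (fun x => complex.Im ((a *: f + g) x)).
  rewrite (_ : (fun x => _) = (fun x => complex.Re a * complex.Im (f x)
      + complex.Im a * complex.Re (f x) + complex.Im (g x))); last first.
    apply/funext => x; rewrite /GRing.add /GRing.scale /=.
    by case: a (f x) (g x) {mr} => [? ?] [? ?] [? ?].
  apply: measurable_funD => //; apply: measurable_funD;
    by apply: measurable_funM => //; exact: measurable_cst.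
split=> //.
have : Normc.normc a *: cabs f + cabs g \in Lfun mu 2%:E.
  have p1 : (1 <= (2 : R)%:E)%E by rewrite lee_fin ler1n.
  by apply: (Lfun_submod_closed mu p1).2; exact: cabs_Lfun.
rewrite inE => /andP[]; rewrite !inE /= => mN; apply: le_lt_trans.
apply: le_Lnorm2 => // [|x]; first exact: measurable_cabs.
by rewrite cabs_ge0 /=; apply: le_trans (cabsD _ _ _) _; rewrite cabsZ.
Qed.

HB.instance Definition _ := GRing.isSubmodClosed.Build _ _ sqint
  square_integrable_submod.

Record L2fun := MkL2fun { L2val :> T -> C ; L2valP : L2val \in sqint }.

HB.instance Definition _ := [isSub for L2val].
HB.instance Definition _ := gen_eqMixin L2fun.
HB.instance Definition _ := gen_choiceMixin L2fun.
HB.instance Definition _ := [SubChoice_isSubLmodule of L2fun by <:].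

Definition ae_zero : {pred L2fun} := mem [set f : L2fun | {ae mu, forall x, f x = 0}].

Lemma ae_zero_zmod : zmod_closed ae_zero.
Proof.
split; first by rewrite inE; exact: nearW.
move=> f g; rewrite !inE => f0 g0; apply: filterS2 f0 g0 => x fx gx /=.
by rewrite -[LHS]/(f x - g x) fx gx subrr.
Qed.

HB.instance Definition _ := GRing.isZmodClosed.Build _ ae_zero ae_zero_zmod.

(* complex-valued square-integrable functions modulo equality mu-a.e. *)
Definition L2 : Type := Quotient.quot ae_zero.
HB.instance Definition _ := GRing.Zmodule.on L2.

Definition L2class (f : L2fun) : L2 := \pi_(Quotient.quot ae_zero)%qT f.

Lemma eq_L2class f g : L2class f = L2class g <-> {ae mu, forall x, f x = g x}.
Proof.
rewrite /L2class; split.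
  move=> /eqP; rewrite -Quotient.idealrBE inE; apply: filterS => x /=.
  by rewrite -[LHS]/(f x - g x) => /eqP; rewrite subr_eq0 => /eqP.
move=> fg; apply/eqP; rewrite -Quotient.idealrBE inE.
apply: filterS fg => x /= fgx.
by rewrite -[LHS]/(f x - g x) fgx subrr.
Qed.

Definition L2repr (u : L2) : L2fun := repr u.

Lemma L2reprK u : L2class (L2repr u) = u.
Proof. exact: reprK. Qed.

Lemma ae_L2repr f : {ae mu, forall x, L2repr (L2class f) x = f x}.
Proof. by apply/eq_L2class; rewrite L2reprK. Qed.

Lemma L2classD f g : L2class (f + g) = L2class f + L2class g.
Proof. exact: Quotient.pi_add. Qed.

Lemma L2class0 : L2class 0 = 0.
Proof. by apply: (addrI (L2class 0)); rewrite -L2classD !addr0. Qed.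

Definition L2scale (a : C) (u : L2) : L2 := L2class (a *: L2repr u).

Lemma L2classZ a f : L2class (a *: f) = L2scale a (L2class f).
Proof.
apply/eq_L2class; apply: filterS (ae_L2repr f) => x /= fx.
by rewrite -[RHS]/(a *: (L2repr (L2class f) x)) fx.
Qed.

Let scaleA a b u : L2scale a (L2scale b u) = L2scale (a * b) u.
Proof. by rewrite -[u]L2reprK -!L2classZ scalerA. Qed.

Let scale1 : left_id 1 L2scale.
Proof. by move=> u; rewrite -[u]L2reprK -!L2classZ scale1r. Qed.

Let scaleDr : right_distributive L2scale +%R.
Proof.
move=> a u v; rewrite -[u]L2reprK -[v]L2reprK.
by rewrite -L2classD -!L2classZ scalerDr L2classD.
Qed.

Let scaleDl v : {morph L2scale^~ v : a b / a + b}.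
Proof.
by move=> a b; rewrite -[v]L2reprK -!L2classZ scalerDl L2classD.
Qed.

HB.instance Definition _ :=
  GRing.Zmodule_isLmodule.Build C L2 scaleA scale1 scaleDr scaleDl.

Definition L2fun_norm (f : L2fun) : R := fine ('N[mu]_2%:E[EFin \o cabs f])%E.

Definition L2norm (u : L2) : C := (L2fun_norm (L2repr u))%:C%C.

Lemma L2fun_normE f : (L2fun_norm f)%:E = ('N[mu]_2%:E[EFin \o cabs f])%E.
Proof.
have := L2valP f; rewrite inE => -[_ _ ffin].
by rewrite /L2fun_norm fineK// fin_numElt (lt_le_trans ltNy0) ?Lnorm_ge0.
Qed.

Lemma measurable_L2fun (f : L2fun) : measurable_fun setT (cabs f).
Proof. by have := L2valP f; rewrite inE => -[mr mi _]; exact: measurable_cabs. Qed.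

Lemma L2norm_class f : L2norm (L2class f) = (L2fun_norm f)%:C%C.
Proof.
congr (_%:C)%C; apply: EFin_inj; rewrite !L2fun_normE.
apply: ae_eq_Lnorm2; try exact: measurable_L2fun.
by apply: filterS (ae_L2repr f) => x; rewrite /cabs => ->.
Qed.

Let ler_L2normD u v : L2norm (u + v) <= L2norm u + L2norm v.
Proof.
rewrite -[u]L2reprK -[v]L2reprK -L2classD !L2norm_class -rmorphD lecR.
rewrite -lee_fin EFinD !L2fun_normE.
apply: le_trans (eminkowski mu _ _ _); try exact: measurable_L2fun.
  apply: le_Lnorm2 => [||x]; first exact: measurable_L2fun.
    by apply: measurable_funD; exact: measurable_L2fun.
  by rewrite cabs_ge0; exact: cabsD.
by rewrite lee_fin ler1n.
Qed.

Let L2normZ a u : L2norm (a *: u) = `|a| * L2norm u.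
Proof.
rewrite -[u]L2reprK -[a *: _]L2classZ !L2norm_class.
have -> : `|a| = (Normc.normc a)%:C%C by case: a.
rewrite -rmorphM; congr (_%:C)%C; apply: EFin_inj.
rewrite EFinM !L2fun_normE.
have p1 : (1 <= (2 : R)%:E)%E by rewrite lee_fin ler1n.
have := L2valP (L2repr u); rewrite inE => /cabs_Lfun cf.
have := LnormZ (Lfun_Sub p1 cf) (Normc.normc a).
rewrite ger0_norm; last by case: (a) => ? ?; exact: sqrtr_ge0.
move=> <-; congr (Lnorm _ _ _); apply/funext => x /=.
by congr EFin; exact: cabsZ.
Qed.

Let L2norm_eq0 u : L2norm u = 0 -> u = 0.
Proof.
rewrite -[u]L2reprK L2norm_class => /eqP; rewrite eq_complex /= eqxx andbT.
move=> /eqP u0; have : (L2fun_norm (L2repr u))%:E = 0%E by rewrite u0.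
rewrite L2fun_normE => /Lnorm_eq0_eq0 h.
rewrite -L2class0; apply/eq_L2class; apply: filterS (h _ _) => [x /= /(_ I) []||].
- by move=> /Normc.eq0_normc.
- by apply/measurable_EFinP; exact: measurable_L2fun.
- by rewrite lte_fin.
Qed.

HB.instance Definition _ :=
  Lmodule_isNormed.Build C L2 ler_L2normD L2normZ L2norm_eq0.

End L2_space.



(* An unbounded operator on V is represented by its graph, a subset of V * V:
   (u, v) \in G means that u is in the domain and is mapped to v. *)
Section unbounded_operators.
Context {K : numFieldType} {V : normedModType K}.

(* z is in the resolvent set when the operator minus z is a bijection from its
   domain onto V with bounded inverse S: (G - z) u = f iff u = S f. *)
Definition resolvent_set (G : set (V * V)) : set K :=
  [set z | exists S : {linear V -> V}, continuous S /\
     forall u f, G (u, f + z *: u) <-> u = S f].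

Definition spectrum (G : set (V * V)) : set K := ~` resolvent_set G.

Definition eigenvalues (G : set (V * V)) : set K :=
  [set z | exists2 u, u != 0 & G (u, z *: u)].

End unbounded_operators.

Section harmonic_oscillator.
Context {R : realType} {n : nat}.
Local Notation C := R[i].

(* C^k in terms of iterated partial derivatives; delta_mx 0 i is the i-th vector
   of the standard basis *)
Fixpoint Ck (k : nat) (f : 'rV[R]_n -> R) : Prop :=
  continuous f /\
  if k is k'.+1 then forall i : 'I_n,
    (forall x, derivable f x (delta_mx 0 i)) /\ Ck k' ('D_(delta_mx 0 i) f)
  else True.

Definition smooth (f : 'rV[R]_n -> R) : Prop := forall k, Ck k f.

(* R[i] is not a normed module over R in the library, hence real derivatives of
   complex-valued functions are taken on the real and imaginary parts *)
Definition test_function (phi : 'rV[R]_n -> C) : Prop :=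
  [/\ smooth (fun x => complex.Re (phi x)), smooth (fun x => complex.Im (phi x))
    & compact (closure [set x | phi x != 0])].

Definition laplacian (f : 'rV[R]_n -> R) (x : 'rV[R]_n) : R :=
  \sum_(i < n) 'D_(delta_mx 0 i) ('D_(delta_mx 0 i) f) x.

Definition claplacian (phi : 'rV[R]_n -> C) (x : 'rV[R]_n) : C :=
  (laplacian (fun y => complex.Re (phi y)) x +i*
   laplacian (fun y => complex.Im (phi y)) x)%C.

Definition quadratic_form (A : 'M[R]_n) (x : 'rV[R]_n) : R :=
  \sum_(i < n) \sum_(j < n) A i j * x 0 i * x 0 j.

Local Notation L2Rn := (L2 (lebesgue_rV n)).

(* graph of -Delta + <Ax,x> on the test functions; being continuous with compact
   support, the representatives f and g below are always square-integrable *)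
Definition minimal_oscillator (A : 'M[R]_n) : set (L2Rn * L2Rn) :=
  [set p | exists f g : L2fun (lebesgue_rV n),
     [/\ test_function f,
         forall x, g x = - claplacian f x + (quadratic_form A x)%:C%C * f x
       & p = (L2class f, L2class g)]].

Definition harmonic_oscillator (A : 'M[R]_n) : set (L2Rn * L2Rn) :=
  closure (minimal_oscillator A).

End harmonic_oscillator.

(* Main.v *)
(* Write A = U^T diag(w_i^2) U with U orthogonal and y = U x.  The products h_m of
   one-dimensional Hermite functions of the coordinates y_i satisfy
   K h_m = (sum_i (2 m_i + 1) w_i) h_m pointwise; they are orthogonal by the ladder
   relations, and cutting them off by smooth bumps shows that they lie in the domain of
   the closure of K.  They are total: if f is orthogonal to all h_m, then all moments of
   f h_0 vanish, where h_0 is a Gaussian, and f h_0 has all exponential moments; the functions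
   by which such a weight may be multiplied without losing these properties include x_i, hence
   by power series the sines of s (x_i - a), hence by limits the signs of x_i - a, hence all
   indicators of measurable sets, so f = 0.  Green's identity against test functions shows that
   the closure is diagonal in this basis.  As the levels are discrete, off them the diagonal
   operator with entries 1 / (level - z) is bounded, and it is the resolvent. *)

From HB Require Import structures.
Require Import Defs.
From mathcomp Require Import all_boot all_order all_algebra.
From mathcomp Require Import all_classical all_reals all_analysis.
From mathcomp Require Import measurable_realfun complex ring lra.

Set Implicit Arguments.
Unset Strict Implicit.
Unset Printing Implicit Defensive.

Import Order.TTheory GRing.Theory Num.Theory.
Import numFieldNormedType.Exports.

Local Open Scope classical_set_scope.
Local Open Scope ring_scope.

(** * Operators with an orthogonal eigenbasis in a Hilbert space *)

(** Estimates go through squared norms with values in R, because the norm of a complex space is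
    R[i]-valued and the order of R[i] is only partial; inequalities with a factor 2 replace the
    triangle inequality. The abstract part asks for symmetry only on the test functions and for
    eigenvectors only in the closure, so the domain of the closure never has to be described. The
    main obstacle is totality, classically a matter of Fourier transforms or tensor products;
    multipliers settle it directly in n variables, for an arbitrary exponentially integrable weight.
    Decay faster than every exponential is the working class: it is stable under multiplication by
    coordinates, contains test functions and Hermite functions alike, and is dominated by the
    product weight exp(- l1 x), to which Fubini applies. The eigenvectors stay unnormalised, so no
    square roots of factorials occur; the ladder identity that gives their orthogonality also shows
    that none of them vanishes. *)

Section squared_modulus.
Context {R : rcfType}.
Implicit Types x y : R[i].

(** The squared modulus taken in R rather than in R[i], so that [lra], minima and suprema are
    available. *)
Definition sqm x : R := complex.Re x ^+ 2 + complex.Im x ^+ 2.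

Lemma sqm_ge0 x : 0 <= sqm x.
Proof. by rewrite addr_ge0 ?sqr_ge0. Qed.

Lemma mulc_conj x : x * x^* = (sqm x)%:C%C.
Proof.
by case: x => a b; rewrite /sqm /=; apply/eqP; rewrite eq_complex /=; apply/andP; split;
  apply/eqP; ring.
Qed.

Lemma sqr_normc_sqm x : `|x| ^+ 2 = (sqm x)%:C%C.
Proof. by rewrite -mulc_conj; exact: normCK. Qed.

Lemma sqmM x y : sqm (x * y) = sqm x * sqm y.
Proof. by case: x y => a b [c d]; rewrite /sqm /=; ring. Qed.

Lemma sqmD_le x y : sqm (x + y) <= 2 * sqm x + 2 * sqm y.
Proof.
case: x y => [a b] [c d]; rewrite /sqm /= -subr_ge0.
rewrite (_ : _ - _ = (a - c) ^+ 2 + (b - d) ^+ 2); last by ring.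
by rewrite addr_ge0 ?sqr_ge0.
Qed.

Lemma gt0_complexE x : 0 < x -> x = (complex.Re x)%:C%C /\ 0 < complex.Re x.
Proof.
by case: x => a b; rewrite ltcE /= => /andP[/eqP -> a0]; split.
Qed.

Lemma ge0_complexE x : 0 <= x -> x = (complex.Re x)%:C%C /\ 0 <= complex.Re x.
Proof.
by case: x => a b; rewrite lecE /= => /andP[/eqP -> a0]; split.
Qed.

End squared_modulus.

Section hilbert.
Context {R : realType} {V : normedModType R[i]}.
Local Notation C := R[i].
Variable ip : V -> V -> C.

Definition sqn (u : V) : R := complex.Re (ip u u).

Hypothesis ipDl : forall u v w, ip (u + v) w = ip u w + ip v w.
Hypothesis ipZl : forall a u w, ip (a *: u) w = a * ip u w.
Hypothesis ipC : forall u v, ip u v = (ip v u)^*.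
Hypothesis normV : forall u, `|u| ^+ 2 = ip u u.

Lemma sqnE u : ip u u = (sqn u)%:C%C.
Proof.
have : 0 <= ip u u by rewrite -normV exprn_ge0.
by move=> /ge0_complexE[].
Qed.

Lemma sqn_ge0 u : 0 <= sqn u.
Proof. by rewrite -lecR -sqnE -normV exprn_ge0. Qed.

Lemma sqn_eq0 u : sqn u = 0 -> u = 0.
Proof.
by move=> u0; apply/eqP; rewrite -normr_eq0 -sqrf_eq0 normV sqnE u0.
Qed.

Lemma ip0l w : ip 0 w = 0.
Proof. by rewrite -[X in ip X _](scale0r 0) ipZl mul0r. Qed.

Lemma ip0r w : ip w 0 = 0.
Proof. by rewrite ipC ip0l conjC0. Qed.

Lemma ipNl u w : ip (- u) w = - ip u w.
Proof. by rewrite -scaleN1r ipZl mulN1r. Qed.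

Lemma ipDr u v w : ip w (u + v) = ip w u + ip w v.
Proof. by rewrite ipC ipDl rmorphD /= -!ipC. Qed.

Lemma ipZr a u w : ip w (a *: u) = a^* * ip w u.
Proof. by rewrite ipC ipZl rmorphM /= -ipC. Qed.

Lemma ip_suml I (r : seq I) (F : I -> V) w :
  ip (\sum_(i <- r) F i) w = \sum_(i <- r) ip (F i) w.
Proof.
elim: r => [|i r IH]; first by rewrite !big_nil ip0l.
by rewrite !big_cons ipDl IH.
Qed.

Lemma ip_sumr I (r : seq I) (F : I -> V) w :
  ip w (\sum_(i <- r) F i) = \sum_(i <- r) ip w (F i).
Proof.
elim: r => [|i r IH]; first by rewrite !big_nil ip0r.
by rewrite !big_cons ipDr IH.
Qed.

Lemma sqn_orthD u v : ip u v = 0 -> sqn (u + v) = sqn u + sqn v.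
Proof.
move=> uv; rewrite /sqn ipDl !ipDr uv (ipC v u) uv conjC0 addr0 add0r.
by rewrite raddfD.
Qed.

Lemma sqnZ a u : sqn (a *: u) = sqm a * sqn u.
Proof.
apply: (@complexI R); rewrite -sqnE ipZl ipZr mulrA mulc_conj sqnE.
by rewrite rmorphM.
Qed.

Lemma ipNr u w : ip w (- u) = - ip w u.
Proof. by rewrite ipC ipNl rmorphN /= -ipC. Qed.

(** Half of the parallelogram law. It serves as a triangle inequality free of square roots, and its
    factor 2 explains the splittings of [eps] into quarters below. *)
Lemma sqnD_le u v : sqn (u + v) <= 2 * sqn u + 2 * sqn v.
Proof.
have : 0 <= sqn (u - v) by exact: sqn_ge0.
rewrite /sqn !(ipDl, ipDr, ipNl, ipNr).
move: (ip u u) (ip v v) (ip u v) (ip v u) => [a ?] [b ?] [c ?] [d ?] /=; lra.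
Qed.

Lemma cauchy_schwarz u v : sqm (ip u v) <= sqn u * sqn v.
Proof.
have [v0|v0] := eqVneq (sqn v) 0.
  by rewrite (sqn_eq0 v0) ip0r /sqm /= expr0n /= addr0 /sqn ip0r /= mulr0.
have v_gt0 : 0 < sqn v by rewrite lt_def v0 sqn_ge0.
(* [p] is the orthogonal projection of [u] on the line of [v]; the inequality is Pythagoras for
   [u - p] and [p]. *)
pose p := (ip u v / (sqn v)%:C%C) *: v.
have up : ip (u - p) p = 0.
  rewrite ipZr ipDl ipNl ipZl sqnE mulfVK ?subrr ?mulr0 //.
  by rewrite fmorph_eq0.
have : sqn u = sqn (u - p) + sqn p by rewrite -sqn_orthD // subrK.
have -> : sqn p = sqm (ip u v) / sqn v.
  rewrite sqnZ sqmM -mulrA; congr (_ * _).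
  rewrite -fmorphV /sqm /= expr0n addr0 /=; field.
  by rewrite v0.
move=> h; rewrite -ler_pdivrMr// h lerDr; exact: sqn_ge0.
Qed.

(** The vectors are neither normalised nor assumed nonzero: multi-indices will be enumerated by
    natural numbers, and numbers that code no multi-index carry the zero vector. *)
Variable e : nat -> V.
Hypothesis orth : forall i j, i != j -> ip (e i) (e j) = 0.

Lemma ip_part a m n j : ip (\sum_(m <= k < n) a k *: e k) (e j) =
  if (m <= j < n)%N then a j * ip (e j) (e j) else 0.
Proof.
rewrite ip_suml; under eq_bigr do rewrite ipZl.
case: ifP => mjn.
  rewrite (bigD1_seq j) ?mem_index_iota ?iota_uniq //= big1 ?addr0 //.
  by move=> i ij; rewrite orth // mulr0.
rewrite big_seq big1 // => i; rewrite mem_index_iota => imn.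
have [ij|ij] := eqVneq i j; first by rewrite ij mjn in imn.
by rewrite orth // mulr0.
Qed.

Lemma sqn_part a m n : sqn (\sum_(m <= k < n) a k *: e k) =
  \sum_(m <= k < n) sqm (a k) * sqn (e k).
Proof.
apply: (@complexI R); rewrite -sqnE ip_sumr rmorph_sum /=.
apply: eq_big_seq => j; rewrite mem_index_iota => jmn.
by rewrite ipZr ip_part jmn mulrA (mulrC _^*) mulc_conj sqnE rmorphM.
Qed.

(** Where [e k] is zero this is 0 / 0 = 0, and [coefK] still holds there. *)
Definition coef (u : V) k : C := ip u (e k) / ip (e k) (e k).

Lemma coefK u k : coef u k * ip (e k) (e k) = ip u (e k).
Proof.
have [k0|k0] := eqVneq (sqn (e k)) 0.
  by rewrite (sqn_eq0 k0) !ip0r mulr0.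
by rewrite mulfVK // sqnE fmorph_eq0.
Qed.

(** The partial Fourier sum is the orthogonal projection of [u] on the span of the first N vectors,
    so Pythagoras applies. *)
Lemma bessel u N : \sum_(0 <= k < N) sqm (coef u k) * sqn (e k) <= sqn u.
Proof.
rewrite -sqn_part; set p := \sum_(0 <= k < N) _.
have up : ip (u - p) p = 0.
  rewrite ip_sumr big_seq big1 // => k; rewrite mem_index_iota => kN.
  by rewrite ipZr ipDl ipNl ip_part kN coefK subrr mulr0.
by rewrite -[in leRHS](subrK p u) sqn_orthD // lerDr sqn_ge0.
Qed.

Definition sqn_cvg (s : nat -> V) l :=
  forall eps : R, 0 < eps -> exists N, forall n, (N <= n)%N ->
    sqn (l - s n) <= eps.

Hypothesis complete : forall s : nat -> V,
  (forall eps : R, 0 < eps -> exists N, forall m n, (N <= m)%N -> (m <= n)%N ->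
     sqn (s n - s m) <= eps) ->
  exists l, sqn_cvg s l.

Lemma ip_cvg s l a N k : sqn_cvg s l ->
  (forall n, (N <= n)%N -> ip (s n) (e k) = a) -> ip l (e k) = a.
Proof.
move=> sl sa; apply/eqP; rewrite -subr_eq0; apply/negPn/negP => h.
have d0 : 0 < sqm (ip l (e k) - a).
  rewrite -(@ltcR R) -sqr_normc_sqm exprn_gt0 // normr_gt0 //.
have q1 : 0 < 1 + sqn (e k) by rewrite ltr_pwDl ?sqn_ge0.
(* With [q = sqn (e k)], an approximation this close makes Cauchy-Schwarz bound the positive gap by
   q / (1 + q) / 2 times itself. The summand 1 covers the case q = 0. *)
have d1 : 0 < sqm (ip l (e k) - a) / (1 + sqn (e k)) / 2 by rewrite !divr_gt0.
have [M HM] := sl _ d1.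
have {HM} := HM (maxn M N) (leq_maxl _ _).
set x := l - _ => xs; have := cauchy_schwarz x (e k).
rewrite ipDl ipNl (sa _ (leq_maxr _ _)); apply/negP; rewrite -ltNge.
apply: le_lt_trans (ler_wpM2r (sqn_ge0 _) xs) _.
set d := sqm _ in d0 *; have := sqn_ge0 (e k); set q := sqn (e k) => q0.
have -> : d / (1 + q) / 2 * q = d * (q / (1 + q) / 2) by ring.
rewrite gtr_pMr // ltr_pdivrMr // ltr_pdivrMr; lra.
Qed.

(** By Bessel the sums of [sqm (coef u k) * sqn (e k)] converge, and K times their tails dominates
    the tails of the series in [b], which is therefore Cauchy. It is used for [b] the coefficients
    divided by [lam k - z], and with K = 1 for the Fourier series of [u] itself. *)
Lemma series_cvg (u : V) (b : nat -> C) (K : R) : 0 <= K ->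
  (forall k, sqm (b k) <= K * sqm (coef u k)) ->
  exists l, [/\ sqn_cvg (fun n => \sum_(0 <= k < n) b k *: e k) l,
    forall k, ip l (e k) = b k * ip (e k) (e k) & sqn l <= 2 * (K * sqn u) ].
Proof.
move=> K0 bK; pose s n := \sum_(0 <= k < n) b k *: e k.
pose S n := \sum_(0 <= k < n) sqm (coef u k) * sqn (e k).
have t_ge0 k : 0 <= sqm (coef u k) * sqn (e k) by rewrite mulr_ge0 ?sqm_ge0 ?sqn_ge0.
have Smono : nondecreasing_seq S.
  apply/nondecreasing_seqP => n; rewrite /S big_nat_recr //= lerDl; exact: t_ge0.
have Scvg : cvgn S.
  apply: nondecreasing_is_cvgn => //; exists (sqn u) => _ [n _ <-]; exact: bessel.
have Sle n : S n <= limn S by exact: nondecreasing_cvgn_le.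
have cau : forall eps : R, 0 < eps -> exists N, forall m n, (N <= m)%N -> (m <= n)%N ->
     sqn (s n - s m) <= eps.
  move=> eps e0; have K1 : 0 < K + 1 by rewrite ltr_wpDl.
  have := Scvg; move/cvgrPdist_lt => /(_ (eps / (K + 1))) /(_ (divr_gt0 e0 K1)) [N _ HN].
  exists N => m n Nm mn; have {HN} := HN m Nm; rewrite /= ger0_norm ?subr_ge0 // => HN.
  have -> : s n - s m = \sum_(m <= k < n) b k *: e k.
    by rewrite /s (@big_cat_nat _ _ _ m 0 n) //= addrAC subrr add0r.
  rewrite sqn_part; apply: (@le_trans _ _ (K * (S n - S m))).
    have -> : S n - S m = \sum_(m <= k < n) sqm (coef u k) * sqn (e k).
      by rewrite /S (@big_cat_nat _ _ _ m 0 n) //= addrAC subrr add0r.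
    rewrite mulr_sumr; apply: ler_sum => k _; rewrite mulrA ler_wpM2r ?sqn_ge0 //.
  have h : S n - S m <= eps / (K + 1).
    by apply/ltW/(le_lt_trans _ HN); rewrite lerB.
  apply: le_trans (ler_wpM2l K0 h) _.
  by rewrite mulrCA ger_pMr // ler_pdivrMr // mul1r lerDl.
have [l sl] := complete cau; exists l; split => //.
  move=> k; apply: (ip_cvg (N := k.+1) sl) => n kn; by rewrite ip_part kn.
apply/ler_addgt0Pl => eps e0.
have [N HN] := sl (eps / 2) ltac:(by rewrite divr_gt0).
have {HN} := HN N (leqnn _); rewrite -/(s N) => HN.
rewrite -[X in sqn X](subrK (s N)); apply: le_trans (sqnD_le _ _) _.
have -> : eps = 2 * (eps / 2) by field.
rewrite lerD // ler_wpM2l //.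
rewrite sqn_part; apply: le_trans (ler_wpM2l K0 (bessel u N)).
by rewrite mulr_sumr; apply: ler_sum => k _; rewrite mulrA ler_wpM2r ?sqn_ge0.
Qed.

Lemma norm_le_sqn x (r : R) : 0 <= r -> sqn x <= r ^+ 2 -> `|x| <= r%:C%C.
Proof.
move=> r0 xr; have r0' : 0 <= r%:C%C :> C by rewrite lecR.
have := @ler_pXn2r C 2 isT `|x| r%:C%C; rewrite !nnegrE normr_ge0 r0'.
by move=> /(_ isT isT) <-; rewrite normV sqnE -rmorphXn lecR.
Qed.

(** Translates the product topology on the graph space, whose balls have radii in R[i], into real
    bounds on squared norms. *)
Lemma closureP (M : set (V * V)) p : closure M p <->
  forall eps : R, 0 < eps -> exists q, [/\ M q, sqn (p.1 - q.1) <= eps & sqn (p.2 - q.2) <= eps].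
Proof.
split=> [Mp eps e0|Mp B].
  pose d := Num.sqrt eps; have d0 : 0 < d by rewrite sqrtr_gt0.
  have /Mp [q [Mq [q1 q2]]] : nbhs p (ball p (d%:C%C : C)).
    by apply: nbhsx_ballx; rewrite ltcR.
  have le x : `|x| < d%:C%C -> sqn x <= eps.
    move=> xd; rewrite -lecR -sqnE -normV -[eps]sqr_sqrtr ?(ltW e0) //.
    by rewrite rmorphXn /= lerXn2r ?nnegrE ?(ltW xd) ?normr_ge0 // lecR ltW.
  by exists q; split => //; apply: le; [move: q1|move: q2]; rewrite -ball_normE.
move=> /nbhs_ballP [d d0 dB].
have [dE dr0] := gt0_complexE d0; set dr := complex.Re d in dE dr0.
have [q [Mq q1 q2]] := Mp ((dr / 2) ^+ 2) ltac:(by rewrite exprn_gt0 // divr_gt0).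
exists q; split => //; apply: dB.
have lt x : sqn x <= (dr / 2) ^+ 2 -> `|x| < d.
  move=> xd; apply: (@le_lt_trans _ _ (dr / 2)%:C%C); last by rewrite dE ltcR; lra.
  by apply: norm_le_sqn => //; rewrite divr_ge0 // ltW.
by split; rewrite -ball_normE; apply: lt.
Qed.

Variables (M : set (V * V)) (lam : nat -> C) (z : C) (d : R).
Hypothesis Mlin : forall a p q, M p -> M q -> M (a *: p.1 + q.1, a *: p.2 + q.2).
Hypothesis M0 : M (0, 0).
Hypothesis eig : forall k, closure M (e k, lam k *: e k).
Hypothesis sym : forall u v k, M (u, v) -> ip v (e k) = lam k * ip u (e k).
Hypothesis tot : forall u, (forall k, ip u (e k) = 0) -> u = 0.
Hypothesis d0 : 0 < d.
Hypothesis gap : forall k, d <= sqm (lam k - z).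

Lemma closure_lin a p q : closure M p -> closure M q ->
  closure M (a *: p.1 + q.1, a *: p.2 + q.2).
Proof.
move=> /closureP Mp /closureP Mq; apply/closureP => eps e0.
have a0 : 0 < 2 * sqm a + 1 by rewrite ltr_wpDl // mulr_ge0 // sqm_ge0.
have [p' [Mp' p1 p2]] := Mp (eps / 2 / (2 * sqm a + 1)) ltac:(by rewrite !divr_gt0).
have [q' [Mq' q1 q2]] := Mq (eps / 4) ltac:(by rewrite divr_gt0).
exists (a *: p'.1 + q'.1, a *: p'.2 + q'.2); split; first exact: Mlin.
all: rewrite /= opprD addrACA -scalerBr; apply: le_trans (sqnD_le _ _) _.
all: have -> : eps = eps / 2 + 2 * (eps / 4) by field.
all: rewrite lerD // ?ler_wpM2l // sqnZ mulrA.
- apply: le_trans (ler_wpM2l _ p1) _; first by rewrite mulr_ge0 // sqm_ge0.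
  rewrite mulrCA ger_pMr ?divr_gt0 // ler_pdivrMr // mul1r; lra.
- apply: le_trans (ler_wpM2l _ p2) _; first by rewrite mulr_ge0 // sqm_ge0.
  rewrite mulrCA ger_pMr ?divr_gt0 // ler_pdivrMr // mul1r; lra.
Qed.

Lemma closure_closed_sqn (s t : nat -> V) u v : sqn_cvg s u -> sqn_cvg t v ->
  (forall n, closure M (s n, t n)) -> closure M (u, v).
Proof.
move=> su tv Mst; apply/closureP => eps e0.
have [N1 H1] := su (eps / 4) ltac:(by rewrite divr_gt0).
have [N2 H2] := tv (eps / 4) ltac:(by rewrite divr_gt0).
have /closureP/(_ (eps / 4)) := Mst (maxn N1 N2).
case=> [|q [Mq q1 q2]]; first by rewrite divr_gt0.
exists q; split => //=.
  rewrite -(subrKA (s (maxn N1 N2))); apply: le_trans (sqnD_le _ _) _.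
  by have := H1 _ (leq_maxl N1 N2); move: q1 => /=; lra.
rewrite -(subrKA (t (maxn N1 N2))); apply: le_trans (sqnD_le _ _) _.
by have := H2 _ (leq_maxr N1 N2); move: q2 => /=; lra.
Qed.

(** Both sides are continuous in (u, v) by Cauchy-Schwarz, so the relation passes from M to its
    closure. *)
Lemma closure_sym u v k : closure M (u, v) -> ip v (e k) = lam k * ip u (e k).
Proof.
move=> /closureP Muv; apply/eqP; rewrite -subr_eq0; apply/negPn/negP => h.
set x := _ - _ in h.
have x0 : 0 < sqm x by rewrite -(@ltcR R) -sqr_normc_sqm exprn_gt0 // normr_gt0.
set q := sqn (e k); have q0 : 0 <= q by exact: sqn_ge0.
have l0 : 0 <= sqm (lam k) by exact: sqm_ge0.
(* If both components are approximated within y, the defect [x] satisfies [sqm x <= y * (K - 1)];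
   taking y = [sqm x / 2 / K] contradicts [0 < sqm x]. *)
set K := 2 * q + 2 * sqm (lam k) * q + 1.
have K0 : 0 < K by rewrite /K ltr_wpDl // addr_ge0 ?mulr_ge0.
have [[u' v'] /= [/(sym k) E u1 v1]] := Muv (sqm x / 2 / K) ltac:(by rewrite !divr_gt0).
have xE : x = ip (v - v') (e k) + - lam k * ip (u - u') (e k).
  by rewrite /x !(ipDl, ipNl) E; ring.
have : sqm x <= sqm x / 2 / K * K.
  rewrite {1}xE; apply: le_trans (sqmD_le _ _) _; rewrite sqmM.
  have -> : sqm (- lam k) = sqm (lam k) by rewrite /sqm !raddfN /= !sqrrN.
  have h1 := le_trans (cauchy_schwarz _ _) (ler_wpM2r q0 v1).
  have h2 := le_trans (cauchy_schwarz _ _) (ler_wpM2r q0 u1).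
  have h3 := ler_wpM2l l0 h2; move: h1 h3; set y := sqm x / 2 / K.
  have y0 : 0 < y by rewrite !divr_gt0.
  rewrite /K; set a := sqm (ip _ _); set b := sqm (ip _ _).
  move=> h1 h3; apply: (@le_trans _ _ (2 * (y * q) + 2 * (sqm (lam k) * (y * q)))).
    by rewrite lerD // ler_wpM2l.
  by lra.
rewrite mulfVK ?gt_eqF //; lra.
Qed.

(** The inverse is the diagonal operator S with entries 1 / (lam k - z), bounded thanks to [gap]. By
    totality, identities between vectors are checked coefficientwise; that S u lies in the domain
    follows from approximation by partial sums, since the closure of M is closed. *)
Theorem resolvent_of_eigenbasis : resolvent_set (closure M) z.
Proof.
have lz k : lam k - z != 0.
  by apply/eqP => lz; have := gap k; rewrite lz /sqm /= expr0n addr0 leNgt d0.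
pose b u k := (lam k - z)^-1 * coef u k.
have bK u k : sqm (b u k) <= d^-1 * sqm (coef u k).
  rewrite sqmM ler_wpM2r ?sqm_ge0 //.
  have : sqm (lam k - z)^-1 * sqm (lam k - z) = 1.
    by rewrite -sqmM mulVf // /sqm /= expr1n expr0n addr0.
  have := gap k; set s := sqm (lam k - z); set t := sqm _ => ds ts.
  have s0 : 0 < s by exact: lt_le_trans ds.
  have sn0 : s != 0 by rewrite gt_eqF.
  have -> : t = s^-1 by rewrite -[LHS](mulfK sn0) ts mul1r.
  by rewrite lef_pV2 ?posrE.
have dV0 : 0 <= d^-1 by rewrite invr_ge0 ltW.
pose S u := projT1 (cid (series_cvg dV0 (bK u))).
have SP u : [/\ sqn_cvg (fun n => \sum_(0 <= k < n) b u k *: e k) (S u),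
    forall k, ip (S u) (e k) = b u k * ip (e k) (e k) & sqn (S u) <= 2 * (d^-1 * sqn u) ].
  exact: projT2 (cid (series_cvg dV0 (bK u))).
have Sip u k : (lam k - z) * ip (S u) (e k) = ip u (e k).
  have [_ h _] := SP u; rewrite h /b -[X in _ * X]mulrA coefK mulrA mulfV ?mul1r //.
(* Vectors are determined by their coefficients, even after weighting by the nonzero factors
   [lam k - z]. This gives linearity of S and the uniqueness half of the resolvent identity. *)
have tot2 u v : (forall k, (lam k - z) * ip u (e k) = (lam k - z) * ip v (e k)) -> u = v.
  move=> uv; apply/eqP; rewrite -subr_eq0; apply/eqP; apply: tot => k.
  by rewrite ipDl ipNl; have /mulfI -> := uv k; rewrite ?subrr.
have Slin : linear S.
  move=> a u v; apply: tot2 => k; rewrite Sip !ipDl !ipZl.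
  by rewrite mulrDr mulrCA !Sip.
pose S' : {linear V -> V} := HB.pack S (GRing.isLinear.Build _ _ _ _ S Slin).
exists S'; split.
  (* On the unit ball the values of S are bounded by the square root of 2 / d, the 2 coming from
     [series_cvg]. *)
  apply: bounded_linear_continuous.
  exists (Num.sqrt (2 * d^-1))%:C%C; split; first by apply: ger0_real; rewrite lecR sqrtr_ge0.
  move=> r /ltW rK; apply/nbhs_ballP; exists 1 => //= x.
  rewrite -ball_normE /= sub0r normrN => x1; apply: le_trans rK.
  apply: norm_le_sqn; rewrite ?sqrtr_ge0 // sqr_sqrtr ?mulr_ge0 //.
  have [_ _] := SP x; move=> /le_trans; apply; rewrite mulrA.
  rewrite -[leRHS]mulr1 ler_wpM2l ?mulr_ge0 // -lecR -sqnE -normV.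
  by rewrite expr_le1 // ltW.
move=> u f; split=> [/closure_sym uf|-> /=].
  apply: tot2 => k; rewrite Sip; have := uf k; rewrite ipDl ipZl => E.
  by rewrite mulrBl -E addrK.
have [Scvg _ _] := SP f.
(* The case [b = coef f], K = 1: the Fourier series of [f] converges, and totality identifies its
   sum with [f]. *)
have [l [lcvg lip _]] := series_cvg (ler01) (fun k => eq_ind_r (fun x => _ <= x) (lexx _)
  (mul1r (sqm (coef f k)))).
have lf : l = f.
  by apply: tot2 => k; rewrite lip coefK.
rewrite lf in lcvg.
apply: (closure_closed_sqn (s := fun n => \sum_(0 <= k < n) b f k *: e k)
   (t := fun n => \sum_(0 <= k < n) b f k *: (lam k *: e k))) => //.
  move=> eps e0.
  have z0 : 0 < 2 * sqm z + 1 by rewrite ltr_wpDl // mulr_ge0 // sqm_ge0.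
  have [N1 H1] := lcvg (eps / 4) ltac:(by rewrite divr_gt0).
  have [N2 H2] := Scvg (eps / 2 / (2 * sqm z + 1)) ltac:(by rewrite !divr_gt0).
  exists (maxn N1 N2) => n; rewrite geq_max => /andP[/H1 h1 /H2 h2].
  (* From lam / (lam - z) = 1 + z / (lam - z): the images of the partial sums of S f tend to f + z S
     f. *)
  have -> : \sum_(0 <= k < n) b f k *: (lam k *: e k) =
     \sum_(0 <= k < n) coef f k *: e k + z *: \sum_(0 <= k < n) b f k *: e k.
    rewrite scaler_sumr -big_split /=; apply: eq_bigr => k _.
    rewrite !scalerA -scalerDl; congr (_ *: _).
    rewrite -[X in X + _](mulVKf (lz k)) -/(b f k); ring.
  rewrite opprD addrACA -scalerBr; apply: le_trans (sqnD_le _ _) _.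
  have -> : eps = 2 * (eps / 4) + eps / 2 by field.
  rewrite lerD // ?ler_wpM2l // sqnZ mulrA.
  apply: le_trans (ler_wpM2l _ h2) _; first by rewrite mulr_ge0 // sqm_ge0.
  rewrite mulrCA ger_pMr ?divr_gt0 // ler_pdivrMr // mul1r; lra.
elim=> [|n IH]; first by rewrite !big_nil; exact: subset_closure.
have /= := closure_lin (a := b f n) (@eig n) IH.
by rewrite ![_ *: _ + \sum_(_ <= _ < _) _]addrC -!big_nat_recr.
Qed.

End hilbert.

(** * The Hilbert space of square-integrable functions *)

Section real_L2.
Context {d : measure_display} {T : measurableType d} {R : realType}.
Variable mu : {measure set T -> \bar R}.
Implicit Types f g h : T -> R.

Definition sqrint f := measurable_fun setT f /\
  mu.-integrable setT (EFin \o (fun x => f x ^+ 2)).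

Lemma le_integrable_fun f g : measurable_fun setT f ->
  (forall x, `|f x| <= g x) -> mu.-integrable setT (EFin \o g) ->
  mu.-integrable setT (EFin \o f).
Proof.
move=> mf fg; apply: le_integrable => //; first exact/measurable_EFinP.
by move=> x _ /=; rewrite lee_fin (le_trans (fg x)) // ler_norm.
Qed.

Lemma integrable_funD f g : mu.-integrable setT (EFin \o f) ->
  mu.-integrable setT (EFin \o g) ->
  mu.-integrable setT (EFin \o (fun x => f x + g x)).
Proof. by move=> fi gi; exact: (integrableD measurableT fi gi). Qed.

Lemma integrable_funB f g : mu.-integrable setT (EFin \o f) ->
  mu.-integrable setT (EFin \o g) ->
  mu.-integrable setT (EFin \o (fun x => f x - g x)).
Proof. by move=> fi gi; exact: (integrableB measurableT fi gi). Qed.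

Lemma integrable_funZ (c : R) f : mu.-integrable setT (EFin \o f) ->
  mu.-integrable setT (EFin \o (fun x => c * f x)).
Proof. by move=> fi; exact: (integrableZl measurableT c fi). Qed.

Lemma Rdominated_cvg (F : nat -> T -> R) f h :
  (forall N, measurable_fun setT (F N)) -> mu.-integrable setT (EFin \o h) ->
  (forall N x, `|F N x| <= h x) -> (forall x, F N x @[N --> \oo] --> f x) ->
  \int[mu]_x F N x @[N --> \oo] --> \int[mu]_x f x.
Proof.
move=> mF ih Fh Ff.
have [|||||fi _ cv] := @dominated_convergence _ _ _ mu setT measurableT
  (fun N => EFin \o F N) (EFin \o f) (EFin \o h).
- by move=> N; exact/measurable_EFinP.
- apply/measurable_EFinP; apply: (measurable_realfun.measurable_fun_cvg mF) => x _.
  exact: Ff.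
- by apply: aeW => x _; apply: cvg_EFin; [exact: nearW|exact: Ff].
- by [].
- by apply: aeW => x N _; rewrite /= lee_fin.
apply: fine_cvg; rewrite /Rintegral fineK //; exact: integrable_fin_num.
Qed.

Lemma sqrint_mul f g : sqrint f -> sqrint g ->
  mu.-integrable setT (EFin \o (fun x => f x * g x)).
Proof.
move=> [mf fi] [mg gi]; apply: le_integrable_fun (integrable_funD fi gi).
  exact: measurable_funM.
move=> x; rewrite normrM -(real_normK (num_real (f x))) -(real_normK (num_real (g x))).
have := sqr_ge0 (`|f x| - `|g x|).
have := sqr_ge0 (`|f x|); have := sqr_ge0 (`|g x|); nra.
Qed.

Lemma sqrintD f g : sqrint f -> sqrint g -> sqrint (fun x => f x + g x).
Proof.
move=> sf sg; have [mf fi] := sf; have [mg gi] := sg.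
split; first exact: measurable_funD.
have := integrable_funD (integrable_funD fi gi) (integrable_funZ 2 (sqrint_mul sf sg)).
apply: eq_integrable => // x _ /=; congr EFin; ring.
Qed.

Lemma sqrintZ (c : R) f : sqrint f -> sqrint (fun x => c * f x).
Proof.
move=> [mf fi]; split; first exact: measurable_funM.
have := integrable_funZ (c ^+ 2) fi.
by apply: eq_integrable => // x _ /=; rewrite exprMn.
Qed.

Lemma sqrintB f g : sqrint f -> sqrint g -> sqrint (fun x => f x - g x).
Proof.
move=> sf sg; have := sqrintD sf (sqrintZ (-1) sg).
by under eq_fun do rewrite mulN1r.
Qed.

Lemma sqrint_le f g : measurable_fun setT f -> (forall x, `|f x| <= g x) ->
  sqrint g -> sqrint f.
Proof.
move=> mf fg [mg gi]; split => //; apply: le_integrable_fun gi.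
  exact: measurable_funX.
by move=> x; rewrite normrX lerXn2r ?nnegrE // (le_trans _ (fg x)).
Qed.

Lemma summable_cvg (u : nat -> R) (B : R) :
  (forall n, \sum_(0 <= k < n) `|u k.+1 - u k| <= B) -> cvgn u.
Proof.
move=> uB; have : cvgn (series (telescope u)).
  apply: normed_cvg; apply: nondecreasing_is_cvgn.
    by apply/nondecreasing_seqP => n; rewrite /= !seriesEnat /= big_nat_recr //= lerDl.
  by exists B => _ [n _ <-]; exact: uB.
rewrite telescopeK => /cvg_ex[l ul]; apply/cvg_ex; exists (l + u 0%N).
have : (u n - u 0%N) + u 0%N @[n --> \oo] --> l + u 0%N.
  by apply: cvgD => //; exact: cvg_cst.
by under eq_fun do rewrite subrK.
Qed.

(** Riesz-Fischer with integrals of squares only. Along a fast subsequence with increments D k, the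
    series F of 2^k (D k)^2 has integral at most 1, so it is finite almost everywhere; as |D k| <=
    2^-k + 2^k (D k)^2, the subsequence converges wherever F is finite. Fatou then turns the
    pointwise limit into a limit in mean square. *)
Lemma sqrint_complete (s : nat -> T -> R) : (forall n, sqrint (s n)) ->
  (forall eps : R, 0 < eps -> exists N, forall m n, (N <= m)%N -> (m <= n)%N ->
     \int[mu]_x (s n x - s m x) ^+ 2 <= eps) ->
  exists l, sqrint l /\ forall eps : R, 0 < eps ->
    exists N, forall n, (N <= n)%N -> \int[mu]_x (l x - s n x) ^+ 2 <= eps.
Proof.
move=> ss cau.
have ms n : measurable_fun setT (s n) by have [] := ss n.
have e0 k : 0 < ((2 ^ k)%:R * (2 ^ k.+1)%:R)^-1 :> R.
  by rewrite invr_gt0 mulr_gt0 // ltr0n expn_gt0.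
have [N HN] := choice (fun k => cau _ (e0 k)).
(* Summing the thresholds makes [phi] monotone and at least [N k]; the extra k makes it at least k,
   hence cofinal. *)
pose phi k := (\sum_(i < k.+1) N i + k)%N.
have phiN k : (N k <= phi k)%N by rewrite /phi big_ord_recr /= -addnA addnCA leq_addr.
have phiS k : (phi k <= phi k.+1)%N.
  by rewrite /phi [in leqRHS]big_ord_recr /= leq_add // leq_addr.
have phik k : (k <= phi k)%N by rewrite /phi leq_addl.
pose D k x := s (phi k.+1) x - s (phi k) x.
have sD k : sqrint (D k) by exact: sqrintB.
have mD2 k : measurable_fun setT (fun x => ((2 ^ k)%:R * D k x ^+ 2)%:E).
  by have [_ /(integrable_funZ (2 ^ k)%:R) /measurable_int] := sD k.
have D20 k x : (0 <= ((2 ^ k)%:R * D k x ^+ 2)%:E)%E.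
  by rewrite lee_fin mulr_ge0 // sqr_ge0.
pose F x := (\sum_(0 <= k <oo) ((2 ^ k)%:R * D k x ^+ 2)%:E)%E.
have F0 x : (0 <= F x)%E by apply: nneseries_ge0 => k _ _; exact: D20.
have mF : measurable_fun setT F.
  by apply: ge0_emeasurable_sum => // k x _ _; exact: D20.
have intF : mu.-integrable setT F.
  apply/integrableP; split => //; under eq_integral do rewrite gee0_abs //.
  rewrite integral_nneseries //.
  apply: (@le_lt_trans _ _ (1%:E)); last by rewrite ltry.
  apply: le_trans (epsilon_trick0 xpredT (ler01)).
  apply: lee_nneseries => [k _ _|k _]; first by apply: integral_ge0 => x _; exact: D20.
  have := HN k (phi k) (phi k.+1) (phiN k) (phiS k).
  have [mDk iD] := sD k.
  move=> h; have -> : (\int[mu]_x ((2 ^ k)%:R * D k x ^+ 2)%:E)%E =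
      ((2 ^ k)%:R * \int[mu]_x (D k x ^+ 2))%:E.
    rewrite -(RintegralZl _ measurableT iD) /Rintegral fineK //.
    exact: (integrable_fin_num measurableT (integrable_funZ _ iD)).
  rewrite lee_fin; apply: le_trans (ler_wpM2l _ h) _ => //.
  rewrite invfM mulrA mulfV ?mul1r // pnatr_eq0 -lt0n expn_gt0 //.
(* Truncating both the limit and the subsequence to 0 on the null set where F is infinite makes the
   convergence hold everywhere, which gives measurability of [l]. *)
pose l x := if F x \is a fin_num then limn (fun k => s (phi k) x) else 0.
pose s' k x := if F x \is a fin_num then s (phi k) x else 0.
have cvgs x : F x \is a fin_num -> cvgn (fun k => s (phi k) x).
  move=> Fx; apply: (@summable_cvg _ (2 + fine (F x))) => n.
  apply: (@le_trans _ _ (\sum_(0 <= k < n) ((2 ^ k)%:R^-1 + (2 ^ k)%:R * D k x ^+ 2))).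
    apply: ler_sum => k _; rewrite -/(D k x).
    have a0 : 0 < (2 ^ k)%:R :> R by rewrite ltr0n expn_gt0.
    set a := (2 ^ k)%:R in a0 *; rewrite -subr_ge0 -(real_normK (num_real (D k x))).
    have -> : a^-1 + a * `|D k x| ^+ 2 - `|D k x| =
       a^-1 * ((a * `|D k x| - 2^-1) ^+ 2 + 3 / 4).
      by field; rewrite gt_eqF.
    by rewrite mulr_ge0 ?invr_ge0 ?ltW // ltr_wpDl // sqr_ge0.
  rewrite big_split /=; apply: lerD.
    have -> : \sum_(0 <= k < n) ((2 ^ k)%:R^-1 : R) = 2 - 2 * (2 ^ n)%:R^-1.
      elim: n => [|n IH]; first by rewrite big_nil expn0 invr1 mulr1 subrr.
      rewrite big_nat_recr //= IH expnS natrM invfM.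
      by field; rewrite natrX expf_neq0.
    by rewrite gerBl mulr_ge0 // invr_ge0.
  rewrite -lee_fin fineK // -sumEFin.
  by apply: nneseries_lim_ge => k _ _; exact: D20.
have Ffin : {ae mu, forall x, F x \is a fin_num}.
  by have := integrable_ae measurableT intF; apply: filterS => x; apply.
have mFfin : measurable [set x | F x \is a fin_num].
  by have := emeasurable_fin_num measurableT mF; rewrite setTI.
have ms' k : measurable_fun setT (s' k).
  apply: measurable_fun_ifT => //; apply: (measurable_fun_bool true).
  by rewrite setTI preimage_true.
have ml : measurable_fun setT l.
  apply: (measurable_realfun.measurable_fun_cvg ms') => x _.
  rewrite /s' /l; case: ifPn => Fx; last exact: cvg_cst.
  exact: cvgs.
(* Fatou for (s (phi k) - s n)^2 as k grows. The bound is stated for the extended integral because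
   square integrability of [l] is not yet known. *)
have key eps M : (forall m n, (M <= m)%N -> (m <= n)%N ->
    \int[mu]_x (s n x - s m x) ^+ 2 <= eps) ->
    forall n, (M <= n)%N -> (\int[mu]_x ((l x - s n x) ^+ 2)%:E <= eps%:E)%E.
  move=> HM n Mn.
  have msq (a b : T -> R) : measurable_fun setT a -> measurable_fun setT b ->
      measurable_fun setT (fun x => ((a x - b x) ^+ 2)%:E).
    by move=> ma mb; apply/measurable_EFinP; apply: measurable_funX; exact: measurable_funB.
  pose u k x := ((s (phi k) x - s n x) ^+ 2)%:E.
  have mu_ k : measurable_fun setT (u k) by exact: msq.
  have u0 k x : (0 <= u k x)%E by rewrite lee_fin sqr_ge0.
  have E : (\int[mu]_x ((l x - s n x) ^+ 2)%:E = \int[mu]_x limn_einf (u^~ x))%E.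
    apply: ge0_ae_eq_integral => //.
    - exact: msq.
    - rewrite /limn_einf; apply: measurableT_comp => //.
      by apply: measurable_fun_limn_esup => k; exact: measurableT_comp.
    - by move=> x _; rewrite lee_fin sqr_ge0.
    - move=> x _; rewrite limn_einf_lim; apply: lime_ge; first exact: is_cvg_einfs.
      apply: nearW => m; apply: le_ereal_inf_tmp => _ [j _ <-]; exact: u0.
    apply: filterS Ffin => x Fx _.
    have /cvg_limn_einf_sup[-> _] // : u k x @[k --> \oo] --> ((l x - s n x) ^+ 2)%:E.
    apply: cvg_EFin; first exact: nearW.
    rewrite /l Fx; have := cvgs _ Fx => h.
    have hB : s (phi k) x - s n x @[k --> \oo] --> limn (fun k => s (phi k) x) - s n x.
      by apply: cvgB => //; exact: cvg_cst.
    by rewrite expr2; apply: cvgM.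
  rewrite E; apply: le_trans (fatou mu measurableT mu_ (fun k x _ => u0 k x)) _.
  rewrite limn_einf_lim; apply: lime_le; first exact: is_cvg_einfs.
  apply: nearW => m; apply: ge_ereal_inf.
  exists (\int[mu]_x u (maxn m n) x)%E.
    by exists (maxn m n) => //=; exact: leq_maxl.
  have iu : mu.-integrable setT (u (maxn m n)) by have [_] := sqrintB (ss (phi (maxn m n))) (ss n).
  rewrite -[leLHS]fineK; last exact: integrable_fin_num.
  by rewrite lee_fin; apply: HM => //; exact: leq_trans (leq_maxr m n) (phik _).
(* The bound [key] for eps = 1 places [l - s M1], and hence [l], among the square-integrable
   functions. *)
have [M1 HM1] := cau 1 ltr01.
have m1 : measurable_fun setT (EFin \o (fun x => (l x - s M1 x) ^+ 2)).
  by apply/measurable_EFinP; apply: measurable_funX; exact: measurable_funB.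
have sl1 : sqrint (fun x => l x - s M1 x).
  split; first exact: measurable_funB.
  apply/integrableP; split => //.
  apply: (@le_lt_trans _ _ 1%:E); last by rewrite ltry.
  apply: le_trans (key _ _ HM1 _ (leqnn _)); apply: ge0_le_integral => //.
  - exact: measurableT_comp.
  - by move=> x _ /=; rewrite ger0_norm // sqr_ge0.
have sl : sqrint l.
  by have := sqrintD sl1 (ss M1); under eq_fun do rewrite subrK.
exists l; split => // eps eps0; have [M HM] := cau eps eps0; exists M => n Mn.
have := key _ _ HM _ Mn; have [_ il] := sqrintB sl (ss n).
by rewrite -lee_fin /Rintegral fineK //; exact: integrable_fin_num.
Qed.

End real_L2.

Section complex_L2.
Context {d : measure_display} {T : measurableType d} {R : realType}.
Variable mu : {measure set T -> \bar R}.
Local Notation C := R[i].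
Implicit Types (f g h : L2fun mu) (u v w : L2 mu).

Definition fre (f : T -> C) (x : T) : R := complex.Re (f x).
Definition fim (f : T -> C) (x : T) : R := complex.Im (f x).

Lemma Rintegral_ae_eq (f g : T -> R) :
  measurable_fun setT f -> measurable_fun setT g ->
  {ae mu, forall x, f x = g x} -> \int[mu]_x f x = \int[mu]_x g x.
Proof.
move=> mf mg fg; rewrite /Rintegral; congr fine.
apply: ae_eq_integral => //; [exact/measurable_EFinP|exact/measurable_EFinP|].
by apply: filterS fg => x -> _.
Qed.

Lemma cabs_sqr (f : T -> C) x : cabs f x ^+ 2 = fre f x ^+ 2 + fim f x ^+ 2.
Proof.
rewrite /cabs /fre /fim; case: (f x) => a b /=.
by rewrite sqr_sqrtr // addr_ge0 ?sqr_ge0.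
Qed.

Lemma Lnorm2_sqr (f : T -> R) :
  ('N[mu]_2%:E[EFin \o f] `^ 2)%E = (\int[mu]_x (f x ^+ 2)%:E)%E.
Proof.
rewrite poweR_Lnorm //; apply: eq_integral => x _ /=.
by rewrite powR_mulrn // real_normK // num_real.
Qed.

Lemma square_integrableP (f : T -> C) : square_integrable mu f <->
  sqrint mu (fre f) /\ sqrint mu (fim f).
Proof.
have ge0 x : (0 <= (cabs f x ^+ 2)%:E)%E by rewrite lee_fin sqr_ge0.
split=> [[mr mi fin]|[[mr ir] [mi ii]]].
  have mc := measurable_cabs mr mi.
  have ic : mu.-integrable setT (EFin \o (fun x => cabs f x ^+ 2)).
    apply: Lfun2_integrable_sqr; apply: cabs_Lfun; by split.
  split; split => //; apply: le_integrable_fun ic.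
  - exact: measurable_funX.
  - by move=> x; rewrite cabs_sqr ger0_norm ?sqr_ge0 // lerDl sqr_ge0.
  - exact: measurable_funX.
  - by move=> x; rewrite cabs_sqr ger0_norm ?sqr_ge0 // lerDr sqr_ge0.
split => //; rewrite /finite_norm.
have : ('N[mu]_2%:E[EFin \o cabs f] `^ 2 < +oo)%E.
  rewrite Lnorm2_sqr.
  have /integrable_lty := integrable_funD ir ii; move=> /(_ measurableT).
  by congr (_ < _)%E; apply: eq_integral => x _ /=; rewrite cabs_sqr.
have := Lnorm_ge0 mu 2%:E (EFin \o cabs f).
case: ('N[mu]_2%:E[EFin \o cabs f])%E => [r| |] //= _; first by rewrite !ltry.
by rewrite pnatr_eq0.
Qed.

Lemma L2fun_sqrint f : sqrint mu (fre f) /\ sqrint mu (fim f).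
Proof. by apply/square_integrableP; have := L2valP f; rewrite inE. Qed.

Lemma L2fun_ex (f : T -> C) : sqrint mu (fre f) -> sqrint mu (fim f) ->
  {g : L2fun mu | (g : T -> C) = f}.
Proof.
move=> sr si; have fP : f \in sqint mu by rewrite inE; exact/square_integrableP.
by exists (MkL2fun fP).
Qed.

(** The integral of f times the conjugate of g, split into real and imaginary parts. *)
Definition ipf f g : C :=
  (\int[mu]_x (fre f x * fre g x + fim f x * fim g x) +i*
   \int[mu]_x (fim f x * fre g x - fre f x * fim g x))%C.

Lemma ipf_int1 f g : mu.-integrable setT
  (EFin \o (fun x => fre f x * fre g x + fim f x * fim g x)).
Proof.
have [fr fi] := L2fun_sqrint f; have [gr gi] := L2fun_sqrint g.
by apply: integrable_funD; exact: sqrint_mul.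
Qed.

Lemma ipf_int2 f g : mu.-integrable setT
  (EFin \o (fun x => fim f x * fre g x - fre f x * fim g x)).
Proof.
have [fr fi] := L2fun_sqrint f; have [gr gi] := L2fun_sqrint g.
by apply: integrable_funB; exact: sqrint_mul.
Qed.

Lemma measurable_int_fun (h : T -> R) : mu.-integrable setT (EFin \o h) ->
  measurable_fun setT h.
Proof. by move=> /measurable_int /measurable_EFinP. Qed.

Lemma ipf_ae f f' g g' : {ae mu, forall x, f x = f' x} ->
  {ae mu, forall x, g x = g' x} -> ipf f g = ipf f' g'.
Proof.
move=> ff' gg'; rewrite /ipf.
congr (_ +i* _)%C; apply: Rintegral_ae_eq.
- exact/measurable_int_fun/ipf_int1.
- exact/measurable_int_fun/ipf_int1.
- by apply: filterS2 ff' gg' => x; rewrite /fre /fim => -> ->.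
- exact/measurable_int_fun/ipf_int2.
- exact/measurable_int_fun/ipf_int2.
- by apply: filterS2 ff' gg' => x; rewrite /fre /fim => -> ->.
Qed.

Definition ip u v : C := ipf (L2repr u) (L2repr v).

Lemma ip_class f g : ip (L2class f) (L2class g) = ipf f g.
Proof. by apply: ipf_ae; exact: ae_L2repr. Qed.

Lemma L2fun_ptD f g x : fre (f + g) x = fre f x + fre g x /\
  fim (f + g) x = fim f x + fim g x.
Proof. by rewrite /fre /fim -!raddfD. Qed.

Lemma L2fun_ptB f g x : fre (f - g) x = fre f x - fre g x /\
  fim (f - g) x = fim f x - fim g x.
Proof. by rewrite /fre /fim -!raddfB. Qed.

Lemma L2fun_ptZ (a b : R) f x :
  fre ((a +i* b)%C *: f) x = a * fre f x - b * fim f x /\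
  fim ((a +i* b)%C *: f) x = a * fim f x + b * fre f x.
Proof.
rewrite /fre /fim; have -> : ((a +i* b)%C *: f) x = (a +i* b)%C * f x by [].
by case: (f x).
Qed.

Lemma L2classB f g : L2class (f - g) = L2class f - L2class g.
Proof. by apply: (addIr (L2class g)); rewrite -L2classD !subrK. Qed.

Lemma ipDl u v w : ip (u + v) w = ip u w + ip v w.
Proof.
rewrite -[u]L2reprK -[v]L2reprK -[w]L2reprK -L2classD !ip_class.
move: (L2repr u) (L2repr v) (L2repr w) => f g h.
apply/eqP; rewrite /ipf eq_complex /=; apply/andP; split; apply/eqP.
  rewrite -(RintegralD measurableT (ipf_int1 f h) (ipf_int1 g h)).
  apply: eq_Rintegral => x _; have [-> ->] := L2fun_ptD f g x; ring.
rewrite -(RintegralD measurableT (ipf_int2 f h) (ipf_int2 g h)).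
apply: eq_Rintegral => x _; have [-> ->] := L2fun_ptD f g x; ring.
Qed.

Lemma ipZl a u w : ip (a *: u) w = a * ip u w.
Proof.
rewrite -[u]L2reprK -[w]L2reprK -[a *: _]L2classZ !ip_class.
move: (L2repr u) (L2repr w) => f h; case: a => a b.
have i1 := ipf_int1 f h; have i2 := ipf_int2 f h.
apply/eqP; rewrite /ipf eq_complex /=; apply/andP; split; apply/eqP.
  rewrite -(RintegralZl a measurableT i1) -(RintegralZl b measurableT i2).
  rewrite -(RintegralB measurableT (integrable_funZ a i1) (integrable_funZ b i2)).
  apply: eq_Rintegral => x _; have [-> ->] := L2fun_ptZ a b f x; ring.
rewrite -(RintegralZl a measurableT i2) -(RintegralZl b measurableT i1).
rewrite -(RintegralD measurableT (integrable_funZ a i2) (integrable_funZ b i1)).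
apply: eq_Rintegral => x _; have [-> ->] := L2fun_ptZ a b f x; ring.
Qed.

Lemma ipC u v : ip u v = (ip v u)^*.
Proof.
rewrite -[u]L2reprK -[v]L2reprK !ip_class.
move: (L2repr u) (L2repr v) => f h.
apply/eqP; rewrite /ipf eq_complex /=; apply/andP; split; apply/eqP.
  by apply: eq_Rintegral => x _; ring.
rewrite -mulN1r -(RintegralZl (-1) measurableT (ipf_int2 _ _)).
by apply: eq_Rintegral => x _; ring.
Qed.

Lemma normL2 u : `|u| ^+ 2 = ip u u.
Proof.
rewrite -[u]L2reprK ip_class; move: (L2repr u) => f.
rewrite -[`|_|]/(L2norm (L2class f)) L2norm_class -rmorphXn.
apply/eqP; rewrite /ipf eq_complex /=; apply/andP; split; apply/eqP; last first.
  under eq_Rintegral do rewrite mulrC subrr.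
  by rewrite Rintegral_cst // mul0r.
apply: EFin_inj; rewrite /Rintegral fineK; last exact: (integrable_fin_num measurableT
  (ipf_int1 f f)).
have -> : ((L2fun_norm f ^+ 2)%:E = (L2fun_norm f)%:E `^ 2)%E.
  by rewrite poweR_EFin powR_mulrn // fine_ge0 // Lnorm_ge0.
rewrite L2fun_normE Lnorm2_sqr; apply: eq_integral => x _.
by rewrite cabs_sqr !expr2.
Qed.

Lemma sqn_class f : sqn ip (L2class f) =
  \int[mu]_x (fre f x ^+ 2) + \int[mu]_x (fim f x ^+ 2).
Proof.
have [[_ fr] [_ fi]] := L2fun_sqrint f.
rewrite /sqn ip_class /ipf /= -(RintegralD measurableT fr fi).
by apply: eq_Rintegral => x _; rewrite !expr2.
Qed.

Lemma L2_complete (s : nat -> L2 mu) :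
  (forall eps : R, 0 < eps -> exists N, forall m n, (N <= m)%N -> (m <= n)%N ->
     sqn ip (s n - s m) <= eps) ->
  exists l, sqn_cvg ip s l.
Proof.
move=> cau; pose f n := L2repr (s n).
have sE m n : s n - s m = L2class (f n - f m) by rewrite L2classB !L2reprK.
have ge0 (h : T -> R) : 0 <= \int[mu]_x (h x ^+ 2).
  by apply: Rintegral_ge0 => x _; exact: sqr_ge0.
have [n|eps e0|lr [slr Hr]] := @sqrint_complete _ _ _ mu (fun n => fre (f n)).
- by have [] := L2fun_sqrint (f n).
- have [N HN] := cau _ e0; exists N => m n Nm mn.
  apply: le_trans (HN _ _ Nm mn); rewrite sE sqn_class.
  apply: le_trans (_ : _ <= \int[mu]_x (fre (f n - f m) x ^+ 2)) _.
    rewrite le_eqVlt; apply/orP; left; apply/eqP; apply: eq_Rintegral => x _.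
    by have [-> _] := L2fun_ptB (f n) (f m) x.
  by rewrite lerDl.
have [n|eps e0|li [sli Hi]] := @sqrint_complete _ _ _ mu (fun n => fim (f n)).
- by have [] := L2fun_sqrint (f n).
- have [N HN] := cau _ e0; exists N => m n Nm mn.
  apply: le_trans (HN _ _ Nm mn); rewrite sE sqn_class.
  apply: le_trans (_ : _ <= \int[mu]_x (fim (f n - f m) x ^+ 2)) _.
    rewrite le_eqVlt; apply/orP; left; apply/eqP; apply: eq_Rintegral => x _.
    by have [_ ->] := L2fun_ptB (f n) (f m) x.
  by rewrite lerDr.
have [g gE] := @L2fun_ex (fun x => (lr x +i* li x)%C) slr sli.
exists (L2class g) => eps e0.
have [N1 H1] := Hr (eps / 2) (divr_gt0 e0 (ltr0Sn R 1)).
have [N2 H2] := Hi (eps / 2) (divr_gt0 e0 (ltr0Sn R 1)).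
exists (maxn N1 N2) => n; rewrite geq_max => /andP[/H1 h1 /H2 h2].
rewrite -[s n]L2reprK -L2classB sqn_class (splitr eps); apply: lerD.
  apply: le_trans h1; rewrite le_eqVlt; apply/orP; left; apply/eqP.
  by apply: eq_Rintegral => x _; have [-> _] := L2fun_ptB g (f n) x; rewrite {1}/fre gE.
apply: le_trans h2; rewrite le_eqVlt; apply/orP; left; apply/eqP.
by apply: eq_Rintegral => x _; have [_ ->] := L2fun_ptB g (f n) x; rewrite {1}/fim gE.
Qed.

End complex_L2.

(** * Determinacy of exponentially integrable weights by their moments *)

Section sign_iteration.
Context {R : realType}.

(** The Newton-Schulz iteration for the sign: an odd cubic with fixed points -1, 0, 1 that maps
    [-1, 1] to itself. Being a polynomial, it preserves multipliers. *)
Definition sgstep (y : R) := 2^-1 * (3 * y - y ^+ 3).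

Lemma sgstepN y : sgstep (- y) = - sgstep y.
Proof. by rewrite /sgstep; ring. Qed.

Lemma sgstep_itv y : 0 <= y <= 1 -> y <= sgstep y <= 1.
Proof.
move=> /andP[y0 y1]; apply/andP; split; rewrite -subr_ge0 /sgstep.
  have -> : 2^-1 * (3 * y - y ^+ 3) - y = 2^-1 * y * (1 - y) * (1 + y) by field.
  by rewrite !mulr_ge0 ?subr_ge0 // addr_ge0.
have -> : 1 - 2^-1 * (3 * y - y ^+ 3) = 2^-1 * (1 - y) ^+ 2 * (2 + y) by field.
by apply: mulr_ge0; [rewrite mulr_ge0 ?sqr_ge0 // invr_ge0|rewrite addr_ge0].
Qed.

Lemma sgstep_norm y : `|y| <= 1 -> `|sgstep y| <= 1.
Proof.
wlog y0 : y / 0 <= y => [H|].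
  have [/H//|/ltW yn] := leP 0 y; rewrite -normrN => h.
  by rewrite -normrN -sgstepN; apply: H; rewrite ?oppr_ge0.
rewrite ger0_norm // => y1; have := @sgstep_itv y; rewrite y0 y1 => /(_ isT).
by move=> /andP[h1 h2]; rewrite ger0_norm // (le_trans y0).
Qed.

(** For y > 0 the iterates t stay above y, and 1 - t is multiplied at each step by (1 - t) (2 + t) /
    2 <= 1 - y / 2, so the convergence to 1 is geometric; oddness gives the negative side. *)
Lemma cvg_iter_sgstep (y : R) : `|y| <= 1 ->
  (fun N => iter N sgstep y) @ \oo --> Num.sg y.
Proof.
wlog y0 : y / 0 <= y => [H|].
  have [/H//|/ltW yn] := leP 0 y; rewrite -normrN => h.
  have := H (- y); rewrite oppr_ge0 => /(_ yn h) => /cvgN; rewrite sgrN opprK.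
  have -> // : (- (fun N => iter N sgstep (- y))) = (fun N => iter N sgstep y).
  apply/funext => N; rewrite -[LHS]/(- iter N sgstep (- y)).
  by elim: N => [|N IH] /=; rewrite ?opprK // -sgstepN IH.
rewrite ger0_norm // => y1.
have [<-|yn0] := eqVneq 0 y.
  rewrite sgr0; have -> : (fun N => iter N sgstep 0) = (fun=> 0); last exact: cvg_cst.
  by apply/funext; elim=> //= N ->; rewrite /sgstep expr0n /= mulr0 subrr mulr0.
have yp : 0 < y by rewrite lt_def eq_sym yn0.
rewrite gtr0_sg //.
have H N : y <= iter N sgstep y <= 1 /\ 1 - iter N sgstep y <= (1 - y / 2) ^+ N.
  elim: N => [|N [/andP[h1 h2] h3]] /=.
    by rewrite lexx y1; split => //; rewrite expr0; lra.
  set t := iter N sgstep y in h1 h2 h3 *.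
  have /andP[h4 h5] := @sgstep_itv t ltac:(by rewrite h2 (le_trans y0 h1)).
  split; first by rewrite h5 (le_trans h1).
  rewrite exprS.
  have -> : 1 - sgstep t = (1 - t) * ((1 - t) * (2 + t) / 2) by rewrite /sgstep; field.
  rewrite [leRHS]mulrC; apply: ler_pM => //; first by rewrite subr_ge0.
    by rewrite divr_ge0 // mulr_ge0 ?subr_ge0 // addr_ge0 // (le_trans y0).
  by nra.
apply: (@squeeze_cvgr _ _ _ _ (fun N => 1 - (1 - y / 2) ^+ N) (fun=> 1)).
- by apply: nearW => N; have [/andP[_ ->] h] := H N; rewrite andbT; lra.
- rewrite -[X in _ --> X]subr0; apply: cvgB; first exact: cvg_cst.
  by apply: cvg_expr; rewrite ger0_norm; lra.
- exact: cvg_cst.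
Qed.

Lemma sg_sin (u : R) : `|u| < pi -> Num.sg (sin u) = Num.sg u.
Proof.
have H (v : R) : 0 <= v < pi -> Num.sg (sin v) = Num.sg v.
  move=> /andP[v0 vpi]; have [<-|v0'] := eqVneq 0 v; first by rewrite sin0.
  have vp : 0 < v by rewrite lt_def eq_sym v0'.
  by rewrite !gtr0_sg // sin_gt0_pi // vp.
have [u0|/ltW u0] := leP 0 u.
  by rewrite ger0_norm // => h; apply: H; rewrite u0.
rewrite ler0_norm // => h; apply: oppr_inj.
by rewrite -!sgrN -sinN H // oppr_ge0 u0.
Qed.

Lemma partial_exp_le (x : R) N : 0 <= x ->
  \sum_(0 <= k < N) x ^+ k / k`!%:R <= expR x.
Proof.
move=> x0; have := @nondecreasing_cvgn_le R (series (exp_coeff x)).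
move=> /(_ _ (is_cvg_series_exp_coeff x) N); apply.
apply/nondecreasing_seqP => n; rewrite !seriesEnat /= big_nat_recr //= lerDl.
exact: exp_coeff_ge0.
Qed.

End sign_iteration.

(** * Weights with vanishing moments and their multipliers *)

Section moments.
Context {R : realType} {n : nat}.
Variable mu : {measure set 'rV[R]_n -> \bar R}.
Local Notation T := 'rV[R]_n.
Implicit Types (g : T -> R) (phi : T -> R).

Definition l1 (x : T) : R := \sum_(i < n) `|x 0 i|.
(** Monomials are lists of indices with repetition, so that multiplying by a coordinate adds one
    letter. *)
Definition word (t : seq 'I_n) (x : T) : R := \prod_(i <- t) x 0 i.

Lemma measurable_coord i : measurable_fun setT (fun x : T => x 0 i : R).
Proof. exact: (@measurable_mx_coord _ (measurableTypeR R)). Qed.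

Lemma measurable_l1 : measurable_fun setT l1.
Proof.
apply: measurable_sum => i; apply: measurableT_comp => //.
exact: measurable_coord.
Qed.

Lemma measurable_word t : measurable_fun setT (word t).
Proof.
apply: measurable_prod => i _; exact: measurable_coord.
Qed.

Lemma coord_le_l1 i (x : T) : `|x 0 i| <= l1 x.
Proof. by rewrite /l1 (bigD1 i) //= lerDl sumr_ge0. Qed.

Lemma l1_ge0 x : 0 <= l1 x.
Proof. exact: sumr_ge0. Qed.

Lemma word_le t x : `|word t x| <= expR ((size t)%:R * l1 x).
Proof.
rewrite /word; elim: t => [|i t IH]; first by rewrite big_nil normr1 mul0r expR0.
rewrite big_cons normrM -natr1 mulrDl mul1r addrC expRD ler_pM //.
apply: le_trans (coord_le_l1 i x) _; apply: le_trans (expR_ge1Dx _).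
by rewrite lerDr.
Qed.

(** Integrability against [expR (c * l1 x)] for every c is much stronger than existence of moments:
    it provides the dominating functions for power series in the coordinates. *)
Definition null_moments g := [/\ measurable_fun setT g,
  forall c : R, mu.-integrable setT (EFin \o (fun x => expR (c * l1 x) * g x))
  & forall t, \int[mu]_x (word t x * g x) = 0].

Lemma null_moments_int g t c : null_moments g ->
  mu.-integrable setT (EFin \o (fun x => word t x * (expR (c * l1 x) * g x))).
Proof.
move=> [mg ig _].
have := ig ((size t)%:R + c) => /integrable_norm; apply: le_integrable_fun.
  apply: measurable_funM; first exact: measurable_word.
  apply: measurable_funM => //; apply: measurableT_comp => //.
  by apply: measurable_funM => //; exact: measurable_l1.
move=> x /=; rewrite mulrDl expRD -mulrA normrM [leRHS]normrM.
by rewrite ler_wpM2r // [leRHS]ger0_norm ?expR_ge0 // word_le.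
Qed.

Lemma null_moments_intw g t : null_moments g ->
  mu.-integrable setT (EFin \o (fun x => word t x * g x)).
Proof.
move=> /(@null_moments_int g t 0); apply: eq_integrable => // x _ /=.
by rewrite mul0r expR0 mul1r.
Qed.

Lemma null_momentsD (a b : R) f g : null_moments f -> null_moments g ->
  null_moments (fun x => a * f x + b * g x).
Proof.
move=> Gf Gg; have [mf if_ f0] := Gf; have [mg ig g0] := Gg; split.
- by apply: measurable_funD; exact: measurable_funM.
- move=> c; have := integrable_funD (integrable_funZ a (if_ c)) (integrable_funZ b (ig c)).
  by apply: eq_integrable => // x _ /=; congr EFin; ring.
- move=> t; have i1 := null_moments_intw t Gf; have i2 := null_moments_intw t Gg.
  transitivity (a * \int[mu]_x (word t x * f x) + b * \int[mu]_x (word t x * g x)).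
    rewrite -(RintegralZl _ measurableT i1) -(RintegralZl _ measurableT i2).
    rewrite -(RintegralD measurableT (integrable_funZ a i1) (integrable_funZ b i2)).
    by apply: eq_Rintegral => x _; ring.
  by rewrite f0 g0 !mulr0 addr0.
Qed.

Lemma null_moments_coord i g : null_moments g ->
  null_moments (fun x => x 0 i * g x).
Proof.
move=> Gg; have [mg ig g0] := Gg; split.
- by apply: measurable_funM => //; exact: measurable_coord.
- move=> c; have := null_moments_int [:: i] c Gg.
  by apply: eq_integrable => // x _ /=; rewrite /word big_seq1 mulrCA.
- move=> t; have := g0 (rcons t i).
  under eq_Rintegral do rewrite /word -cats1 big_cat big_seq1 /= -mulrA.
  by [].
Qed.

Lemma null_moments_exp i k g : null_moments g ->
  null_moments (fun x => x 0 i ^+ k * g x).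
Proof.
move=> Gg; elim: k => [|k /(null_moments_coord i)].
  by under eq_fun do rewrite expr0 mul1r.
by under eq_fun do rewrite mulrA -exprS.
Qed.

Lemma null_moments_sum (I : Type) (r : seq I) (a : I -> R) (F : I -> T -> R) :
  mu.-integrable setT (EFin \o (fun=> 0 : R)) ->
  (forall i, null_moments (F i)) ->
  null_moments (fun x => \sum_(i <- r) a i * F i x).
Proof.
move=> i0 GF; elim: r => [|i r IH].
  under eq_fun do rewrite big_nil; split => //.
    by move=> c; under eq_fun do rewrite mulr0.
  by move=> t; under eq_Rintegral do rewrite mulr0; rewrite Rintegral_cst // mul0r.
have := null_momentsD (a i) 1 (GF i) IH.
by congr null_moments; apply/funext => x; rewrite big_cons mul1r.
Qed.

(** Dominated convergence. The majorant may exceed [g0] by an exponential factor because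
    [null_moments] controls every exponential rate. *)
Lemma null_moments_cvg (G : nat -> T -> R) g g0 (c0 : R) : null_moments g0 ->
  (forall N, null_moments (G N)) ->
  (forall N x, `|G N x| <= expR (c0 * l1 x) * `|g0 x|) ->
  (forall x, G N x @[N --> \oo] --> g x) -> null_moments g.
Proof.
move=> G0 GG Gle Gcvg.
have mG N : measurable_fun setT (G N) by have [] := GG N.
have mg : measurable_fun setT g.
  by apply: (measurable_realfun.measurable_fun_cvg mG) => x _; exact: Gcvg.
have gle x : `|g x| <= expR (c0 * l1 x) * `|g0 x|.
  apply: (ler_cvg_to (cvg_norm (Gcvg x)) (cvg_cst _)); exact: nearW.
have mexp c : measurable_fun setT (fun x : T => expR (c * l1 x)).
  apply: measurableT_comp => //; apply: measurable_funM => //; exact: measurable_l1.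
have [mg0 ig0 _] := G0.
split => //.
  move=> c; have /integrable_norm := ig0 (c + c0); apply: le_integrable_fun.
    exact: measurable_funM.
  move=> x /=; rewrite mulrDl expRD -mulrA !normrM !(ger0_norm (expR_ge0 _)).
  by rewrite ler_wpM2l ?expR_ge0.
move=> t.
have iw := null_moments_int t c0 G0.
have := Rdominated_cvg (F := fun N x => word t x * G N x)
  (f := fun x => word t x * g x) _ (integrable_norm iw).
have E : (fun N => \int[mu]_x (word t x * G N x)) = fun=> 0.
  by apply/funext => N; have [] := GG N.
rewrite E => h; apply/esym; apply: cvg_unique (h _ _ _); last first.
- by move=> x; apply: cvgM; [exact: cvg_cst|exact: Gcvg].
- by move=> N x /=; rewrite !normrM (ger0_norm (expR_ge0 _)) ler_wpM2l.
- by move=> N; apply: measurable_funM => //; exact: measurable_word.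
- exact: cvg_cst.
- exact: norm_hausdorff.
Qed.

(* The indicators among the multipliers form a sigma-algebra containing the
   half-spaces x_i > a, hence all measurable sets. *)
Definition multiplier phi := [/\ measurable_fun setT phi,
  exists B, forall x, `|phi x| <= B &
  forall g, null_moments g -> null_moments (fun x => phi x * g x)].

Lemma multiplierD (a b : R) f g : multiplier f -> multiplier g ->
  multiplier (fun x => a * f x + b * g x).
Proof.
move=> [mf [A fA] Gf] [mg [B gB] Gg]; split.
- by apply: measurable_funD; exact: measurable_funM.
- exists (`|a| * A + `|b| * B) => x; apply: le_trans (ler_normD _ _) _.
  by rewrite !normrM lerD // ler_wpM2l.
- move=> h Gh; have := null_momentsD a b (Gf _ Gh) (Gg _ Gh).
  by congr null_moments; apply/funext => x; ring.
Qed.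

Lemma multiplierM f g : multiplier f -> multiplier g ->
  multiplier (fun x => f x * g x).
Proof.
move=> [mf [A fA] Gf] [mg [B gB] Gg]; split.
- exact: measurable_funM.
- by exists (A * B) => x; rewrite normrM ler_pM.
- move=> h Gh; have := Gf _ (Gg _ Gh).
  by congr null_moments; apply/funext => x; rewrite mulrA.
Qed.

Lemma multiplier1 : multiplier (fun=> 1).
Proof.
split => //; first by exists 1 => x; rewrite normr1.
by move=> g; under [in X in _ -> X]eq_fun do rewrite mul1r.
Qed.

Lemma multiplier_cvg (B : R) (F : nat -> T -> R) f :
  (forall N, multiplier (F N)) -> (forall N x, `|F N x| <= B) ->
  (forall x, F N x @[N --> \oo] --> f x) -> multiplier f.
Proof.
move=> MF FB Fcvg.
have B0 : 0 <= B by apply: le_trans (FB 0%N 0).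
have fB x : `|f x| <= B.
  by apply: (ler_cvg_to (cvg_norm (Fcvg x)) (cvg_cst _)); exact: nearW.
split.
- apply: (measurable_realfun.measurable_fun_cvg _) => [N|x _]; last exact: Fcvg.
  by have [] := MF N.
- by exists B.
(* The majorant is B times g, padded with [0 * g x] to have the shape handled by [null_momentsD]; no
   exponential factor is needed, hence c0 = 0. *)
- move=> g Gg; apply: (@null_moments_cvg (fun N x => F N x * g x) _ (fun x => B * g x + 0 * g x) 0).
  + exact: null_momentsD.
  + by move=> N; have [_ _] := MF N; apply.
  + move=> N x; rewrite !mul0r expR0 mul1r addr0 !normrM ler_wpM2r //.
    by rewrite (ger0_norm B0).
  + by move=> x; apply: cvgM; [exact: Fcvg|exact: cvg_cst].
Qed.

(** Each partial sum is a polynomial in x_i and is bounded by exp(|s| |x_i|) uniformly in N, which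
    is within reach of [null_moments_cvg]. Sine and cosine are the two instances. *)
Lemma multiplier_series i (psi : R -> R) (a : nat -> R) (s : R) :
  measurable_fun setT psi -> (forall u, `|psi u| <= 1) ->
  (forall k, `|a k| <= `|s| ^+ k / k`!%:R) ->
  (forall u, (fun N => \sum_(0 <= k < N) a k * u ^+ k) @ \oo --> psi u) ->
  multiplier (fun x => psi (x 0 i)).
Proof.
move=> mpsi psi1 ak acvg; split.
- by apply: measurableT_comp => //; exact: measurable_coord.
- by exists 1.
move=> g Gg.
apply: (@null_moments_cvg (fun N x => \sum_(0 <= k < N) a k * (x 0 i ^+ k * g x)) _ g `|s|) => //.
- move=> N; apply: null_moments_sum => [|k]; last exact: null_moments_exp.
  exact: integrable0.
- move=> N x; under eq_bigr do rewrite mulrA.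
  rewrite -mulr_suml normrM ler_wpM2r //.
  apply: le_trans (ler_norm_sum _ _ _) _.
  apply: (@le_trans _ _ (expR (`|s| * `|x 0 i|))); last first.
    by rewrite ler_expR ler_wpM2l // coord_le_l1.
  apply: le_trans (partial_exp_le N _); last by rewrite mulr_ge0.
  apply: ler_sum => k _; rewrite normrM normrX exprMn mulrAC ler_wpM2r ?exprn_ge0 //.
- move=> x; under eq_fun do under eq_bigr do rewrite mulrA.
  under eq_fun do rewrite -mulr_suml.
  by apply: cvgM; [exact: acvg|exact: cvg_cst].
Qed.

Lemma multiplier_sin i (s : R) : multiplier (fun x => sin (s * x 0 i)).
Proof.
apply: (@multiplier_series i (fun u => sin (s * u)) (sin_coeff s) s).
- apply: measurableT_comp; last exact: measurable_funM.
  by apply: continuous_measurable_fun; exact: continuous_sin.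
- by move=> u; exact: sin_max.
- move=> k; rewrite /sin_coeff /= !normrM normrV ?unitfE ?pnatr_eq0 -?lt0n ?fact_gt0 //.
  rewrite !normrX !normr_nat normrN1 expr1n mulr1 ler_wpM2r ?invr_ge0 //.
  by rewrite -[leRHS]mul1r ler_wpM2r ?exprn_ge0 //; case: odd; rewrite ?ler01.
- move=> u; rewrite sin.unlock.
  have -> : (fun N => \sum_(0 <= k < N) sin_coeff s k * u ^+ k) = series (sin_coeff (s * u)).
    apply/funext => N; rewrite seriesEnat /=; apply: eq_bigr => k _.
    by rewrite /sin_coeff /= exprMn; ring.
  exact: (@is_cvg_series_sin_coeff _ (s * u)).
Qed.

Lemma multiplier_cos i (s : R) : multiplier (fun x => cos (s * x 0 i)).
Proof.
apply: (@multiplier_series i (fun u => cos (s * u)) (cos_coeff s) s).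
- apply: measurableT_comp; last exact: measurable_funM.
  by apply: continuous_measurable_fun; exact: continuous_cos.
- by move=> u; exact: cos_max.
- move=> k; rewrite /cos_coeff /= !normrM normrV ?unitfE ?pnatr_eq0 -?lt0n ?fact_gt0 //.
  rewrite !normrX !normr_nat normrN1 expr1n mulr1 ler_wpM2r ?invr_ge0 //.
  by rewrite -[leRHS]mul1r ler_wpM2r ?exprn_ge0 //; case: odd; rewrite ?ler01.
- move=> u; rewrite cos.unlock.
  have -> : (fun N => \sum_(0 <= k < N) cos_coeff s k * u ^+ k) = series (cos_coeff (s * u)).
    apply/funext => N; rewrite seriesEnat /=; apply: eq_bigr => k _.
    by rewrite /cos_coeff /= exprMn; ring.
  exact: (@is_cvg_series_cos_coeff _ (s * u)).
Qed.

Lemma multiplier_sgstep phi : multiplier phi -> multiplier (fun x => sgstep (phi x)).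
Proof.
move=> Mphi; have := multiplierD (2^-1 * 3) (- 2^-1) Mphi (multiplierM Mphi (multiplierM Mphi
  Mphi)).
by congr multiplier; apply/funext => x; rewrite /sgstep; ring.
Qed.

(* sgstep iterated on sin (s (x_i - a)) tends to the sign of that sine, which
   tends to the sign of x_i - a as s -> 0. *)
Lemma multiplier_sg i (a : R) : multiplier (fun x => Num.sg (x 0 i - a)).
Proof.
have Ms s : multiplier (fun x => sin (s * (x 0 i - a))).
  have := multiplierD (cos (s * a)) (- sin (s * a)) (multiplier_sin i s) (multiplier_cos i s).
  by congr multiplier; apply/funext => x; rewrite mulrBr sinB; ring.
have Msg s : multiplier (fun x => Num.sg (sin (s * (x 0 i - a)))).
  apply: (@multiplier_cvg 1 (fun N x => iter N sgstep (sin (s * (x 0 i - a))))).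
  - by elim=> [|N IH] /=; [exact: Ms|exact: multiplier_sgstep].
  - by elim=> [|N IH] x /=; [exact: sin_max|exact: sgstep_norm].
  - by move=> x; apply: cvg_iter_sgstep; exact: sin_max.
apply: (@multiplier_cvg 1 (fun N x => Num.sg (sin (N.+1%:R^-1 * (x 0 i - a))))).
- by move=> N; exact: Msg.
- by move=> N x; rewrite normr_sg; case: eqP.
move=> x; apply: cvg_near_cst.
have : (N.+1%:R^-1 * (x 0 i - a)) @[N --> \oo] --> (0 : R).
  rewrite -[X in _ --> X](mul0r (x 0 i - a)); apply: cvgM; last exact: cvg_cst.
  exact: cvg_harmonic.
move=> /cvgr0Pnorm_lt /(_ pi (pi_gt0 R)); apply: filterS => N /sg_sin ->.
by rewrite sgrM gtr0_sg ?mul1r.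
Qed.

Definition multiplier_set (S : set T) := measurable S /\ multiplier (\1_S : T -> R).

Lemma multiplier_setC S : multiplier_set S -> multiplier_set (~` S).
Proof.
move=> [mS MS]; split; first exact: measurableC.
have := multiplierD 1 (-1) multiplier1 MS.
congr multiplier; apply/funext => x; rewrite !indicE in_setC.
by case: (x \in S); rewrite /= ?mulr1 ?mulr0 ?addr0 ?subrr ?mulN1r ?subrr.
Qed.

Lemma multiplier_setI S S' : multiplier_set S -> multiplier_set S' ->
  multiplier_set (S `&` S').
Proof.
move=> [mS MS] [mS' MS']; split; first exact: measurableI.
have := multiplierM MS MS'.
by rewrite indicI.
Qed.

(** At each point the indicators of the finite unions are eventually constant, so [multiplier_cvg]
    applies with bound 1. *)
Lemma multiplier_set_bigcup (F : (set T)^nat) : (forall k, multiplier_set (F k)) ->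
  multiplier_set (\bigcup_k F k).
Proof.
move=> MF; split; first by apply: bigcupT_measurable => k; have [] := MF k.
pose U N := ~` \big[setI/setT]_(k < N) ~` F k.
have MU N : multiplier_set (U N).
  apply: multiplier_setC; elim: N => [|N IH].
    rewrite big_ord0; split => //.
    by have := multiplier1; congr multiplier; apply/funext => x; rewrite indicT.
  by rewrite big_ord_recr /=; apply: multiplier_setI => //; exact: multiplier_setC.
have UE N x : U N x <-> exists2 k, (k < N)%N & F k x.
  rewrite /U setC_bigsetI -(bigcup_mkord N (fun k => ~` ~` F k)).
  split=> [[k kN]|[k kN Fkx]]; first by rewrite setCK; exists k.
  by exists k => //; rewrite setCK.
apply: (@multiplier_cvg 1 (fun N => \1_(U N))).
- by move=> N; have [] := MU N.
- by move=> N x; rewrite indicE normr_nat; case: (_ \in _).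
move=> x; apply: cvg_near_cst.
have [[k _ Fkx]|nF] := pselect ((\bigcup_k F k) x).
  near=> N; rewrite !indicE mem_set ?mem_set //; first by exists k.
  by apply/UE; exists k => //; near: N; exact: nbhs_infty_gt.
apply: nearW => N; rewrite !indicE memNset ?memNset // => /UE[k _ Fkx].
by apply: nF; exists k.
Unshelve. all: by end_near. Qed.

Lemma multiplier_set0 : multiplier_set set0.
Proof.
rewrite -setCT; apply: multiplier_setC; split => //.
by have := multiplier1; congr multiplier; apply/funext => x; rewrite indicT.
Qed.

Lemma multiplier_set_measurable S : measurable S -> multiplier_set S.
Proof.
have key i (B : set (measurableTypeR R)) : measurable B ->
    multiplier_set ((fun x : T => x 0 i) @^-1` B).
  rewrite RGenOInfty.measurableE => mB.
  pose H := [set B : set R | multiplier_set ((fun x : T => x 0 i) @^-1` B)].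
  have : <<s @RGenOInfty.G R >> `<=` H.
    apply: smallest_sub.
      split => [|A HA|F HF]; rewrite /H /=.
      - by rewrite preimage_set0; exact: multiplier_set0.
      - by rewrite setTD preimage_setC; exact: multiplier_setC.
      - by rewrite preimage_bigcup; exact: multiplier_set_bigcup.
    move=> _ [a ->]; split.
      rewrite -[X in measurable X]setTI; exact: (@measurable_coord i _ _ (measurable_itv _)).
    (* With sigma the sign of x_i - a, the indicator of x_i > a is (sigma + sigma^2) / 2, which also
       gives 0 when x_i = a. *)
    have := multiplierD (2^-1) (2^-1) (multiplier_sg i a) (multiplierM (multiplier_sg i a)
      (multiplier_sg i a)).
    congr multiplier; apply/funext => x; rewrite indicE.
    have -> : (x \in (fun x0 : T => x0 0 i) @^-1` `]a, +oo[) = (a < x 0 i).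
      by apply/idP/idP => [/set_mem|h]; [|apply/mem_set]; rewrite /= in_itv /= andbT.
    have [ax|xa] := ltP a (x 0 i); first by rewrite gtr0_sg ?subr_gt0 //=; field.
    have [->|xn] := eqVneq (x 0 i) a; first by rewrite subrr sgr0 !mulr0 addr0.
    by rewrite ltr0_sg ?subr_lt0 ?lt_neqAle ?xn //=; ring.
  by apply.
rewrite /measurable /=.
have : <<s \bigcup_(ij in [set: 'I_1 * 'I_n])
        preimage_set_system setT (fun M : 'M[measurableTypeR R]_(1, n) => M ij.1 ij.2)
          measurable >> `<=` multiplier_set.
  apply: smallest_sub.
    split; first exact: multiplier_set0.
    - by move=> A; rewrite setTD; exact: multiplier_setC.
    - exact: multiplier_set_bigcup.
  by move=> _ [[i j] _ [B mB <-]] /=; rewrite setTI ord1; exact: key.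
by apply.
Qed.

(** The empty word says that a weight with null moments has integral zero. Multiplying g by the
    indicators of g >= 0 and of its complement gives two such weights, whose integrals differ by
    that of |g|. *)
Theorem null_moments_ae0 g : null_moments g -> {ae mu, forall x, g x = 0}.
Proof.
move=> Gg; have [mg ig g0] := Gg.
have intS S : measurable S -> \int[mu]_x (\1_S x * g x) = 0.
  move=> /multiplier_set_measurable[mS [_ _ /(_ _ Gg)[_ _ /(_ [::])]]].
  by under eq_Rintegral do rewrite /word big_nil mul1r.
have int0 : mu.-integrable setT (EFin \o g).
  by have := null_moments_intw [::] Gg; under eq_fun do rewrite /word big_nil mul1r.
pose P := [set x | 0 <= g x].
have mP : measurable P.
  rewrite /P -[X in measurable X]setTI.
  have -> : [set x | 0 <= g x] = g @^-1` `[0, +oo[.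
    by apply/seteqP; split=> x /=; rewrite in_itv /= andbT.
  exact: mg.
have mI S : measurable S -> mu.-integrable setT (EFin \o (fun x => \1_S x * g x)).
  move=> mS; apply: le_integrable_fun (integrable_norm int0).
    by apply: measurable_funM => //; exact: measurable_indic.
  by move=> x /=; rewrite normrM indicE normr_nat; case: (_ \in _); rewrite ?mul1r ?mul0r.
have : \int[mu]_x `|g x| = 0.
  transitivity (\int[mu]_x (\1_P x * g x) - \int[mu]_x (\1_(~` P) x * g x)).
    rewrite -(RintegralB measurableT (mI _ mP) (mI _ (measurableC mP))).
    apply: eq_Rintegral => x _; rewrite !indicE in_setC.
    have -> : (x \in P) = (0 <= g x) by apply/idP/idP => [/set_mem|/mem_set].
    have [gx|gx] := leP 0 (g x); first by rewrite ger0_norm //= mul1r mul0r subr0.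
    by rewrite ltr0_norm //= mul0r mul1r sub0r.
  by rewrite !intS ?subrr //; exact: measurableC.
move=> h; have : (\int[mu]_(x in setT) `|(EFin \o g) x| = 0)%E.
  rewrite -[LHS]fineK ?h //; first by congr EFin.
  exact: (integrable_fin_num measurableT (integrable_norm int0)).
move/ae_eq_integral_abs; case=> //; first exact/measurable_EFinP.
move=> N [mN N0 sub]; exists N; split => // x /= gx; apply: sub => /= /(_ I) [].
by move=> /gx.
Qed.

End moments.

(** * Integration by parts on R^n *)

Lemma is_derive_line {R : realType} {V : normedModType R} (F dF : V -> R) (v x : V) (s : R) :
  (forall y, is_derive y v F (dF y)) ->
  is_derive s 1 (fun t => F (x + t *: v)) (dF (x + s *: v)).
Proof.
move=> dFv; have [d1 d2] := dFv (x + s *: v).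
have E : (fun h : R => h^-1 *: (((fun t : R => F (x + t *: v)) \o shift s) (h *: 1) - F (x + s
  *: v))) =
   (fun h : R => h^-1 *: ((F \o shift (x + s *: v)) (h *: v) - F (x + s *: v))).
  apply/funext => h /=; congr (_ *: (F _ - _)).
  by rewrite [h *: (1 : R)]mulr1 scalerDl addrCA.
by split; [rewrite /derivable E|rewrite /derive E].
Qed.

Section integral_1D.
Context {R : realType}.
Local Notation mu := (@lebesgue_measure R).

Lemma integrable_exp_abs : mu.-integrable setT (EFin \o (fun x => expR (- `|x|))).
Proof.
have mf : measurable_fun setT (fun x : R => expR (- `|x|)).
  by apply: measurableT_comp => //; apply: measurableT_comp.
apply/integrableP; split; first exact/measurable_EFinP.
under eq_integral do rewrite /= ger0_norm ?expR_ge0 //.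
rewrite ge0_symfun_integralT; first last.
- by move=> x /=; rewrite normrN.
- move=> x; apply: continuous_comp; last exact: continuous_expR.
  by apply: cvgN; exact: norm_continuous.
- by move=> x; exact: expR_ge0.
rewrite lte_mul_pinfty // ?lee_fin //.
have <- : (\int[mu]_x (exponential_pdf 1 x)%:E = \int[mu]_(x in [set x | (0 <= x)%R]) (expR (-
  `|x|))%:E)%E.
  rewrite [RHS]integral_mkcond; apply: eq_integral => x _.
  rewrite /exponential_pdf set_itvcy !patchE.
  by case: ifPn => // /set_mem /= x0; rewrite mul1r mulN1r ger0_norm.
by rewrite integral_exponential_pdf // ltry.
Qed.

(** The fundamental theorem of calculus on [-(N+1), N+1], with boundary terms that vanish as N
    grows; the bound on [df] is the majorant for passing to the whole line. *)
Lemma integral_derive0 (f df : R -> R) (C : R) :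
  (forall x : R, is_derive x 1 f (df x)) -> continuous df ->
  (forall x, `|f x| <= C * expR (- `|x|)) ->
  (forall x, `|df x| <= C * expR (- `|x|)) ->
  \int[mu]_x df x = 0.
Proof.
move=> fdf cdf fC dfC.
have cf : continuous f.
  move=> x; apply: differentiable_continuous; apply/derivable1_diffP; by have [] := fdf x.
have mdf : measurable_fun setT df by exact: continuous_measurable_fun.
pose F N := (fun x => df x * \1_(`[- N.+1%:R, N.+1%:R]%classic) x).
have intC : mu.-integrable setT (EFin \o (fun x => C * expR (- `|x|))).
  exact: integrable_funZ integrable_exp_abs.
have C0 : 0 <= C.
  by have := le_trans (normr_ge0 _) (fC 0); rewrite normr0 oppr0 expR0 mulr1.
have cvg0 : \int[mu]_x F N x @[N --> \oo] --> \int[mu]_x df x.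
  apply: (@Rdominated_cvg _ (measurableTypeR R) _ mu F df (fun x : R => C * expR (- `|x|))) => //.
  - move=> N; apply: measurable_funM => //; exact: measurable_indic.
  - move=> N x; rewrite /F normrM indicE normr_nat.
    by case: (_ \in _); rewrite ?mulr1 ?mulr0 // mulr_ge0 ?expR_ge0.
  - move=> x; apply: cvg_near_cst; near=> N.
    rewrite /F indicE mem_set ?mulr1 //= in_itv /= -ler_norml.
    near: N; have [N0 _ HN] := nbhs_infty_ger `|x|.
    by exists N0 => // N /= /HN /le_trans; apply; rewrite ler_nat.
have FE N : \int[mu]_x F N x = f N.+1%:R - f (- N.+1%:R).
  have N0 : - N.+1%:R < N.+1%:R :> R by rewrite -subr_gt0 opprK addr_gt0.
  have := @continuous_FTC2 R df f _ _ N0.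
  move=> H; transitivity (\int[mu]_(x in `[- N.+1%:R, N.+1%:R]) df x).
    rewrite [RHS]Rintegral_mkcond; apply: eq_Rintegral => x _.
    by rewrite patchE /F indicE; case: ifP => _; rewrite ?mulr1 ?mulr0.
  rewrite /Rintegral H //.
  - exact: continuous_subspaceT.
  - split.
    + by move=> x _; have [] := fdf x.
    + exact: cvg_at_right_filter (cf _).
    + exact: cvg_at_left_filter (cf _).
  - by move=> x _; rewrite derive1E; have [_] := fdf x.
apply/esym; apply: cvg_unique cvg0; first exact: norm_hausdorff.
rewrite /= (funext FE).
(* Uses exp(-a) <= 1 / a at a = N + 1, so that the boundary terms are compared with the harmonic
   sequence. *)
have bnd N : `|f N.+1%:R - f (- N.+1%:R)| <= (2 * C) * N.+1%:R^-1.
  apply: le_trans (ler_normB _ _) _.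
  have h (y : R) : `|y| = N.+1%:R -> `|f y| <= C * N.+1%:R^-1.
    move=> yN; apply: le_trans (fC y) _; rewrite yN ler_wpM2l // expRN.
    rewrite lef_pV2 ?posrE ?expR_gt0 //.
    by apply: le_trans (expR_ge1Dx _); rewrite lerDr.
  have -> : 2 * C * N.+1%:R^-1 = C * N.+1%:R^-1 + C * N.+1%:R^-1 by ring.
  by rewrite lerD // h // ?normrN normr_nat.
apply/cvgr0Pnorm_le => eps e0.
have : (2 * C) * N.+1%:R^-1 @[N --> \oo] --> 0.
  rewrite -[X in _ --> X](mulr0 (2 * C)); apply: cvgM; first exact: cvg_cst.
  exact: cvg_harmonic.
move=> /cvgr0Pnorm_le /(_ _ e0); apply: filterS => N; apply: le_trans.
by rewrite (ger0_norm (_ : 0 <= 2 * C * _)) ?bnd // !mulr_ge0 // invr_ge0.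
Unshelve. all: by end_near. Qed.

End integral_1D.

(** * Measurability and slicing for Lebesgue measure on R^n *)

Section rV_measure.
Context {R : realType}.
Local Notation leb := (@lebesgue_rV R).

Lemma measurable_box n (P : 'I_n -> set (measurableTypeR R)) :
  (forall i, measurable (P i)) -> measurable [set x : 'rV[R]_n | forall i, P i (x 0 i)].
Proof.
move=> mP.
rewrite (_ : [set x | _] = \bigcap_(i in [set: 'I_n])
    ((fun x : 'rV[R]_n => x 0 i) @^-1` P i)).
  apply: fin_bigcap_measurable => [|i _]; first exact: finite_finset.
  rewrite -[X in measurable X]setTI; exact: (measurable_coord i _ (mP _)).
by apply/seteqP; split=> x /= h i; [move=> _|]; exact: h.
Qed.

(** The sigma-algebra is generated by the coordinates, so open sets are written as countable unions
    of cubes with rational centres and radii 1 / (k + 1). This is what makes continuous functions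
    measurable. *)
Lemma open_measurable_rV n (U : set 'rV[R]_n) : open U -> measurable U.
Proof.
move=> oU.
pose box (q : 'rV[rat]_n * nat) := [set x : 'rV[R]_n |
   forall i, `|ratr (q.1 0 i) - x 0 i| < q.2.+1%:R^-1].
have mbox q : measurable (box q).
  apply: (@measurable_box n (fun i => [set t : R | `|ratr (q.1 0 i) - t| < q.2.+1%:R^-1])) => i.
  have -> : [set t : R | `|ratr (q.1 0 i) - t| < q.2.+1%:R^-1] =
     `]ratr (q.1 0 i) - q.2.+1%:R^-1, ratr (q.1 0 i) + q.2.+1%:R^-1[%classic.
    by apply/seteqP; split => t /=; rewrite in_itv /= ltr_distlC.
  exact: measurable_itv.
have -> : U = \bigcup_(q in [set q | box q `<=` U]) box q.
  apply/seteqP; split=> [x Ux|x [q]]; last by apply.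
  have /nbhs_ballP [e /= e0 eU] := open_nbhs_nbhs (conj oU Ux).
  have [k _ kP] := near_infty_natSinv_lt (PosNum (divr_gt0 e0 (ltr0Sn R 1))).
  have {kP} := kP k (leqnn k) => /= ke.
  have rx i : exists q : rat, `|ratr q - x 0 i| < k.+1%:R^-1.
    have [q] := @rat_in_itvoo R (x 0 i - k.+1%:R^-1) (x 0 i + k.+1%:R^-1)
      ltac:(by rewrite ltrD2l gtrN).
    by rewrite in_itv /= -ltr_distl => h; exists q.
  have [q Hq] := choice rx.
  exists (\row_i q i, k) => [y Hy|i]; last by rewrite /= mxE.
    apply: eU; split => // i j; rewrite ord1 -ball_normE /=.
    have := Hy j; rewrite /= mxE => h1; have := Hq j => h2.
    rewrite -(subrKA (ratr (q j))); apply: le_lt_trans (ler_normD _ _) _.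
    rewrite [`|x 0 j - _|]distrC (splitr e); apply: ltrD; exact: lt_trans ke.
rewrite bigcup_mkcond; apply: countable_bigcupT_measurable => [|q]; first exact: countableP.
by case: ifP => _ //; exact: mbox.
Qed.

Lemma continuous_measurable_rV n (f : 'rV[R]_n -> R) : continuous f ->
  measurable_fun setT f.
Proof.
move=> cf; apply: (measurability _ (RGenOpens.measurableE R)).
move=> _ [_ [a [b ->] <-]]; rewrite setTI; apply: open_measurable_rV.
by apply: open_comp => // x _; exact: cf.
Qed.

Lemma l1_cons n (p : measurableTypeR R * 'rV[R]_n) :
  l1 (consrV p) = `|p.1| + l1 p.2.
Proof.
rewrite /l1 big_ord_recl consrV0; congr (_ + _).
by apply: eq_bigr => i _; rewrite consrVS.
Qed.

Lemma integrable_rVS n (f : 'rV[R]_n.+1 -> R) : measurable_fun setT f ->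
  ((@lebesgue_measure R) \x leb n)%E.-integrable setT (EFin \o (f \o @consrV R n)) ->
  (leb n.+1).-integrable setT (EFin \o f).
Proof.
move=> mf fi.
have := @integrable_pushforward _ _ _ _ _ (@consrV R n) (@measurable_consrV R n)
  ((@lebesgue_measure R) \x leb n)%E setT (EFin \o f).
by apply => //; exact/measurable_EFinP.
Qed.

Lemma integral_rVS n (f : 'rV[R]_n.+1 -> R) : measurable_fun setT f ->
  ((@lebesgue_measure R) \x leb n)%E.-integrable setT (EFin \o (f \o @consrV R n)) ->
  (\int[leb n.+1]_x (f x)%:E =
   \int[(@lebesgue_measure R) \x leb n]_p (f (consrV p))%:E)%E.
Proof.
move=> mf fi.
have := @integral_pushforward _ _ _ _ _ (@consrV R n) (@measurable_consrV R n)
  ((@lebesgue_measure R) \x leb n)%E setT (EFin \o f).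
rewrite preimage_setT; apply => //; exact/measurable_EFinP.
Qed.

Lemma measurable_exp_l1 n (c : R) : measurable_fun setT (fun x : 'rV[R]_n => expR (c * l1 x)).
Proof.
by apply: measurableT_comp => //; apply: measurable_funM => //; exact: measurable_l1.
Qed.

Lemma integrable_exp_l1_cons n : (leb n).-integrable setT (EFin \o (fun x => expR (- l1 x))) ->
  ((@lebesgue_measure R) \x leb n)%E.-integrable setT
    (EFin \o (fun p => expR (- `|p.1|) * expR (- l1 p.2))).
Proof.
move=> IH; apply/(integrable12ltyP _).
  apply/measurable_EFinP; apply: measurable_funM.
    apply: (measurableT_comp (f := fun x : R => expR (- `|x|)) _ measurable_fst).
    by have /measurable_int/measurable_EFinP := @integrable_exp_abs R.
  apply: (measurableT_comp (f := fun x : 'rV[R]_n => expR (- l1 x)) _ measurable_snd).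
  by have /measurable_int/measurable_EFinP := IH.
pose c := \int[leb n]_x expR (- l1 x).
rewrite (eq_integral (fun x : measurableTypeR R => (c * expR (- `|x|))%:E)).
  apply: integrable_lty => //; exact: (integrable_funZ c (@integrable_exp_abs R)).
move=> x _ /=.
rewrite (eq_integral (fun y => (expR (- `|x|))%:E * (expR (- l1 y))%:E)%E).
  rewrite integralZl // mulrC EFinM; congr (_ * _)%E.
  by rewrite /c /Rintegral fineK //; exact: integrable_fin_num.
by move=> y _; rewrite ger0_norm ?mulr_ge0 ?expR_ge0.
Qed.

Lemma integrable_exp_l1 n : (leb n).-integrable setT (EFin \o (fun x => expR (- l1 x))).
Proof.
have m1 k : measurable_fun setT (fun x : 'rV[R]_k => expR (- l1 x)).
  by have := @measurable_exp_l1 k (-1); under eq_fun do rewrite mulN1r.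
elim: n => [|n IH].
  have m0 : measurable_fun setT (EFin \o (fun x : 'rV[R]_0 => expR (- l1 x))).
    apply/measurable_EFinP. exact: (m1 0%N).
  apply/integrableP; split => //.
  have m0' : measurable_fun setT (abse \o (EFin \o (fun x : 'rV[R]_0 => expR (- l1 x)))).
    exact: measurableT_comp m0.
  rewrite /= (integral_dirac _ measurableT m0').
  by rewrite diracT mul1e ltry.
apply: integrable_rVS => //.
have := integrable_exp_l1_cons IH; apply: eq_integrable => // p _ /=.
by rewrite l1_cons opprD expRD.
Qed.

Lemma line_coord n (x : 'rV[R]_n) (s : R) (i j : 'I_n) :
  (x + s *: delta_mx 0 i) 0 j = x 0 j + s * (j == i)%:R.
Proof. by rewrite mxE [X in _ + X]mxE [X in _ * X]mxE. Qed.

Lemma consrV_line0 n (t s : R) (y : 'rV[R]_n) :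
  consrV (t, y) + s *: delta_mx 0 ord0 = consrV ((t + s : measurableTypeR R), y).
Proof.
apply/matrixP => i j; rewrite ord1 line_coord.
case: (unliftP ord0 j) => [k|] ->; first by rewrite !consrVS mulr0 addr0.
by rewrite !consrV0 eqxx mulr1.
Qed.

Lemma consrV_lineS n (t s : R) (y : 'rV[R]_n) (j : 'I_n) :
  consrV ((t : measurableTypeR R), y) + s *: delta_mx 0 (lift ord0 j) =
  consrV ((t : measurableTypeR R), y + s *: delta_mx 0 j).
Proof.
apply/matrixP => i k; rewrite ord1 line_coord.
case: (unliftP ord0 k) => [l|] ->.
  by rewrite !consrVS line_coord (inj_eq lift_inj).
by rewrite !consrV0 mulr0 addr0.
Qed.

(** Induction on the dimension by Fubini. If i is the first coordinate, it is integrated first and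
    [integral_derive0] applies; otherwise the first coordinate t is frozen and the induction
    hypothesis applies to the slice. Derivatives are stated along lines, and bounds through [l1],
    because both pass to slices: C becomes C exp(-|t|). *)
Lemma integral_partial0 n (i : 'I_n) (F dF : 'rV[R]_n -> R) (C : R) :
  measurable_fun setT dF ->
  (forall x (s : R), is_derive s (1 : R) (fun t : R => F (x + t *: delta_mx 0 i))
     (dF (x + s *: delta_mx 0 i))) ->
  (forall x, continuous (fun t : R => dF (x + t *: delta_mx 0 i))) ->
  (forall x, `|F x| <= C * expR (- l1 x)) ->
  (forall x, `|dF x| <= C * expR (- l1 x)) ->
  \int[leb n]_x dF x = 0.
Proof.
elim: n i F dF C => [[]//|n IH] i F dF C mdF Fd cdF FC dFC.
have iexp := integrable_exp_l1_cons (integrable_exp_l1 n).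
have mdFc : measurable_fun setT (dF \o @consrV R n).
  exact: measurableT_comp (@measurable_consrV R n).
have idF : ((@lebesgue_measure R) \x leb n)%E.-integrable setT (EFin \o (dF \o @consrV R n)).
  apply: le_integrable_fun (integrable_funZ C iexp) => // p /=.
  by apply: le_trans (dFC _) _; rewrite l1_cons opprD expRD.
rewrite /Rintegral integral_rVS //.
case: (unliftP ord0 i) Fd cdF => [j|] -> Fd cdF.
  rewrite -integral12_prod_meas1 // /= integral0_eq // => t _.
  pose G y := dF (consrV ((t : measurableTypeR R), y)).
  have mG : measurable_fun setT G.
    exact: (measurableT_comp mdFc (measurable_pair1 (t : measurableTypeR R))).
  have GC y : `|G y| <= C * expR (- `|t|) * expR (- l1 y).
    by apply: le_trans (dFC _) _; rewrite l1_cons opprD expRD mulrA.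
  have iG : (leb n).-integrable setT (EFin \o G).
    exact: (le_integrable_fun mG GC (integrable_funZ _ (integrable_exp_l1 n))).
  rewrite /fubini_F -[LHS]fineK; last exact: (integrable_fin_num measurableT iG).
  congr EFin; apply: (IH j (fun y => F (consrV ((t : measurableTypeR R), y))) G _ mG) => //.
  - move=> x s; have := Fd (consrV ((t : measurableTypeR R), x)) s.
    by under eq_fun do rewrite consrV_lineS; rewrite consrV_lineS.
  - move=> x; have := cdF (consrV ((t : measurableTypeR R), x)).
    by under eq_fun do rewrite consrV_lineS.
  - by move=> x; apply: le_trans (FC _) _; rewrite l1_cons opprD expRD mulrA.
rewrite -integral21_prod_meas1 // /= integral0_eq // => y _.
pose G (t : R) := dF (consrV ((t : measurableTypeR R), y)).
have mG : measurable_fun setT (G : measurableTypeR R -> R).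
  exact: (measurableT_comp mdFc (measurable_pair2 y)).
have GC t : `|G t| <= C * expR (- l1 y) * expR (- `|t|).
  by apply: le_trans (dFC _) _; rewrite l1_cons opprD expRD mulrA mulrAC.
have iG : (@lebesgue_measure R).-integrable setT (EFin \o G).
  exact: (le_integrable_fun mG GC (integrable_funZ _ (@integrable_exp_abs R))).
rewrite /fubini_G -[LHS]fineK; last exact: (integrable_fin_num measurableT iG).
congr EFin; apply: (@integral_derive0 R (fun t => F (consrV ((t : measurableTypeR R), y))) G _
  _ _ _ GC).
- move=> t; have := Fd (consrV ((0 : measurableTypeR R), y)) t.
  by under eq_fun do rewrite consrV_line0 add0r; rewrite consrV_line0 add0r.
- have := cdF (consrV ((0 : measurableTypeR R), y)).
  by under eq_fun do rewrite consrV_line0 add0r.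
- by move=> x; apply: le_trans (FC _) _; rewrite l1_cons opprD expRD mulrA mulrAC.
Qed.

End rV_measure.

(** * Smooth functions *)

Section directional_calculus.
Context {R : realType} {V : normedModType R}.
Implicit Types (f g : V -> R) (x v : V).

(** Reduces directional derivatives to one real variable, where the chain rule is available. *)
Lemma is_derive_line0 f x v (a : R) :
  is_derive x v f a <-> is_derive (0 : R) (1 : R) (fun t => f (x + t *: v)) a.
Proof.
have E : (fun h : R => h^-1 *: (((fun t : R => f (x + t *: v)) \o shift (0 : R)) (h *: (1 : R)) -
     f (x + (0 : R) *: v))) = (fun h : R => h^-1 *: ((f \o shift x) (h *: v) - f x)).
  apply/funext => h /=; congr (_ *: (f _ - f _)).
    by rewrite [h *: (1 : R)]mulr1 addr0 addrC.
  by rewrite scale0r addr0.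
by split=> -[d1 d2]; split; move: d1 d2; rewrite /derivable /derive E.
Qed.

Lemma is_derive_compR (psi : R -> R) f x v (a b : R) :
  is_derive (f x) (1 : R) psi a -> is_derive x v f b ->
  is_derive x v (fun y => psi (f y)) (a * b).
Proof.
move=> psia /is_derive_line0 fb; apply/is_derive_line0.
apply: (is_derive1_comp (f := psi) (g := fun t : R => f (x + t *: v))) => //.
by rewrite scale0r addr0.
Qed.

Lemma is_derive_addR f g x v (a b : R) : is_derive x v f a -> is_derive x v g b ->
  is_derive x v (fun y => f y + g y) (a + b).
Proof. by move=> fa gb; exact: is_deriveD. Qed.

Lemma is_derive_mulR f g x v (a b : R) : is_derive x v f a -> is_derive x v g b ->
  is_derive x v (fun y => f y * g y) (f x * b + g x * a).
Proof. by move=> fa gb; exact: is_deriveM. Qed.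

Lemma is_derive_cstR (c : R) x v : is_derive x v (fun=> c) 0.
Proof. exact: is_derive_cst. Qed.

Lemma is_derive_mull (c : R) f x v (a : R) : is_derive x v f a ->
  is_derive x v (fun y => c * f y) (c * a).
Proof.
move=> fa; apply: is_derive_eq (is_derive_mulR (is_derive_cstR c x v) fa) _.
by rewrite mulr0 addr0.
Qed.

Lemma is_derive_sumR (I : Type) (r : seq I) (F : I -> V -> R) (dF : I -> R) x v :
  (forall i, is_derive x v (F i) (dF i)) ->
  is_derive x v (fun y => \sum_(i <- r) F i y) (\sum_(i <- r) dF i).
Proof.
move=> FdF; elim: r => [|i r IH].
  by under eq_fun do rewrite big_nil; rewrite big_nil; exact: is_derive_cstR.
under eq_fun do rewrite big_cons; rewrite big_cons.
exact: is_derive_addR.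
Qed.

Lemma line_continuous x v : continuous (fun t : R => x + t *: v).
Proof. by move=> t; apply: cvgD; [exact: cvg_cst|exact: scalel_continuous]. Qed.

Lemma derivable_continuousR (psi : R -> R) :
  (forall t : R, exists a, is_derive t (1 : R) psi a) -> continuous psi.
Proof.
move=> d t; have [a [d1 _]] := d t.
by apply: differentiable_continuous; apply/derivable1_diffP.
Qed.

End directional_calculus.

Section continuity.
Context {R : realType} {V : topologicalType}.
Implicit Types f g : V -> R.

Lemma continuous_addR f g : continuous f -> continuous g ->
  continuous (fun x => f x + g x).
Proof. by move=> cf cg x; apply: cvgD; [exact: cf|exact: cg]. Qed.

Lemma continuous_mulR f g : continuous f -> continuous g ->
  continuous (fun x => f x * g x).
Proof. by move=> cf cg x; apply: cvgM; [exact: cf|exact: cg]. Qed.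

Lemma continuous_cstR (c : R) : continuous (fun _ : V => c).
Proof. by move=> x; exact: cvg_cst. Qed.

Lemma continuous_compR (psi : R -> R) f : continuous psi -> continuous f ->
  continuous (fun x => psi (f x)).
Proof. by move=> cp cf x; apply: continuous_comp; [exact: cf|exact: cp]. Qed.

End continuity.

Section smooth_1D.
Context {R : realType}.

(** Regularity C^k in one variable; the digit refers to the dimension. The derivative is exhibited
    as a witness, so explicit formulas can be supplied. *)
Fixpoint C1 (k : nat) (psi : R -> R) : Prop :=
  continuous psi /\
  if k is k'.+1 then exists2 dpsi : R -> R,
    (forall t : R, is_derive t (1 : R) psi (dpsi t)) & C1 k' dpsi
  else True.

Lemma C1_continuous k psi : C1 k psi -> continuous psi.
Proof. by case: k => [|k] []. Qed.

Lemma C1_lin k (a b : R) f g : C1 k f -> C1 k g -> C1 k (fun t => a * f t + b * g t).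
Proof.
elim: k f g => [|k IH] f g /=.
  move=> [cf _] [cg _]; split => //.
  by apply: continuous_addR; apply: continuous_mulR => //; exact: continuous_cstR.
move=> [cf [df fdf Cf]] [cg [dg gdg Cg]]; split.
  by apply: continuous_addR; apply: continuous_mulR => //; exact: continuous_cstR.
exists (fun t => a * df t + b * dg t); last exact: IH.
by move=> t; apply: is_derive_addR; exact: is_derive_mull.
Qed.

(** A family in which every derivative is a combination of two members consists of smooth functions.
    It serves both the bumps and the Hermite functions. *)
Lemma C1_family (F : nat -> R -> R) (a b : nat -> R) (p q : nat -> nat) :
  (forall m (t : R), is_derive t (1 : R) (F m) (a m * F (p m) t + b m * F (q m) t)) ->
  forall k m, C1 k (F m).
Proof.
move=> Fd; have cF m : continuous (F m).
  by apply: derivable_continuousR => t; eexists; exact: Fd.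
elim=> [|k IH] m /=; split => //.
by exists (fun t => a m * F (p m) t + b m * F (q m) t) => //; exact: C1_lin.
Qed.

(** The flat function exp(-1/t) with the powers of 1/t that its derivatives produce, so that the
    family is closed under differentiation. *)
Definition bump (j : nat) (t : R) : R := if 0 < t then t^-1 ^+ j * expR (- t^-1) else 0.

Lemma bump_ge0 j t : 0 <= bump j t.
Proof.
rewrite /bump; case: ifPn => // t0.
by rewrite mulr_ge0 ?expR_ge0 // exprn_ge0 // invr_ge0 ltW.
Qed.

(** With s = 1/t, the single term s^j / j! of the exponential series is at most exp(s). *)
Lemma bump_le j t : bump j t <= j`!%:R.
Proof.
rewrite /bump; case: ifPn => // t0; set s := t^-1.
have s0 : 0 <= s by rewrite invr_ge0 ltW.
rewrite expRN ler_pdivrMr ?expR_gt0 //.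
have := partial_exp_le j.+1 s0; rewrite big_nat_recr //= => h.
rewrite mulrC -ler_pdivrMr ?ltr0n ?fact_gt0 //; apply: le_trans h.
by rewrite lerDr sumr_ge0 // => i _; rewrite divr_ge0 // exprn_ge0.
Qed.

Lemma is_derive_bump j (t : R) :
  is_derive t (1 : R) (bump j) (1 * bump j.+2 t + (- j%:R) * bump j.+1 t).
Proof.
have [t0|t0|<-] := ltgtP 0 t.
- apply: (@near_eq_is_derive _ _ _ (fun u : R => u^-1 ^+ j * expR (- u^-1))).
    near=> u; rewrite /bump ifT //; near: u; exact: lt_nbhsr.
  have tn0 : t != 0 by rewrite gt_eqF.
  have dV : is_derive t (1 : R) (fun u : R => u^-1) (- t ^- 2).
    split; first exact: (@derivableV _ _ id).
    by rewrite (@deriveV _ _ id) // derive_id scaler1 -exprVn.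
  have dVN : is_derive t (1 : R) (fun u : R => - u^-1) (t ^- 2).
    by have := is_deriveN dV; rewrite opprK.
  have dE : is_derive t (1 : R) (fun u : R => expR (- u^-1)) (expR (- t^-1) * t ^- 2).
    exact: (is_derive_compR (psi := expR) (f := fun u : R => - u^-1)).
  have dX : is_derive t (1 : R) (fun u : R => u^-1 ^+ j) (j%:R * t^-1 ^+ j.-1 * (- t ^- 2)).
    by have := is_deriveX j dV; rewrite exprfctE.
  apply: is_derive_eq (is_derive_mulR dX dE) _.
  have e2 : t ^- 2 = t^-1 * t^-1 by rewrite -exprVn expr2.
  rewrite /bump t0 e2 !exprS.
  by case: j dX => [|j] _ /=; rewrite ?exprS; ring.
- apply: (@near_eq_is_derive _ _ _ (fun=> 0)).
    near=> u; rewrite /bump ifF //; apply/negbTE; rewrite -leNgt ltW //.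
    near: u; exact: lt_nbhsl.
  have tF : (0 < t) = false by apply/negbTE; rewrite -leNgt ltW.
  by rewrite /bump tF !mulr0 addr0; exact: is_derive_cstR.
have E : 1 * bump j.+2 0 + - j%:R * bump j.+1 0 = 0 :> R.
  by rewrite /bump ltxx !mulr0 addr0.
rewrite E.
have lim0 : (fun h : R => h^-1 *: ((bump j \o shift 0) (h *: 1) - bump j 0)) @ 0^' --> (0 : R).
  apply/cvgr0Pnorm_le => eps e0.
  near=> h.
  have h0 : h != 0 by near: h; exact: nbhs_dnbhs_neq.
  rewrite /= addr0 [h *: 1]mulr1 {2}/bump ltxx subr0.
  (* At 0 the difference quotient is h times a bounded function, so the derivative vanishes
     there. *)
  have -> : h^-1 *: bump j h = h * bump j.+2 h.
    rewrite /bump; case: ifP => _; last by rewrite scaler0 mulr0.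
    rewrite [LHS]mulrA !exprS; field; exact: h0.
  rewrite normrM (ger0_norm (bump_ge0 _ _)).
  apply: (@le_trans _ _ (`|h| * j.+2`!%:R)); first by rewrite ler_wpM2l // bump_le.
  rewrite -ler_pdivlMr ?ltr0n ?fact_gt0 //.
  near: h; apply: dnbhs0_le; by rewrite divr_gt0 // ltr0n fact_gt0.
split; first by apply/cvg_ex; exists 0.
exact: cvg_lim lim0.
Unshelve. all: by end_near. Qed.

Lemma C1_bump k j : C1 k (bump j).
Proof. exact: (C1_family is_derive_bump). Qed.

End smooth_1D.

Section smooth_rV.
Context {R : realType} {n : nat}.
Local Notation T := 'rV[R]_n.
Local Notation "'e i" := (delta_mx 0 i : T) (at level 0, i at level 0).
Implicit Types f g : T -> R.

Lemma Ck_intro k f (df : 'I_n -> T -> R) : continuous f ->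
  (forall i x, is_derive x ('e i) f (df i x)) -> (forall i, Ck k (df i)) -> Ck k.+1 f.
Proof.
move=> cf fd Cd; split => // i; split => [x|]; first by have [] := fd i x.
have -> : 'D_('e i) f = df i by apply/funext => x; have [] := fd i x.
exact: Cd.
Qed.

Lemma Ck_continuous k f : Ck k f -> continuous f.
Proof. by case: k => [|k] []. Qed.

Lemma Ck_elim k f : Ck k.+1 f ->
  (forall i x, is_derive x ('e i) f ('D_('e i) f x)) /\ (forall i, Ck k ('D_('e i) f)).
Proof.
by move=> [_ H]; split=> [i x|i]; have [d Cd] := H i => //; exact: derivableP.
Qed.

Lemma CkS k f : Ck k.+1 f -> Ck k f.
Proof.
elim: k f => [|k IH] f Cf; first by split => //; exact: Ck_continuous Cf.
have [fd Cd] := Ck_elim Cf.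
apply: (Ck_intro (df := fun i => 'D_('e i) f) (Ck_continuous Cf) fd) => i.
exact: IH (Cd i).
Qed.

Lemma CkD k f g : Ck k f -> Ck k g -> Ck k (fun x => f x + g x).
Proof.
elim: k f g => [|k IH] f g Cf Cg.
  have cf := Ck_continuous Cf; have cg := Ck_continuous Cg.
  by split => //; exact: continuous_addR.
have [fd Cdf] := Ck_elim Cf; have [gd Cdg] := Ck_elim Cg.
apply: (Ck_intro (df := fun i x => 'D_('e i) f x + 'D_('e i) g x)
  (continuous_addR (Ck_continuous Cf) (Ck_continuous Cg))
  (fun i x => is_derive_addR (fd i x) (gd i x))) => i.
exact: (IH _ _ (Cdf i) (Cdg i)).
Qed.

Lemma CkM k f g : Ck k f -> Ck k g -> Ck k (fun x => f x * g x).
Proof.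
elim: k f g => [|k IH] f g Cf Cg.
  have cf := Ck_continuous Cf; have cg := Ck_continuous Cg.
  by split => //; exact: continuous_mulR.
have [fd Cdf] := Ck_elim Cf; have [gd Cdg] := Ck_elim Cg.
apply: (Ck_intro (df := fun i x => f x * 'D_('e i) g x + g x * 'D_('e i) f x)
  (continuous_mulR (Ck_continuous Cf) (Ck_continuous Cg))
  (fun i x => is_derive_mulR (fd i x) (gd i x))) => i.
exact: (CkD (IH _ _ (CkS Cf) (Cdg i)) (IH _ _ (CkS Cg) (Cdf i))).
Qed.

Lemma Ck_cst k (c : R) : Ck k (fun _ : T => c).
Proof.
elim: k c => [|k IH] c; first by split => //; exact: continuous_cstR.
have d i x : is_derive x ('e i) (fun _ : T => c) 0 by exact: is_derive_cstR.
exact: (@Ck_intro k (fun=> c) (fun _ _ => 0) (@continuous_cstR _ _ c) d (fun=> IH 0)).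
Qed.

Lemma is_derive_coord (x v : T) (j : 'I_n) : is_derive x v (fun y : T => y 0 j) (v 0 j).
Proof.
apply/is_derive_line0.
have -> : (fun t : R => (x + t *: v) 0 j) = (fun t : R => x 0 j + v 0 j * t).
  by apply/funext => t; rewrite !mxE mulrC.
apply: is_derive_eq (is_derive_addR (is_derive_cstR _ _ _) (is_derive_mull _ (is_derive_id _ _))) _.
by rewrite add0r mulr1.
Qed.

Lemma Ck_coord k (j : 'I_n) : Ck k (fun x : T => x 0 j).
Proof.
case: k => [|k]; first by split => //; exact: coord_continuous.
have d i x : is_derive x ('e i) (fun y : T => y 0 j) (('e i) 0 j) by exact: is_derive_coord.
have c : continuous (fun y : T => y 0 j) by exact: coord_continuous.
exact: (@Ck_intro k _ (fun i _ => ('e i) 0 j) c d (fun i => Ck_cst k _)).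
Qed.

Lemma Ck_comp k (psi : R -> R) f : C1 k psi -> Ck k f -> Ck k (fun x => psi (f x)).
Proof.
elim: k psi f => [|k IH] psi f Cp Cf.
  have cf := Ck_continuous Cf; have cp := C1_continuous Cp.
  by split => //; exact: continuous_compR.
have [cp [dpsi pd Cd]] := Cp; have [fd Cdf] := Ck_elim Cf.
apply: (Ck_intro (df := fun i x => dpsi (f x) * 'D_('e i) f x)
  (continuous_compR cp (Ck_continuous Cf))
  (fun i x => is_derive_compR (pd (f x)) (fd i x))) => i.
exact: (CkM (IH _ _ Cd (CkS Cf)) (Cdf i)).
Qed.

Lemma Ck_sum k (I : Type) (r : seq I) (F : I -> T -> R) :
  (forall i, Ck k (F i)) -> Ck k (fun x => \sum_(i <- r) F i x).
Proof.
move=> CF; elim: r => [|i r IH].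
  by under eq_fun do rewrite big_nil; exact: Ck_cst.
by under eq_fun do rewrite big_cons; exact: CkD.
Qed.

Lemma Ck_prod k (I : Type) (r : seq I) (F : I -> T -> R) :
  (forall i, Ck k (F i)) -> Ck k (fun x => \prod_(i <- r) F i x).
Proof.
move=> CF; elim: r => [|i r IH].
  by under eq_fun do rewrite big_nil; exact: Ck_cst.
by under eq_fun do rewrite big_cons; exact: CkM.
Qed.

End smooth_rV.

(** * Diagonalization of symmetric matrices *)

Section orthogonal_diagonalization.
Context {R : rcfType}.

Lemma char_poly_orth n (H A : 'M[R]_n) : H *m H^T = 1%:M ->
  char_poly (H *m A *m H^T) = char_poly A.
Proof.
move=> HH; rewrite /char_poly.
have HHp : map_mx (@polyC R) H *m map_mx (@polyC R) H^T = 1%:M.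
  by rewrite -map_mxM HH map_mx1.
have -> : char_poly_mx (H *m A *m H^T) =
    map_mx (@polyC R) H *m char_poly_mx A *m map_mx (@polyC R) H^T.
  rewrite /char_poly_mx mulmxBr mulmxBl !map_mxM; congr (_ - _).
  by rewrite scalar_mxC -mulmxA HHp mulmx1.
by rewrite !det_mulmx mulrAC -det_mulmx HHp det1 mul1r.
Qed.

Definition border_mx n (a : R) (X : 'M[R]_n) : 'M[R]_(1 + n) :=
  block_mx (a%:M : 'M[R]_1) 0 0 X.

Lemma border_mxM n a b (X Y : 'M[R]_n) :
  border_mx a X *m border_mx b Y = border_mx (a * b) (X *m Y).
Proof.
rewrite /border_mx mulmx_block !mulmx0 !mul0mx !addr0 add0r.
by rewrite -scalar_mxM.
Qed.

Lemma tr_border_mx n a (X : 'M[R]_n) : (border_mx a X)^T = border_mx a X^T.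
Proof. by rewrite /border_mx tr_block_mx !trmx0 tr_scalar_mx. Qed.

Lemma char_poly_border n (a : R) (A : 'M[R]_n) :
  char_poly (border_mx a A) = ('X - a%:P) * char_poly A.
Proof.
rewrite /char_poly.
have -> : char_poly_mx (border_mx a A) =
   block_mx (('X - a%:P)%:M : 'M[{poly R}]_1) 0 0 (char_poly_mx A).
  rewrite /char_poly_mx /border_mx map_block_mx scalar_mx_block opp_block_mx add_block_mx.
  by rewrite !map_mx0 !oppr0 !addr0 map_scalar_mx -raddfB.
by rewrite det_ublock det_scalar1.
Qed.

Lemma rV_normsq_gt0 n (v : 'rV[R]_n) : v != 0 -> 0 < (v *m v^T) 0 0.
Proof.
move=> v0; rewrite mxE; have [j vj] : exists j, v 0 j != 0.
  apply/existsP; apply: contra_neqT v0 => /existsPn h.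
  by apply/rowP => j; rewrite mxE; apply/eqP; rewrite -[_ == _]negbK h.
rewrite (bigD1 j) //= !mxE ltr_pwDl //.
  by rewrite -expr2 lt_def sqrf_eq0 vj sqr_ge0.
by apply: sumr_ge0 => i _; rewrite mxE -expr2 sqr_ge0.
Qed.

Lemma diag_mx_border n (d : 'I_(1 + n) -> R) : diag_mx (\row_i d i) =
  border_mx (d ord0) (diag_mx (\row_i d (lift ord0 i))).
Proof.
have d0 : lshift n (0 : 'I_1) = ord0 by exact: val_inj.
have dS k : rshift 1 k = lift ord0 k :> 'I_(1 + n) by exact: val_inj.
apply/matrixP => i j; rewrite /border_mx.
case: (split_ordP i) => i' ->; case: (split_ordP j) => j' ->.
- by rewrite block_mxEul !mxE !ord1 d0.
- by rewrite block_mxEur !mxE eq_lrshift.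
- by rewrite block_mxEdl !mxE eq_rlshift.
- by rewrite block_mxEdr !mxE eq_rshift dS.
Qed.

(* Householder reflection exchanging the first basis vector and v. *)
Lemma orthogonal_first_row n (v : 'rV[R]_(1 + n)) : v *m v^T = 1%:M ->
  exists H : 'M[R]_(1 + n), H *m H^T = 1%:M /\ delta_mx 0 0 *m H = v.
Proof.
move=> vv; set e : 'rV[R]_(1 + n) := delta_mx 0 0.
have ee : e *m e^T = 1%:M.
  by rewrite trmx_delta mul_delta_mx; apply/matrixP => i j; rewrite !ord1 !mxE.
have [ve|nve] := eqVneq v e.
  by exists 1%:M; rewrite trmx1 !mulmx1 ve.
pose r := v - e; have r0 : r != 0 by rewrite subr_eq0.
set q := (r *m r^T) 0 0; have q0 : q != 0 by rewrite gt_eqF // rV_normsq_gt0.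
have rr : r *m r^T = q%:M by rewrite [LHS]mx11_scalar.
pose H : 'M[R]_(1 + n) := 1%:M - (2 / q) *: (r^T *m r).
have HT : H^T = H.
  by rewrite /H linearB /= trmx1 linearZ /= trmx_mul trmxK.
exists H; rewrite HT; split.
  rewrite /H; have : (r^T *m r) *m (r^T *m r) = q *: (r^T *m r).
    by rewrite mulmxA -[r^T *m r *m r^T]mulmxA rr mul_mx_scalar -scalemxAl.
  move: (r^T *m r) => P PP.
  rewrite mulmxBl mul1mx mulmxBr mulmx1 -scalemxAl -scalemxAr PP !scalerA.
  by apply/matrixP => i j; rewrite !mxE; field.
rewrite /H mulmxBr mulmx1 -scalemxAr mulmxA.
(* As [v] and [e] are unit vectors with product c, q = 2 - 2c and the product of e with r = v - e is
   c - 1. This is why the reflection sends [e] exactly to [v]. *)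
have er : e *m r^T = (- (q / 2))%:M.
  set c := (e *m v^T) 0 0.
  have ev : e *m v^T = c%:M by rewrite [LHS]mx11_scalar.
  have ve : v *m e^T = c%:M by rewrite -[LHS]trmxK trmx_mul trmxK ev tr_scalar_mx.
  have qE : q = 2 - 2 * c.
    rewrite /q /r linearB /= mulmxBl !mulmxBr vv ee ev ve !mxE /=; ring.
  have -> : - (q / 2) = c - 1 by rewrite qE; field.
  rewrite /r linearB /= mulmxBr ee ev.
  by apply/matrixP => i j; rewrite !mxE mulrnBl.
rewrite er mul_scalar_mx scalerA.
have -> : 2 / q * - (q / 2) = - 1 by field.
by rewrite scaleN1r opprK addrC subrK.
Qed.

(** Deflation: [d ord0] is a root, so it has a unit row eigenvector v; conjugating by an orthogonal
    H with first row v makes the first row of the symmetric matrix d ord0 times a basis vector,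
    hence block diagonal. Cancelling one linear factor of the characteristic polynomial gives the
    induction hypothesis and keeps the prescribed order of eigenvalues. *)
Theorem orthogonal_diagonalization n (A : 'M[R]_n) (d : 'I_n -> R) : A^T = A ->
  char_poly A = \prod_(i < n) ('X - (d i)%:P) ->
  exists U : 'M[R]_n, U *m U^T = 1%:M /\ A = U^T *m diag_mx (\row_i d i) *m U.
Proof.
elim: n A d => [|n IH] A d AT cA.
  by exists 1%:M; split; apply/matrixP => -[].
have : eigenvalue A (d ord0).
  by rewrite eigenvalue_root_char cA big_ord_recl rootM root_XsubC eqxx.
move=> /eigenvalueP[v0 v0A v0n].
have v0p := rV_normsq_gt0 v0n; set s := (v0 *m v0^T) 0 0 in v0p.
pose v := (Num.sqrt s)^-1 *: v0.
have vA : v *m A = d ord0 *: v by rewrite /v -scalemxAl v0A !scalerA mulrC.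
have vv : v *m v^T = 1%:M.
  rewrite /v linearZ /= -scalemxAl -scalemxAr scalerA -invfM -expr2 sqr_sqrtr ?ltW //.
  by rewrite [_ *m _]mx11_scalar -/s scale_scalar_mx mulVf // gt_eqF.
have [H [HH eH]] := @orthogonal_first_row n v vv.
have HTH : H^T *m H = 1%:M by exact: mulmx1C.
pose B : 'M[R]_(1 + n) := H *m A *m H^T.
have BT : B^T = B by rewrite /B !trmx_mul trmxK AT mulmxA.
have eB : delta_mx 0 0 *m B = d ord0 *: (delta_mx 0 0 : 'rV[R]_(1 + n)).
  by rewrite /B !mulmxA eH vA -scalemxAl -eH -mulmxA HH mulmx1.
have B0 j : B 0 j = d ord0 * (j == 0)%:R.
  by have := congr1 (fun M : 'rV[R]_(1 + n) => M 0 j) eB; rewrite -rowE !mxE.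
have AB : A = H^T *m B *m H.
  by rewrite /B -!mulmxA HTH mulmx1 !mulmxA HTH mul1mx.
have cB : char_poly B = char_poly A by exact: char_poly_orth.
clearbody B.
have BE : B = border_mx (d ord0) (drsubmx B).
  rewrite -[LHS]submxK /border_mx; congr block_mx; apply/matrixP => i j; rewrite !mxE.
  - by rewrite !ord1 lshift0 B0 eqxx mulr1.
  - by rewrite !ord1 lshift0 B0 mulr0.
  - by rewrite !ord1 lshift0 -[B]BT mxE B0 mulr0.
have AT' : (drsubmx B)^T = drsubmx B by rewrite trmx_drsub BT.
have cA' : char_poly (drsubmx B) = \prod_(i < n) ('X - (d (lift ord0 i))%:P).
  have := cB; rewrite {1}BE char_poly_border cA big_ord_recl.
  by apply: mulfI; rewrite polyXsubC_eq0.
have [U' [UU' AE]] := IH _ _ AT' cA'.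
pose W := border_mx 1 U'.
have WT : W^T = border_mx 1 U'^T by exact: tr_border_mx.
exists (W *m H); split.
  rewrite trmx_mul mulmxA -(mulmxA W H) HH mulmx1 WT [LHS]border_mxM mulr1 UU'.
  by rewrite /border_mx -scalar_mx_block.
rewrite AB [diag_mx _]diag_mx_border.
rewrite trmx_mul -!mulmxA; congr (_ *m _); rewrite !mulmxA; congr (_ *m _).
rewrite WT /W !border_mxM mul1r mulr1 -AE; exact: BE.
Qed.

End orthogonal_diagonalization.

(** * Hermite functions *)

Section hermite_1D.
Context {R : realType}.
Variable w : R.

(* H_k(sqrt w t) exp(- w t^2 / 2), up to the factor (sqrt w)^k; hf k.-1 is only used
   with the factor k, so its junk value at k = 0 is harmless *)
Fixpoint hf (k : nat) (t : R) : R :=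
  if k is k'.+1 then
    2 * w * t * hf k' t -
    (if k' is k''.+1 then 2 * w * k'%:R * hf k'' t else 0)
  else expR (- (w / 2 * t ^+ 2)).

Lemma hfS k t : hf k.+1 t = 2 * w * t * hf k t - 2 * w * k%:R * hf k.-1 t.
Proof. by case: k => [|k] //; rewrite mulr0 mul0r. Qed.

Lemma hf_coord k t : w * t * hf k t = w * k%:R * hf k.-1 t + 2^-1 * hf k.+1 t.
Proof. by rewrite hfS; field. Qed.

(** Together with [hf_coord] this says that w t + d/dt lowers the index, with factor 2 w k, and w t
    - d/dt raises it. As the recursion has two steps, the proof carries k and k + 1 together. *)
Lemma is_derive_hf k (t : R) :
  is_derive t (1 : R) (hf k) (w * k%:R * hf k.-1 t + (- 2^-1) * hf k.+1 t).
Proof.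
have dt : is_derive t (1 : R) (fun u : R => u) 1 by exact: is_derive_id.
have dlin : is_derive t (1 : R) (fun u : R => 2 * w * u) (2 * w).
  by apply: is_derive_eq (is_derive_mull (2 * w) dt) _; rewrite mulr1.
suff H : is_derive t (1 : R) (hf k) (w * k%:R * hf k.-1 t + (- 2^-1) * hf k.+1 t) /\
   is_derive t (1 : R) (hf k.+1) (w * k.+1%:R * hf k t + (- 2^-1) * hf k.+2 t).
  by have [] := H.
elim: k => [|k [IH1 IH2]].
  have d0 : is_derive t (1 : R) (hf 0) (- (w * t) * hf 0 t).
    have dsq : is_derive t (1 : R) (fun u : R => - (w / 2 * u ^+ 2)) (- (w * t)).
      have := is_derive_mull (- (w / 2)) (is_derive_mulR dt dt).
      under eq_fun do rewrite -expr2 mulNr.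
      by move=> h; apply: is_derive_eq h _; field.
    apply: is_derive_eq (is_derive_compR (is_derive_expR _) dsq) _.
    by rewrite mulrC.
  split; first by apply: is_derive_eq d0 _; rewrite hfS /=; field.
  have := is_derive_mulR dlin d0.
  have -> : (fun y : R => 2 * w * y * hf 0 y) = hf 1.
    by apply/funext => u; rewrite [RHS]hfS; ring.
  by move=> h; apply: is_derive_eq h _; rewrite hfS [hf 1 t]hfS /=; field.
split; first exact: IH2.
have := is_derive_addR (is_derive_mulR dlin IH2) (is_derive_mull (- (2 * w * k.+1%:R)) IH1).
have -> : (fun y : R => 2 * w * y * hf k.+1 y + - (2 * w * k.+1%:R) * hf k y) = hf k.+2.
  by apply/funext => u; rewrite [RHS]hfS; ring.
move=> h; apply: is_derive_eq h _.
rewrite [hf k.+3 t]hfS [hf k.+2 t]hfS -[k.+2.-1]/(k.+1) -[k.+1.-1]/k.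
have := hfS k t; set a := hf k.+1 t; set b := hf k t; set c := hf k.-1 t => ->.
by rewrite -!natr1; field.
Qed.

Lemma C1_hf k m : C1 k (hf m).
Proof. exact: (C1_family is_derive_hf). Qed.

Lemma le_expR_abs (t : R) : `|t| <= expR `|t|.
Proof. by apply: le_trans (expR_ge1Dx _); rewrite lerDr. Qed.

(** The Gaussian beats every exponential by completing the square; each further factor t costs one
    unit of the rate, which is arbitrary. *)
Lemma hf_rapid (w0 : 0 < w) k c : exists C, 0 <= C /\ forall t, `|hf k t| <= C * expR (- (c *
  `|t|)).
Proof.
suff H : (forall c, exists C, 0 <= C /\ forall t, `|hf k t| <= C * expR (- (c * `|t|))) /\
   (forall c, exists C, 0 <= C /\ forall t, `|hf k.+1 t| <= C * expR (- (c * `|t|))).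
  by have [] := H.
have lin (f : R -> R) : (forall c, exists C, 0 <= C /\ forall t, `|f t| <= C * expR (- (c *
  `|t|))) ->
    forall c, exists C, 0 <= C /\ forall t, `|2 * w * t * f t| <= C * expR (- (c * `|t|)).
  move=> fR {}c; have [C [C0 HC]] := fR (c + 1); exists (2 * w * C); split.
    by rewrite !mulr_ge0 // ltW.
  have w2 : 0 <= 2 * w by rewrite mulr_ge0 // ltW.
  move=> t; rewrite -[2 * w * t * f t]mulrA normrM (ger0_norm w2) -[leRHS]mulrA ler_wpM2l // normrM.
  apply: le_trans (ler_pM _ _ (le_expR_abs t) (HC t)) _ => //.
  rewrite mulrCA ler_wpM2l // -expRD ler_expR; lra.
elim: k => [|k [IH1 IH2]].
  have H0 c' : exists C, 0 <= C /\ forall t, `|hf 0 t| <= C * expR (- (c' * `|t|)).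
    (* The maximum of c' |t| - w t^2 / 2, attained at |t| = c' / w when c' >= 0, is this
       exponent. *)
    exists (expR (c' ^+ 2 / (2 * w))); split; first exact: expR_ge0.
    move=> t; rewrite ger0_norm ?expR_ge0 // -expRD ler_expR -subr_ge0.
    rewrite -(real_normK (num_real t)).
    have -> : c' ^+ 2 / (2 * w) - c' * `|t| - - (w / 2 * `|t| ^+ 2) =
       (w / 2) * (`|t| - c' / w) ^+ 2 by field; rewrite gt_eqF.
    by rewrite mulr_ge0 ?sqr_ge0 // divr_ge0 // ltW.
  split => // c'; have [C [C0 HC]] := lin _ H0 c'; exists C; split => // t.
  by rewrite hfS mulr0 mul0r subr0.
split => // c'; have [C [C0 HC]] := lin _ IH2 c'; have [D [D0 HD]] := IH1 c'.
exists (C + 2 * w * k.+1%:R * D); split.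
  by rewrite addr_ge0 // !mulr_ge0 // ltW.
move=> t; rewrite hfS [leRHS]mulrDl; apply: le_trans (ler_normB _ _) _.
have w2 : 0 <= 2 * w * k.+1%:R by rewrite !mulr_ge0 // ltW.
by apply: lerD => //; rewrite normrM (ger0_norm w2) -[leRHS]mulrA ler_wpM2l.
Qed.

End hermite_1D.

Section rapid_functions.
Context {R : realType} {n : nat}.
Local Notation T := 'rV[R]_n.
Local Notation mu := (@lebesgue_rV R n).
Implicit Types f g : T -> R.

(* decay faster than every exponential, unlike for Schwartz functions *)
Definition rapid f := continuous f /\ forall c : R, exists C : R,
  forall x, `|f x| <= C * expR (- (c * l1 x)).

Lemma rapidD f g : rapid f -> rapid g -> rapid (fun x => f x + g x).
Proof.
move=> [cf rf] [cg rg]; split; first exact: continuous_addR.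
move=> c; have [C HC] := rf c; have [D HD] := rg c; exists (C + D) => x.
by rewrite mulrDl; apply: le_trans (ler_normD _ _) _; rewrite lerD.
Qed.

Lemma rapidZ (a : R) f : rapid f -> rapid (fun x => a * f x).
Proof.
move=> [cf rf]; split; first by apply: continuous_mulR => //; exact: continuous_cstR.
move=> c; have [C HC] := rf c; exists (`|a| * C) => x.
by rewrite normrM -mulrA ler_wpM2l.
Qed.

Lemma rapidM f g : rapid f -> rapid g -> rapid (fun x => f x * g x).
Proof.
move=> [cf rf] [cg rg]; split; first exact: continuous_mulR.
move=> c; have [C HC] := rf c; have [D HD] := rg 0; exists (C * D) => x.
rewrite normrM mulrAC; apply: ler_pM => //.
by apply: le_trans (HD x) _; rewrite mul0r oppr0 expR0 mulr1.
Qed.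

Lemma rapid_coord i f : rapid f -> rapid (fun x => x 0 i * f x).
Proof.
move=> [cf rf]; split; first by apply: continuous_mulR => //; exact: coord_continuous.
move=> c; have [C HC] := rf (c + 1); exists C => x; rewrite normrM.
apply: le_trans (ler_pM _ _ (coord_le_l1 i x) (HC x)) _ => //.
have C0 : 0 <= C.
  have := le_trans (normr_ge0 _) (HC x); rewrite pmulr_lge0 ?expR_gt0 //.
have h : l1 x <= expR (l1 x) by apply: le_trans (expR_ge1Dx _); rewrite lerDr.
rewrite mulrCA ler_wpM2l //; apply: le_trans (ler_wpM2r (expR_ge0 _) h) _.
by rewrite -expRD ler_expR; lra.
Qed.

Lemma rapid_sum (I : Type) (r : seq I) (F : I -> T -> R) :
  (forall i, rapid (F i)) -> rapid (fun x => \sum_(i <- r) F i x).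
Proof.
move=> rF; elim: r => [|i r IH].
  under eq_fun do rewrite big_nil; split; first exact: continuous_cstR.
  by move=> c; exists 0 => x; rewrite normr0 mul0r.
by under eq_fun do rewrite big_cons; exact: rapidD.
Qed.

Lemma rapid_measurable f : rapid f -> measurable_fun setT f.
Proof. by move=> [cf _]; exact: continuous_measurable_rV. Qed.

Lemma rapid_bound1 f : rapid f -> exists C, forall x, `|f x| <= C * expR (- l1 x).
Proof.
by move=> [_ /(_ 1)[C HC]]; exists C => x; have := HC x; rewrite mul1r.
Qed.

Lemma rapid_integrable f : rapid f -> mu.-integrable setT (EFin \o f).
Proof.
move=> rf; have [C HC] := rapid_bound1 rf.
exact: (le_integrable_fun (rapid_measurable rf) HC (integrable_funZ C (integrable_exp_l1 n))).
Qed.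

Lemma rapid_sqrint f : rapid f -> sqrint mu f.
Proof.
move=> rf; split; first exact: rapid_measurable.
by have := rapid_integrable (rapidM rf rf); under eq_fun do rewrite -expr2.
Qed.

Lemma rapid_integral_partial0 i f g : rapid f -> rapid g ->
  (forall x, is_derive x (delta_mx 0 i) f (g x)) -> \int[mu]_x g x = 0.
Proof.
move=> rf rg fg; have [C HC] := rapid_bound1 rf; have [D HD] := rapid_bound1 rg.
apply: (@integral_partial0 _ _ i f g (`|C| + `|D|)).
- exact: rapid_measurable.
- by move=> x s; exact: is_derive_line.
- move=> x t; apply: continuous_comp; last by case: rg => cg _; exact: cg.
  exact: line_continuous.
- move=> x; apply: le_trans (HC x) _; rewrite ler_wpM2r ?expR_ge0 //.
  by apply: le_trans (ler_norm _) _; rewrite lerDl.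
- move=> x; apply: le_trans (HD x) _; rewrite ler_wpM2r ?expR_ge0 //.
  by apply: le_trans (ler_norm _) _; rewrite lerDr.
Qed.

Lemma rapid_integral_sum (I : Type) (r : seq I) (F : I -> T -> R) :
  (forall i, rapid (F i)) -> \int[mu]_x (\sum_(i <- r) F i x) = \sum_(i <- r) \int[mu]_x F i x.
Proof.
move=> rF; elim: r => [|i r IH].
  by under eq_Rintegral do rewrite big_nil; rewrite Rintegral_cst // mul0r big_nil.
under eq_Rintegral do rewrite big_cons.
rewrite RintegralD // ?IH ?big_cons //; apply: rapid_integrable => //.
exact: rapid_sum.
Qed.

End rapid_functions.

(** Leibniz rule for a list of factors; [uniq] makes the filter [j != i] remove exactly one of
    them. *)
Lemma is_derive_prodR {R : realType} {V : normedModType R} (I : eqType) (r : seq I)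
  (F : I -> V -> R) (dF : I -> R) (x v : V) : uniq r ->
  (forall i, is_derive x v (F i) (dF i)) ->
  is_derive x v (fun y => \prod_(i <- r) F i y)
    (\sum_(i <- r) dF i * \prod_(j <- r | j != i) F j x).
Proof.
move=> ur FdF; elim: r ur => [_|i r IH /= /andP[ir ur]].
  by under eq_fun do rewrite big_nil; rewrite big_nil; exact: is_derive_cstR.
under eq_fun do rewrite big_cons.
apply: is_derive_eq (is_derive_mulR (FdF i) (IH ur)) _.
rewrite [RHS]big_cons big_cons eqxx /= addrC; congr (_ + _).
  rewrite mulrC; congr (_ * _); rewrite big_seq [RHS]big_seq_cond.
  by apply: eq_bigl => j; rewrite andbC; case: eqP => // ->; rewrite (negbTE ir).
rewrite mulr_sumr; apply: eq_big_seq => k kr.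
rewrite big_cons ifT 1?mulrCA //.
by apply: contraNneq ir => ->.
Qed.

Section hermite_nD.
Context {R : realType} {n : nat}.
Variables (w : 'I_n -> R) (U : 'M[R]_n).
Hypothesis w0 : forall i, 0 < w i.
Hypothesis UU : U *m U^T = 1%:M.
Local Notation T := 'rV[R]_n.
Local Notation mu := (@lebesgue_rV R n).
Implicit Types (m : 'I_n -> nat) (x v : T).

Definition rot (i : 'I_n) x : R := \sum_l U i l * x 0 l.

Definition incm m i : 'I_n -> nat := fun j => (m j + (j == i))%N.
(** The subtraction is truncated, so [decm m i] is [m] when [m i = 0]; wherever that value occurs
    below, its coefficient [m i] vanishes. *)
Definition decm m i : 'I_n -> nat := fun j => (m j - (j == i))%N.

Definition herm m x : R := \prod_i hf (w i) (m i) (rot i x).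

Lemma herm_split m i x : herm m x =
  hf (w i) (m i) (rot i x) * \prod_(j | j != i) hf (w j) (m j) (rot j x).
Proof. by rewrite /herm (bigD1 i). Qed.

Lemma herm_inc m i x : herm (incm m i) x =
  hf (w i) (m i).+1 (rot i x) * \prod_(j | j != i) hf (w j) (m j) (rot j x).
Proof.
rewrite (herm_split _ i) /incm eqxx addn1; congr (_ * _).
by apply: eq_bigr => j ji; rewrite (negbTE ji) addn0.
Qed.

Lemma herm_dec m i x : herm (decm m i) x =
  hf (w i) (m i).-1 (rot i x) * \prod_(j | j != i) hf (w j) (m j) (rot j x).
Proof.
rewrite (herm_split _ i) /decm eqxx subn1; congr (_ * _).
by apply: eq_bigr => j ji; rewrite (negbTE ji) subn0.
Qed.

Lemma incmK m i : decm (incm m i) i = m.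
Proof. by apply/funext => j; rewrite /decm /incm addnK. Qed.

Lemma decmK m i : (0 < m i)%N -> incm (decm m i) i = m.
Proof.
move=> mi; apply/funext => j; rewrite /incm /decm.
by case: eqP => [->|_]; rewrite ?subnK // subn0 addn0.
Qed.

(** In the coordinates y = U x, [hermD] is the partial derivative of [herm m] in y_i, and [hermX] on
    the next line is the product by w_i y_i. *)
Definition hermD m i x : R := w i * (m i)%:R * herm (decm m i) x + (- 2^-1) * herm (incm m i) x.
Definition hermX m i x : R := w i * (m i)%:R * herm (decm m i) x + 2^-1 * herm (incm m i) x.

Lemma herm_rot m i x : w i * rot i x * herm m x = hermX m i x.
Proof.
rewrite /hermX herm_dec herm_inc (herm_split m i) !mulrA hf_coord; ring.
Qed.

Lemma is_derive_rot i x v : is_derive x v (rot i) (rot i v).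
Proof.
apply: is_derive_sumR => l; apply: is_derive_mull; exact: is_derive_coord.
Qed.

Lemma is_derive_herm m x v : is_derive x v (herm m) (\sum_i rot i v * hermD m i x).
Proof.
have d i : is_derive x v (fun y => hf (w i) (m i) (rot i y)) _ :=
  is_derive_compR (is_derive_hf (w i) (m i) (rot i x)) (is_derive_rot i x v).
apply: is_derive_eq (is_derive_prodR (index_enum_uniq _) d) _.
apply: eq_bigr => i _; rewrite /hermD herm_dec herm_inc; ring.
Qed.

Lemma rot_delta i l : rot i (delta_mx 0 l) = U i l.
Proof.
rewrite /rot (bigD1 l) //= big1 ?addr0.
  by rewrite mxE !eqxx mulr1.
by move=> j jl; rewrite mxE (negbTE jl) andbF mulr0.
Qed.

Lemma is_derive_hermD m i x v : is_derive x v (hermD m i)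
  (\sum_j rot j v * (w i * (m i)%:R * hermD (decm m i) j x + (- 2^-1) * hermD (incm m i) j x)).
Proof.
apply: is_derive_eq (is_derive_addR (is_derive_mull _ (is_derive_herm (decm m i) x v))
  (is_derive_mull _ (is_derive_herm (incm m i) x v))) _.
rewrite !mulr_sumr -big_split /=; apply: eq_bigr => j _; ring.
Qed.

Lemma U_orth i j : \sum_l U i l * U j l = (i == j)%:R.
Proof.
have := congr1 (fun M => fun_of_matrix M i j) UU; rewrite !mxE => <-.
by apply: eq_bigr => l _; rewrite mxE.
Qed.

Lemma Ck_rot k i : Ck k (rot i).
Proof.
by apply: Ck_sum => l; apply: CkM; [exact: Ck_cst|exact: Ck_coord].
Qed.

Lemma Ck_herm k m : Ck k (herm m).
Proof.
by apply: Ck_prod => i; apply: (Ck_comp (C1_hf _ _ _)); exact: Ck_rot.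
Qed.

Definition hermDD m x : R :=
  \sum_i (w i * (m i)%:R * hermD (decm m i) i x + (- 2^-1) * hermD (incm m i) i x).

(** Rotation invariance of the Laplacian: summing over l, the orthonormal rows of U kill the mixed
    derivatives in y_i, y_j. *)
Lemma laplacian_herm m x : laplacian (herm m) x = hermDD m x.
Proof.
rewrite /laplacian.
have D1 l : 'D_(delta_mx 0 l) (herm m) = fun y => \sum_i U i l * hermD m i y.
  apply/funext => y; have [_ ->] := is_derive_herm m y (delta_mx 0 l).
  by apply: eq_bigr => i _; rewrite rot_delta.
pose B i j := w i * (m i)%:R * hermD (decm m i) j x + (- 2^-1) * hermD (incm m i) j x.
have D2 l : 'D_(delta_mx 0 l) ('D_(delta_mx 0 l) (herm m)) x =
    \sum_i \sum_j U i l * U j l * B i j.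
  rewrite D1.
  have d : is_derive x (delta_mx 0 l) (fun y => \sum_i U i l * hermD m i y) _ :=
    is_derive_sumR _ (fun i => is_derive_mull (U i l) (is_derive_hermD m i x (delta_mx 0 l))).
  have [_ ->] := d; apply: eq_bigr => i _; rewrite mulr_sumr.
  by apply: eq_bigr => j _; rewrite rot_delta mulrA.
under eq_bigr do rewrite D2.
rewrite exchange_big /=; apply: eq_bigr => i _.
rewrite exchange_big /= (bigD1 i) //= -mulr_suml U_orth eqxx mul1r big1 ?addr0 //.
by move=> j ji; rewrite -mulr_suml U_orth eq_sym (negbTE ji) mul0r.
Qed.

Definition level m : R := \sum_i (2 * m i + 1)%:R * w i.

(** For each i, applying [hermX] twice and [hermD] twice gives the same terms in m_i + 2 and m_i -
    2, which cancel; what remains is (2 m_i + 1) w_i. The case m_i = 0 is separate because raising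
    undoes lowering only for positive m_i. *)
Lemma herm_eigen m x :
  - laplacian (herm m) x + (\sum_i w i ^+ 2 * rot i x ^+ 2) * herm m x = level m * herm m x.
Proof.
rewrite laplacian_herm /hermDD /level !mulr_suml -sumrN -big_split /=.
apply: eq_bigr => i _.
have -> : w i ^+ 2 * rot i x ^+ 2 * herm m x = w i * rot i x * (w i * rot i x * herm m x) by ring.
have -> : w i * rot i x * (w i * rot i x * herm m x) =
    w i * (m i)%:R * hermX (decm m i) i x + 2^-1 * hermX (incm m i) i x.
  by rewrite (herm_rot m) -(herm_rot (decm m i)) -(herm_rot (incm m i)) /hermX; ring.
have incE : incm m i i = (m i).+1 by rewrite /incm eqxx addn1.
rewrite /hermX /hermD incmK incE natrD natrM -natr1.
have [->|mi] := posnP (m i); first by rewrite mulr0; field.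
by rewrite decmK //; field.
Qed.

Lemma rot_inv x l : x 0 l = \sum_i U i l * rot i x.
Proof.
have UTU : U^T *m U = 1%:M by exact: mulmx1C.
have E : x *m U^T *m U = x by rewrite -mulmxA UTU mulmx1.
rewrite -[in LHS]E mxE; apply: eq_bigr => i _; rewrite mulrC; congr (_ * _).
by rewrite mxE /rot; apply: eq_bigr => j _; rewrite mxE mulrC.
Qed.

Lemma l1_le_rot x : l1 x <= (\sum_l \sum_i `|U i l|) * \sum_i `|rot i x|.
Proof.
rewrite mulr_suml; apply: ler_sum => l _; rewrite rot_inv mulr_suml.
apply: le_trans (ler_norm_sum _ _ _) _; apply: ler_sum => i _.
rewrite normrM ler_wpM2l // (bigD1 i) //= lerDl sumr_ge0 //.
Qed.

(** Decay is known in each y_i. Since x is the transpose of U applied to y, l1 x is at most K times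
    the sum of the |y_i|, so the rate |c| K in every y_i suffices. *)
Lemma herm_rapid m : rapid (herm m).
Proof.
split; first exact: Ck_continuous (Ck_herm 0 m).
move=> c; pose K := \sum_l \sum_i `|U i l|.
have [C HC] := choice (fun i => hf_rapid (w0 i) (m i) (`|c| * K)).
exists (\prod_i C i) => x; rewrite /herm normr_prod.
apply: (@le_trans _ _ (\prod_i (C i * expR (- (`|c| * K * `|rot i x|))))).
  by apply: ler_prod => i _; rewrite normr_ge0 /=; have [_] := HC i.
rewrite big_split /= ler_wpM2l ?prodr_ge0 // => [i _|]; first by have [] := HC i.
rewrite -expR_sum ler_expR sumrN lerN2 -mulr_sumr -mulrA.
apply: le_trans (ler_wpM2l (normr_ge0 c) (l1_le_rot x)).
by rewrite ler_wpM2r ?l1_ge0 // ler_norm.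
Qed.

Lemma hermD_rapid m i : rapid (hermD m i).
Proof. by apply: rapidD; apply: rapidZ; exact: herm_rapid. Qed.

(* <a^* f, g> = <f, a g> for the ladder operators a = d_u + w (u.x), a^* = - d_u + w (u.x) *)
Lemma herm_ladder m m' i :
  \int[mu]_x (herm (incm m i) x * herm m' x) =
  2 * w i * (m' i)%:R * \int[mu]_x (herm m x * herm (decm m' i) x).
Proof.
(* The partial derivative of [herm m * herm m'] in x_l. Combining these with row i of U gives its
   derivative in y_i, whose integral is therefore zero. *)
pose G l x := herm m x * (\sum_j U j l * hermD m' j x) + herm m' x * (\sum_j U j l * hermD m j x).
have rG l : rapid (G l).
  by apply: rapidD; apply: rapidM (herm_rapid _) (rapid_sum _ _) => j; apply: rapidZ; exact:
    hermD_rapid.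
have IG l : \int[mu]_x G l x = 0.
  apply: (rapid_integral_partial0 (i := l) (rapidM (herm_rapid m) (herm_rapid m')) (rG l)) => x.
  apply: is_derive_eq (is_derive_mulR (is_derive_herm m x _) (is_derive_herm m' x _)) _.
  by congr (_ * _ + _ * _); apply: eq_bigr => j _; rewrite rot_delta.
have Gsum x : \sum_l U i l * G l x = herm m x * hermD m' i x + herm m' x * hermD m i x.
  rewrite /G; under eq_bigr do rewrite mulrDr mulrCA [U i _ * (herm m' x * _)]mulrCA.
  have key m1 : \sum_l U i l * (\sum_j U j l * hermD m1 j x) = hermD m1 i x.
    under eq_bigr do rewrite mulr_sumr.
    rewrite exchange_big /= (bigD1 i) //=.
    under eq_bigr do rewrite mulrA.
    rewrite -mulr_suml U_orth eqxx mul1r big1 ?addr0 //.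
    move=> j ji; under eq_bigr do rewrite mulrA.
    by rewrite -mulr_suml U_orth eq_sym (negbTE ji) mul0r.
  by rewrite big_split /= -!mulr_sumr !key.
have I0 : \int[mu]_x (herm m x * hermD m' i x + herm m' x * hermD m i x) = 0.
  under eq_Rintegral do rewrite -Gsum.
  rewrite rapid_integral_sum => [|l]; last exact: rapidZ.
  by rewrite big1 // => l _; rewrite RintegralZl // ?IG ?mulr0 //; exact: rapid_integrable.
have r1 := rapidM (herm_rapid (incm m i)) (herm_rapid m').
have r2 := rapidM (herm_rapid m) (herm_rapid (decm m' i)).
have r3 : rapid (fun x => herm m x * hermD m' i x + herm m' x * hermD m i x).
  by apply: rapidD; apply: rapidM (herm_rapid _) (hermD_rapid _ _).
have E : \int[mu]_x (2 * w i * (m' i)%:R * (herm m x * herm (decm m' i) x)) =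
   \int[mu]_x ((herm (incm m i) x * herm m' x) +
     1 * (herm m x * hermD m' i x + herm m' x * hermD m i x)).
  apply: eq_Rintegral => x _; rewrite mul1r.
  have h1 := herm_rot m i x; have h2 := herm_rot m' i x.
  have e1 : hermD m' i x = hermX m' i x - herm (incm m' i) x by rewrite /hermD /hermX; field.
  have e2 : hermX m' i x + hermD m' i x = 2 * w i * (m' i)%:R * herm (decm m' i) x.
    by rewrite /hermD /hermX; field.
  have e3 : hermD m i x = hermX m i x - herm (incm m i) x by rewrite /hermD /hermX; field.
  have -> : 2 * w i * (m' i)%:R * (herm m x * herm (decm m' i) x) =
     herm m x * (hermX m' i x + hermD m' i x) by rewrite e2; ring.
  by rewrite e3 -h1 -h2; ring.
rewrite -RintegralZl // ?E; last exact: rapid_integrable.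
rewrite RintegralD //; [|exact: rapid_integrable|by apply/rapid_integrable/rapidZ].
by rewrite RintegralZl // ?I0 ?mulr0 ?addr0 //; exact: rapid_integrable.
Qed.

(** Where the indices differ in coordinate i, [herm_ladder] lowers both there; when the smaller one
    reaches 0 its factor [m' i] annihilates the integral. *)
Lemma herm_orth m m' : m <> m' -> \int[mu]_x (herm m x * herm m' x) = 0.
Proof.
have sym m1 m2 : \int[mu]_x (herm m1 x * herm m2 x) = \int[mu]_x (herm m2 x * herm m1 x).
  by apply: eq_Rintegral => x _; rewrite mulrC.
have H k : forall m1 m2 i, (m1 i > m2 i)%N -> m2 i = k -> \int[mu]_x (herm m1 x * herm m2 x) = 0.
  elim: k => [|k IH] m1 m2 i lt12 m2k; rewrite -(decmK (m := m1) (i := i)) ?(leq_ltn_trans _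
    lt12) //.
    by rewrite herm_ladder m2k mulr0 mul0r.
  rewrite herm_ladder (IH _ _ i) ?mulr0 // /decm eqxx; last by rewrite m2k subn1.
  by rewrite ltn_sub2r // (leq_ltn_trans _ lt12) // m2k.
move=> mm'; have [i mi] : exists i, m i != m' i.
  apply/existsP; apply: contra_notT mm' => /existsPn h.
  by apply/funext => i; apply/eqP; rewrite -[_ == _]negbK h.
move: mi; rewrite neq_ltn => /orP[lt|lt]; last exact: H lt _.
by rewrite sym; exact: H lt _.
Qed.

End hermite_nD.

(** * Test functions and Green's identity *)

Section bounded_support.
Context {R : realType} {n : nat}.
Local Notation T := 'rV[R]_n.
Local Notation "'e i" := (delta_mx 0 i : T) (at level 0, i at level 0).
Implicit Types (f g : T -> R) (x : T).

Lemma continuous_l1 : continuous (@l1 R n).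
Proof.
rewrite /l1; elim: (index_enum _) => [|i r IH].
  by under eq_fun do rewrite big_nil; exact: continuous_cstR.
under eq_fun do rewrite big_cons; apply: continuous_addR => //.
apply: continuous_compR; first exact: norm_continuous.
exact: coord_continuous.
Qed.

Lemma closed_l1 (r : R) : closed [set x : T | l1 x <= r].
Proof.
apply: (@preimage_closed _ _ (@l1 R n) [set t | t <= r]); last exact: closed_le.
by move=> x _; exact: continuous_l1.
Qed.

Lemma compact_l1 (r : R) : compact [set x : T | l1 x <= r].
Proof.
apply: bounded_closed_compact.
  exists r; split; first exact: num_real.
  move=> y ry x /= xr; rewrite /Num.Def.normr /= mx_normrE.
  apply: bigmax_le => [|[i j] _ /=].
    by apply: le_trans (ltW ry); apply: le_trans (l1_ge0 _) xr.
  by rewrite ord1 (le_trans (coord_le_l1 _ _)) // (le_trans xr) // ltW.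
exact: closed_l1.
Qed.

Definition bounded_support f := exists r : R, forall x, r < l1 x -> f x = 0.

Lemma bounded_support_rapid f : continuous f -> bounded_support f -> rapid f.
Proof.
move=> cf [r f0]; split => // c.
have /compact_bounded[M [_ HM]] : compact (f @` [set x : T | l1 x <= r]).
  apply: continuous_compact; last exact: compact_l1.
  exact: continuous_subspaceT.
exists (`|M + 1| * expR (`|c| * `|r|)) => x.
have [xr|xr] := leP (l1 x) r; last by rewrite f0 // normr0 !mulr_ge0 ?expR_ge0.
have fM : `|f x| <= M + 1 by apply: HM; [rewrite ltrDl|exists x].
apply: le_trans (le_trans fM (ler_norm _)) _.
rewrite -mulrA -expRD ler_peMr // -expR0 ler_expR subr_ge0.
apply: le_trans (ler_norm _) _; rewrite normrM ler_wpM2l //.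
by rewrite ger0_norm ?l1_ge0 // (le_trans xr) // ler_norm.
Qed.

Lemma bounded_support_partial f i : bounded_support f -> bounded_support ('D_('e i) f).
Proof.
move=> [r f0]; exists r => x rx.
have [_ <-] // : is_derive x ('e i) f 0.
have d0 : is_derive x ('e i) (fun _ : T => (0 : R)) 0 by exact: is_derive_cstR.
apply: near_eq_is_derive d0.
have : \forall y \near x, r < l1 y by exact: (continuous_l1 (x := x) (lt_nbhsr rx)).
by apply: filterS => y ry; rewrite f0.
Qed.

Lemma compact_supportP (phi : T -> R[i]) : compact (closure [set x | phi x != 0]) <->
  bounded_support (fun x => complex.Re (phi x)) /\ bounded_support (fun x => complex.Im (phi x)).
Proof.
split=> [/compact_bounded[M [_ HM]]|[[r r0] [s s0]]].
  have phi0 x : (M + 1) *+ n < l1 x -> phi x = 0.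
    move=> Mx; apply/eqP; apply: contraTT Mx => phix; rewrite -leNgt.
    have xM : `|x| <= M + 1 by apply: HM; [rewrite ltrDl|exact: subset_closure].
    apply: (@le_trans _ _ (\sum_(i < n) (M + 1))); last by rewrite sumr_const card_ord.
    apply: ler_sum => i _; apply: le_trans xM.
    rewrite [leRHS]/Num.Def.normr /= mx_normrE.
    exact: (le_bigmax _ (fun ij : 'I_1 * 'I_n => `|x ij.1 ij.2|) (0, i)).
  by split; exists ((M + 1) *+ n) => x /phi0 ->.
apply: (subclosed_compact (B := [set x | l1 x <= Num.max r s])).
- exact: closed_closure.
- exact: compact_l1.
rewrite [X in _ `<=` X](closure_id _).1.
  apply: closureS => x /= phix; rewrite leNgt; apply: contra phix => rx.
  rewrite eq_complex /= r0 ?s0 ?eqxx //; apply: le_lt_trans rx; rewrite le_max lexx ?orbT //.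
exact: closed_l1.
Qed.

End bounded_support.

Section green.
Context {R : realType} {n : nat}.
Local Notation T := 'rV[R]_n.
Local Notation mu := (@lebesgue_rV R n).
Local Notation "'e i" := (delta_mx 0 i : T) (at level 0, i at level 0).
Implicit Types (f g : T -> R) (x : T).

(** The common class for Green's identity: it contains the real and imaginary parts of test
    functions as well as the Hermite functions. *)
Definition rapid2 f := [/\ Ck 2 f, rapid f, forall i, rapid ('D_('e i) f)
  & forall i, rapid ('D_('e i) ('D_('e i) f))].

Lemma bounded_support_rapid2 f : Ck 2 f -> bounded_support f -> rapid2 f.
Proof.
move=> Cf bf; have [_ Cdf] := Ck_elim Cf; split => // [|i|i].
- exact: bounded_support_rapid (Ck_continuous Cf) bf.
- exact: bounded_support_rapid (Ck_continuous (Cdf i)) (bounded_support_partial i bf).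
- have [_ Cddf] := Ck_elim (Cdf i).
  apply: bounded_support_rapid (Ck_continuous (Cddf i)) _.
  exact/bounded_support_partial/bounded_support_partial.
Qed.

Lemma rapid_laplacian f : rapid2 f -> rapid (laplacian f).
Proof. by move=> [_ _ _ rf]; exact: rapid_sum. Qed.

(** The divergence of f grad g - g grad f is f times the Laplacian of g minus g times that of f, and
    its integral vanishes one coordinate at a time. *)
Lemma green f g : rapid2 f -> rapid2 g ->
  \int[mu]_x (laplacian f x * g x) = \int[mu]_x (f x * laplacian g x).
Proof.
move=> rf rg; have [Cf f0 f1 f2] := rf; have [Cg g0 g1 g2] := rg.
have rfg := rapidM (rapid_laplacian rf) g0.
have rgf := rapidM f0 (rapid_laplacian rg).
pose G i x := f x * 'D_('e i) ('D_('e i) g) x + - 1 * (g x * 'D_('e i) ('D_('e i) f) x).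
have rG i : rapid (G i) by apply: rapidD; [exact: rapidM|apply: rapidZ; exact: rapidM].
have G0 i : \int[mu]_x G i x = 0.
  have [fd Cdf] := Ck_elim Cf; have [gd Cdg] := Ck_elim Cg.
  have [fdd _] := Ck_elim (Cdf i); have [gdd _] := Ck_elim (Cdg i).
  have rF : rapid (fun x => f x * 'D_('e i) g x + - 1 * (g x * 'D_('e i) f x)).
    by apply: rapidD; [exact: rapidM|apply: rapidZ; exact: rapidM].
  apply: (rapid_integral_partial0 rF (rG i) (i := i)) => x.
  apply: is_derive_eq (is_derive_addR (is_derive_mulR (fd i x) (gdd i x))
    (is_derive_mull _ (is_derive_mulR (gd i x) (fdd i x)))) _.
  rewrite /G; move: (f x) (g x) ('D_('e i) f x) ('D_('e i) g x)
    ('D_('e i) ('D_('e i) f) x) ('D_('e i) ('D_('e i) g) x) => *; ring.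
apply/eqP; rewrite eq_sym -subr_eq0 -RintegralB //; try exact: rapid_integrable.
have <- : \int[mu]_x (\sum_i G i x) = 0 by rewrite rapid_integral_sum // big1.
apply/eqP; apply: eq_Rintegral => x _; rewrite /laplacian mulr_sumr mulr_suml -sumrB.
apply: eq_bigr => i _; rewrite /G.
move: (f x) (g x) ('D_('e i) ('D_('e i) f) x) ('D_('e i) ('D_('e i) g) x) => *; ring.
Qed.

End green.

(** * Smooth cutoffs and the errors they cause *)

Section cutoff.
Context {R : realType} {n : nat}.
Local Notation T := 'rV[R]_n.
Local Notation mu := (@lebesgue_rV R n).
Local Notation "'e i" := (delta_mx 0 i : T) (at level 0, i at level 0).
Implicit Types (f g : T -> R) (x : T) (s : R).

Definition sqnorm x : R := \sum_i x 0 i * x 0 i.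

Lemma sqnorm_ge0 x : 0 <= sqnorm x.
Proof. by apply: sumr_ge0 => i _; rewrite -expr2 sqr_ge0. Qed.

Lemma l1_le_sqnorm x : l1 x <= n%:R + sqnorm x.
Proof.
have -> : n%:R = \sum_(i < n) (1 : R) by rewrite sumr_const card_ord.
rewrite /sqnorm -big_split /=; apply: ler_sum => i _.
rewrite -expr2 -(real_normK (num_real (x 0 i))).
have := sqr_ge0 (`|x 0 i| - 1); have := normr_ge0 (x 0 i).
by move: `|x 0 i| => t; nra.
Qed.

Lemma is_derive_sqnorm i x : is_derive x ('e i) sqnorm (2 * x 0 i).
Proof.
have d j : is_derive x ('e i) (fun y : T => y 0 j * y 0 j) _ :=
  is_derive_mulR (is_derive_coord x _ j) (is_derive_coord x _ j).
apply: is_derive_eq (is_derive_sumR _ d) _.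
rewrite (bigD1 i) //= big1 ?addr0 => [|j ji].
  by rewrite mxE !eqxx mulr1 mulr2n mulrDl mul1r.
by rewrite mxE (negbTE ji) andbF mulr0 addr0.
Qed.

(** The factor [expR 1] normalises the value at the origin to 1; the support is the ball s |x|^2 <=
    1. [cut1] and [cut2] below are the first and second partial derivatives in x_i. *)
Definition cut s x : R := expR 1 * bump 0 (1 + - s * sqnorm x).
Definition cut1 s i x : R := expR 1 * (bump 2 (1 + - s * sqnorm x) * (- s * (2 * x 0 i))).
Definition cut2 s i x : R := expR 1 *
  (bump 2 (1 + - s * sqnorm x) * (- s * 2) + (- s * (2 * x 0 i)) *
    ((1 * bump 4 (1 + - s * sqnorm x) + - 2 * bump 3 (1 + - s * sqnorm x)) * (- s * (2 * x 0 i)))).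

Lemma is_derive_bump_sqnorm j s i x :
  is_derive x ('e i) (fun y => bump j (1 + - s * sqnorm y))
   ((1 * bump j.+2 (1 + - s * sqnorm x) + - j%:R * bump j.+1 (1 + - s * sqnorm x)) *
    (- s * (2 * x 0 i))).
Proof.
have d : is_derive x ('e i) (fun y => 1 + - s * sqnorm y) (- s * (2 * x 0 i)).
  apply: is_derive_eq (is_derive_addR (is_derive_cstR 1 x _)
    (is_derive_mull (- s) (is_derive_sqnorm i x))) _.
  by rewrite add0r.
exact: (is_derive_compR (is_derive_bump j _) d).
Qed.

Lemma is_derive_cut s i x : is_derive x ('e i) (cut s) (cut1 s i x).
Proof.
apply: is_derive_eq (is_derive_mull (expR 1) (is_derive_bump_sqnorm 0 s i x)) _.
by rewrite oppr0 mul0r addr0 mul1r.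
Qed.

Lemma is_derive_cut1 s i x : is_derive x ('e i) (cut1 s i) (cut2 s i x).
Proof.
have d : is_derive x ('e i) (fun y : T => - s * (2 * y 0 i)) (- s * 2).
  apply: is_derive_eq (is_derive_mull (- s) (is_derive_mull 2 (is_derive_coord x _ i))) _.
  by rewrite mxE !eqxx mulr1.
exact: (is_derive_mull (expR 1) (is_derive_mulR (is_derive_bump_sqnorm 2 s i x) d)).
Qed.

Lemma Ck_cut k s : Ck k (cut s).
Proof.
apply: CkM; first exact: Ck_cst.
apply: Ck_comp; first exact: C1_bump.
apply: CkD; first exact: Ck_cst.
apply: CkM; first exact: Ck_cst.
by apply: Ck_sum => i; apply: CkM; exact: Ck_coord.
Qed.

Lemma bounded_support_cut s : 0 < s -> bounded_support (cut s).
Proof.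
move=> s0; exists (n%:R + s^-1) => x /lt_le_trans/(_ (l1_le_sqnorm x)).
rewrite ltrD2l -[s^-1]mulr1 ltr_pdivrMl // => sx.
rewrite /cut /bump ifF ?mulr0 //; apply/negbTE; rewrite -leNgt mulNr subr_le0 ltW //.
Qed.

(** With u = s |x|^2 and v = u / (1 - u), the deviation is 1 - exp(-v) <= v <= 2u for u <= 1/2; for
    larger u it is at most 1 <= 2u. *)
Lemma cut_le s x : 0 < s -> `|cut s x - 1| <= s * `|2 * sqnorm x|.
Proof.
move=> s0; rewrite [`|2 * _|]ger0_norm ?mulr_ge0 ?sqnorm_ge0 //.
rewrite /cut /bump mulNr [leRHS]mulrCA; have : 0 <= s * sqnorm x by rewrite mulr_ge0
  ?sqnorm_ge0 // ltW.
move: (s * sqnorm x) => u u0; case: ifPn => [u1|]; last first.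
  by rewrite -leNgt mulr0 sub0r normrN1; lra.
rewrite expr0 mul1r -expRD.
have -> : 1 + - (1 - u)^-1 = - (u / (1 - u)) by field; rewrite gt_eqF.
set v := u / (1 - u); have v0 : 0 <= v by rewrite divr_ge0 // ltW.
have e1 : expR (- v) <= 1 by rewrite -expR0 ler_expR oppr_le0.
rewrite distrC ger0_norm ?subr_ge0 //.
have e0 := expR_gt0 (- v); have ev := expR_ge1Dx (- v).
have [u2|u2] := leP u 2^-1; last by lra.
have : v <= 2 * u by rewrite ler_pdivrMr //; nra.
lra.
Qed.

Lemma cut1_le s i x : 0 < s -> `|cut1 s i x| <= s * `|4 * expR 1 * x 0 i|.
Proof.
move=> s0; rewrite /cut1 !normrM normrN (gtr0_norm s0) !(ger0_norm (expR_ge0 _)).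
rewrite (ger0_norm (bump_ge0 _ _)) !normr_nat.
have := bump_le 2 (1 + - s * sqnorm x); have := bump_ge0 2 (1 + - s * sqnorm x).
rewrite (_ : 2`!%:R = 2) //; move: (bump 2 _) => b b0 b2.
have -> : s * (4 * expR 1 * `|x 0 i|) = expR 1 * (2 * (s * (2 * `|x 0 i|))) by ring.
by rewrite ler_wpM2l ?expR_ge0 // ler_wpM2r // !mulr_ge0 // ltW.
Qed.

(** The constants come from [bump_le]: 2 times 2! is 4, and 144 is 4 times 36 with 36 = 4! + 2 times
    3!. The quadratic term carries s^2, which is at most s as s <= 1. *)
Lemma cut2_le s i x : 0 < s <= 1 ->
  `|cut2 s i x| <= s * `|4 * expR 1 + 144 * expR 1 * (x 0 i * x 0 i)|.
Proof.
move=> /andP[s0 s1]; rewrite /cut2; move: (1 + - s * sqnorm x) => t.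
have := bump_le 2 t; have := bump_ge0 2 t; have := bump_le 3 t; have := bump_ge0 3 t.
have := bump_le 4 t; have := bump_ge0 4 t.
rewrite (_ : 2`!%:R = 2) // (_ : 3`!%:R = 6) // (_ : 4`!%:R = 24) //.
move: (bump 2 t) (bump 3 t) (bump 4 t) => b c d d0 dle c0 cle b0 ble.
have y0 : 0 <= x 0 i * x 0 i by rewrite -expr2 sqr_ge0.
have -> : expR 1 * (b * (- s * 2) + - s * (2 * x 0 i) * ((1 * d + - 2 * c) * (- s * (2 * x 0 i)))) =
  expR 1 * s * (4 * (s * (x 0 i * x 0 i)) * (d - 2 * c) - 2 * b) by ring.
have -> : 4 * expR 1 + 144 * expR 1 * (x 0 i * x 0 i) = expR 1 * (4 + 144 * (x 0 i * x 0 i)) by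
  ring.
move: (x 0 i * x 0 i) y0 => y y0.
rewrite normrM (ger0_norm (mulr_ge0 (expR_ge0 _) (ltW s0))) normrM (ger0_norm (expR_ge0 _)).
rewrite [leRHS]mulrCA -mulrA; do 2 (rewrite ler_wpM2l ?expR_ge0 ?(ltW s0) //).
rewrite [leRHS]ger0_norm; last by lra.
apply: le_trans (ler_normB _ _) _.
rewrite (ger0_norm (mulr_ge0 (ler0n _ 2) b0)) addrC lerD //; first by lra.
rewrite normrM ger0_norm; last by rewrite !mulr_ge0 // ltW.
have sy : 4 * (s * y) <= 4 * y by rewrite ler_wpM2l // ler_piMl.
have dc : `|d - 2 * c| <= 36 by rewrite ler_norml; lra.
apply: le_trans (ler_pM _ _ sy dc) _ => //; first by rewrite !mulr_ge0 // ltW.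
lra.
Qed.

(* s is the inverse square of the cutoff radius *)
Definition small (F : R -> T -> R) := exists C : R,
  forall s x, 0 < s <= 1 -> `|F s x| <= s * (C * expR (- l1 x)).

Lemma smallD F G : small F -> small G -> small (fun s x => F s x + G s x).
Proof.
move=> [C HC] [D HD]; exists (C + D) => s x s01.
by rewrite mulrDl mulrDr; apply: le_trans (ler_normD _ _) _; rewrite lerD ?HC ?HD.
Qed.

Lemma small_sum (I : Type) (r : seq I) (F : I -> R -> T -> R) :
  (forall i, small (F i)) -> small (fun s x => \sum_(i <- r) F i s x).
Proof.
move=> sF; elim: r => [|i r [C HC]].
  by exists 0 => s x _; rewrite big_nil normr0 mul0r mulr0.
by have [D HD] := smallD (sF i) (ex_intro _ C HC); exists D => s x /HD; rewrite big_cons.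
Qed.

Lemma small_rapid F g : rapid g ->
  (forall s x, 0 < s <= 1 -> `|F s x| <= s * `|g x|) -> small F.
Proof.
move=> /rapid_bound1[C HC] Fg; exists C => s x s01; apply: le_trans (Fg s x s01) _.
by rewrite ler_wpM2l //; have /andP[/ltW] := s01.
Qed.

Lemma rapid_sqnorm f : rapid f -> rapid (fun x => sqnorm x * f x).
Proof.
move=> rf; rewrite /sqnorm; under eq_fun do rewrite mulr_suml.
by apply: rapid_sum => i; under eq_fun do rewrite -mulrA; do 2 apply: rapid_coord.
Qed.

Lemma small_cut f : rapid f -> small (fun s x => cut s x * f x - f x).
Proof.
move=> rf; apply: (small_rapid (rapidZ 2 (rapid_sqnorm rf))) => s x /andP[s0 _].
rewrite -[X in _ - X]mul1r -mulrBl mulrA [in leRHS]normrM mulrA normrM.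
by rewrite ler_wpM2r // cut_le.
Qed.

Lemma laplacian_cut s f x : Ck 2 f -> laplacian (fun y => cut s y * f y) x =
  \sum_i (cut s x * 'D_('e i) ('D_('e i) f) x +
    (2 * cut1 s i x * 'D_('e i) f x + f x * cut2 s i x)).
Proof.
move=> Cf; have [fd Cdf] := Ck_elim Cf; apply: eq_bigr => i _.
have [fdd _] := Ck_elim (Cdf i).
have -> : 'D_('e i) (fun y => cut s y * f y) =
    fun y => cut s y * 'D_('e i) f y + f y * cut1 s i y.
  by apply/funext => y; have [_ ->] := is_derive_mulR (is_derive_cut s i y) (fd i y).
have [_ ->] := is_derive_addR (is_derive_mulR (is_derive_cut s i x) (fdd i x))
  (is_derive_mulR (fd i x) (is_derive_cut1 s i x)).
ring.
Qed.

(** Each error term is s times a polynomial times f or one of its derivatives, and rapid decay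
    absorbs the polynomial. *)
Lemma small_laplacian_cut f : rapid2 f ->
  small (fun s x => laplacian (fun y => cut s y * f y) x - laplacian f x).
Proof.
move=> [Cf f0 f1 f2]; under eq_fun do under eq_fun do rewrite laplacian_cut //.
rewrite /laplacian; under eq_fun do under eq_fun do rewrite -sumrB.
apply: small_sum => i.
under eq_fun do under eq_fun do rewrite addrAC.
apply: smallD; first exact: small_cut.
apply: smallD.
  apply: (small_rapid (rapidZ (8 * expR 1) (rapid_coord i (f1 i)))) => s x /andP[s0 _].
  have -> : 8 * expR 1 * (x 0 i * 'D_('e i) f x) = 2 * (4 * expR 1 * x 0 i) * 'D_('e i) f x by ring.
  rewrite -[2 * cut1 s i x * _]mulrA -[2 * _ * _]mulrA normrM [in leRHS]normrM.
  rewrite [leRHS]mulrCA ler_wpM2l // normrM [in leRHS]normrM mulrA.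
  by rewrite ler_wpM2r // cut1_le.
apply: (@small_rapid _ (fun x => 4 * expR 1 * f x + 144 * expR 1 * (x 0 i * (x 0 i * f x)))).
  by apply: rapidD; apply: rapidZ => //; do 2 apply: rapid_coord.
move=> s x s01.
have -> : 4 * expR 1 * f x + 144 * expR 1 * (x 0 i * (x 0 i * f x)) =
  (4 * expR 1 + 144 * expR 1 * (x 0 i * x 0 i)) * f x by ring.
by rewrite [f x * _]mulrC normrM [in leRHS]normrM [leRHS]mulrA ler_wpM2r // cut2_le.
Qed.

(** As s <= 1 and exp(- l1 x) <= 1, the square of F is at most s C^2 exp(- l1 x), whose integral is
    linear in s. *)
Lemma small_integral (F : R -> T -> R) eps : small F -> 0 < eps ->
  (forall s, 0 < s <= 1 -> measurable_fun setT (F s)) ->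
  exists2 s0 : R, 0 < s0 <= 1 & forall s, 0 < s <= s0 -> \int[mu]_x (F s x ^+ 2) <= eps.
Proof.
move=> [C HC] e0 mF; pose K := C ^+ 2 * \int[mu]_x expR (- l1 x).
have I0 : 0 <= \int[mu]_x expR (- l1 x) by apply: Rintegral_ge0 => x _; exact: expR_ge0.
have K0 : 0 <= K by rewrite mulr_ge0 ?sqr_ge0.
exists (Num.min 1 (eps / (K + 1))).
  by rewrite lt_min ltr01 divr_gt0 ?ltr_wpDl //= ge_min lexx.
move=> s /andP[s0]; rewrite le_min => /andP[s1 sK].
have s01 : 0 < s <= 1 by rewrite s0.
have FC x : F s x ^+ 2 <= s * C ^+ 2 * expR (- l1 x).
  rewrite -(real_normK (num_real (F s x))).
  have := HC s x s01; have := l1_ge0 x; have := expR_ge0 (- l1 x).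
  have : expR (- l1 x) <= 1 by rewrite -expR0 ler_expR oppr_le0 l1_ge0.
  move: (expR _) (F s x) => e f e1 e0' _ h.
  apply: le_trans (_ : (s * (C * e)) ^+ 2 <= _).
    by rewrite ler_sqr ?nnegrE // (le_trans _ h).
  have s2 : s ^+ 2 <= s by rewrite expr2 ler_piMl // ltW.
  have e2 : e ^+ 2 <= e by rewrite expr2 ler_piMl.
  rewrite !exprMn -[leRHS]mulrA; apply: ler_pM (sqr_ge0 _) _ s2 _.
    by rewrite mulr_ge0 ?sqr_ge0.
  by rewrite ler_wpM2l ?sqr_ge0.
have ii := integrable_funZ (s * C ^+ 2) (@integrable_exp_l1 R n).
apply: (@le_trans _ _ (\int[mu]_x (s * C ^+ 2 * expR (- l1 x)))).
  apply: le_Rintegral => //.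
  apply: le_integrable_fun ii; first by apply: measurable_funX; exact: mF.
  by move=> x; rewrite ger0_norm ?sqr_ge0.
rewrite RintegralZl //; last exact: integrable_exp_l1.
rewrite -mulrA -/K; apply: le_trans (_ : s * (K + 1) <= _).
  by rewrite ler_wpM2l ?lerDl // ltW.
by rewrite -ler_pdivlMr // ltr_wpDl.
Qed.

End cutoff.

(** * The oscillator on L2 *)

Section oscillator.
Context {R : realType} {n : nat}.
Local Notation C := R[i].
Local Notation T := 'rV[R]_n.
Local Notation mu := (@lebesgue_rV R n).
Local Notation "'e i" := (delta_mx 0 i : T) (at level 0, i at level 0).
Variable A : 'M[R]_n.
Local Notation M := (minimal_oscillator A).
Implicit Types (f g h : T -> R) (x : T).

Definition osc f x : R := - laplacian f x + quadratic_form A x * f x.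

Lemma rapid_quadratic_form f : rapid f -> rapid (fun x => quadratic_form A x * f x).
Proof.
move=> rf; rewrite /quadratic_form; under eq_fun do rewrite mulr_suml.
apply: rapid_sum => i; under eq_fun do rewrite mulr_suml; apply: rapid_sum => j.
by under eq_fun do rewrite -!mulrA; apply/rapidZ; do 2 apply: rapid_coord.
Qed.

Lemma rapid_osc f : rapid2 f -> rapid (osc f).
Proof.
move=> rf; apply: rapidD; last by apply: rapid_quadratic_form; have [] := rf.
by under eq_fun do rewrite -mulN1r; apply/rapidZ/rapid_laplacian.
Qed.

Lemma osc_green f h : rapid2 f -> rapid2 h ->
  \int[mu]_x (osc f x * h x) = \int[mu]_x (f x * osc h x).
Proof.
move=> rf rh; have [_ f0 _ _] := rf; have [_ h0 _ _] := rh.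
have r1 := rapidM (rapid_laplacian rf) h0; have r2 := rapidM f0 (rapid_laplacian rh).
have r3 := rapid_quadratic_form (rapidM f0 h0).
transitivity (\int[mu]_x (quadratic_form A x * (f x * h x) - laplacian f x * h x)).
  by apply: eq_Rintegral => x _; rewrite /osc; ring.
transitivity (\int[mu]_x (quadratic_form A x * (f x * h x) - f x * laplacian h x)).
  by rewrite !RintegralB // ?green //; exact: rapid_integrable.
by apply: eq_Rintegral => x _; rewrite /osc; ring.
Qed.

Lemma sqrint0 : sqrint mu (fun=> 0).
Proof.
apply: rapid_sqrint; split; first exact: continuous_cstR.
by move=> c; exists 0 => x; rewrite normr0 mul0r.
Qed.

Definition realL2 f (sf : sqrint mu f) : L2fun mu :=
  sval (@L2fun_ex _ _ _ mu (fun x => (f x)%:C%C) sf sqrint0).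

Lemma realL2E f (sf : sqrint mu f) : (realL2 sf : T -> C) = (fun x => (f x)%:C%C).
Proof. exact: svalP (@L2fun_ex _ _ _ mu (fun x => (f x)%:C%C) sf sqrint0). Qed.

Lemma fre_realL2 f (sf : sqrint mu f) : fre (realL2 sf) = f.
Proof. by rewrite /fre realL2E. Qed.

Lemma fim_realL2 f (sf : sqrint mu f) : fim (realL2 sf) = fun=> 0.
Proof. by rewrite /fim realL2E. Qed.

Lemma sqn_realL2B f g (sf : sqrint mu f) (sg : sqrint mu g) :
  sqn (@ip _ _ _ mu) (L2class (realL2 sf) - L2class (realL2 sg)) =
  \int[mu]_x ((g x - f x) ^+ 2).
Proof.
rewrite -L2classB sqn_class.
have -> : \int[mu]_x (fim (realL2 sf - realL2 sg) x ^+ 2) = 0.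
  under eq_Rintegral do rewrite (L2fun_ptB _ _ _).2 !fim_realL2 subrr expr0n.
  by rewrite Rintegral_cst // mul0r.
rewrite addr0; apply: eq_Rintegral => x _.
by rewrite (L2fun_ptB _ _ _).1 !fre_realL2 -opprB sqrrN.
Qed.

Lemma laplacian0 x : laplacian (fun=> 0 : R) x = 0 :> R.
Proof.
have D0 i : 'D_('e i) (fun _ : T => 0 : R) = fun=> 0.
  by apply/funext => y; have [_ ->] := is_derive_cstR (0 : R) y ('e i).
by apply: big1 => i _; rewrite D0; exact: (congr1 (@^~ x) (D0 i)).
Qed.

Lemma minimal_realL2 f (sf : sqrint mu f) (sg : sqrint mu (osc f)) :
  smooth f -> bounded_support f -> M (L2class (realL2 sf), L2class (realL2 sg)).
Proof.
move=> Cf bf; exists (realL2 sf), (realL2 sg); split => //.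
  rewrite realL2E; split => // [k|]; first exact: Ck_cst.
  by apply/compact_supportP; split => //; exists 0.
move=> x; rewrite !realL2E /claplacian /= laplacian0 /osc.
by apply/eqP; rewrite eq_complex /= ?(mulr0, mul0r, addr0, subr0, oppr0) !eqxx.
Qed.

Lemma closure_realL2 f (sf : sqrint mu f) (sg : sqrint mu (osc f)) :
  smooth f -> rapid2 f -> harmonic_oscillator A (L2class (realL2 sf), L2class (realL2 sg)).
Proof.
move=> Cf rf; have [_ f0 _ _] := rf.
have Cc s : smooth (fun x => cut s x * f x) by move=> k; apply: CkM; [exact: Ck_cut|exact: Cf].
have bc s : 0 < s -> bounded_support (fun x => cut s x * f x).
  by move=> s0; have [r H] := bounded_support_cut (n := n) s0; exists r => x /H ->; rewrite mul0r.
have rc s : 0 < s -> rapid2 (fun x => cut s x * f x).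
  by move=> s0; apply: bounded_support_rapid2; [exact: Cc|exact: bc].
have sm1 := small_cut f0.
have sm2 : small (fun s x => osc (fun y => cut s y * f y) x - osc f x).
  have [B HB] := smallD (small_laplacian_cut rf) (small_cut (rapidZ (-1) (rapid_quadratic_form
    f0))).
  exists B => s x s01; rewrite -normrN; apply: le_trans (HB s x s01).
  rewrite le_eqVlt; apply/orP; left; apply/eqP; congr (`|_|); rewrite /osc.
  by move: (laplacian _ x) (laplacian f x) (quadratic_form A x) (cut s x) (f x) => *; ring.
have m1 s : 0 < s <= 1 -> measurable_fun setT (fun x => cut s x * f x - f x).
  move=> /andP[s0 _]; apply: measurable_funB; last exact: rapid_measurable.
  by have [_ /rapid_measurable] := rc s s0.
have m2 s : 0 < s <= 1 -> measurable_fun setT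
    (fun x => osc (fun y => cut s y * f y) x - osc f x).
  move=> /andP[s0 _].
  exact: (measurable_funB (rapid_measurable (rapid_osc (rc s s0))) (rapid_measurable (rapid_osc
    rf))).
apply/(closureP (@normL2 _ _ _ mu)) => eps e0.
have [s1 /andP[s10 s11] H1] := small_integral sm1 e0 m1.
have [s2 /andP[s20 s21] H2] := small_integral sm2 e0 m2.
(* The graph norm requires one cutoff that works for both [f] and [osc f]. *)
pose s := Num.min s1 s2.
have s0 : 0 < s by rewrite lt_min s10.
have [_ c0 _ _] := rc s s0.
exists (L2class (realL2 (rapid_sqrint c0)), L2class (realL2 (rapid_sqrint (rapid_osc (rc s s0))))).
split => /=; first by apply: minimal_realL2; [exact: Cc|exact: bc].
  by rewrite sqn_realL2B H1 // s0 ge_min lexx.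
by rewrite sqn_realL2B H2 // s0 ge_min lexx orbT.
Qed.

Lemma oscE (f g : L2fun mu) :
  (forall x, g x = - claplacian f x + (quadratic_form A x)%:C%C * f x) <->
  fre g = osc (fre f) /\ fim g = osc (fim f).
Proof.
split=> [E|[Er Ei] x].
  split; apply/funext => x; rewrite /fre /fim E /osc /claplacian;
    by case: (f x) => a b /=; rewrite ?mul0r ?subr0 ?addr0.
have := congr1 (@^~ x) Er; have := congr1 (@^~ x) Ei; rewrite /fre /fim /osc /claplacian.
case: (g x) => c d /= -> ->; case: (f x) => a b /=.
by apply/eqP; rewrite eq_complex /= !mul0r subr0 addr0 !eqxx.
Qed.

Lemma test_rapid2 (phi : T -> C) : test_function phi -> rapid2 (fre phi) /\ rapid2 (fim phi).
Proof.
move=> [Cr Ci /compact_supportP[br bi]].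
by split; apply: bounded_support_rapid2; rewrite // -/(fre _) -/(fim _).
Qed.

(** Green's identity moves the operator onto the real eigenfunction [h], separately for the real and
    imaginary parts of the test function. *)
Lemma minimal_sym (l : R) h (sh : sqrint mu h) u v : rapid2 h ->
  (forall x, osc h x = l * h x) -> M (u, v) ->
  ip v (L2class (realL2 sh)) = l%:C%C * ip u (L2class (realL2 sh)).
Proof.
move=> rh eh [f [g [tf /oscE[gr gi] [-> ->]]]].
have [rr ri] := test_rapid2 tf.
rewrite !ip_class /ipf fre_realL2 fim_realL2 gr gi.
have int k : rapid2 k -> \int[mu]_x (osc k x * h x) = l * \int[mu]_x (k x * h x).
  move=> rk; have [_ k0 _ _] := rk; have [_ h0 _ _] := rh.
  rewrite osc_green // -RintegralZl //; last exact: rapid_integrable (rapidM k0 h0).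
  by apply: eq_Rintegral => x _; rewrite eh; ring.
under eq_Rintegral do rewrite mulr0 addr0.
under [X in (_ +i* X)%C]eq_Rintegral do rewrite mulr0 subr0.
under [X in _ = _ * (X +i* _)%C]eq_Rintegral do rewrite mulr0 addr0.
under [X in _ = _ * (_ +i* X)%C]eq_Rintegral do rewrite mulr0 subr0.
rewrite !int //; apply/eqP; rewrite eq_complex /=.
by rewrite !mul0r subr0 addr0 !eqxx.
Qed.

Lemma osc_lin (a b : R) f g : Ck 2 f -> Ck 2 g ->
  osc (fun x => a * f x + b * g x) = fun x => a * osc f x + b * osc g x.
Proof.
move=> Cf Cg; have [fd Cdf] := Ck_elim Cf; have [gd Cdg] := Ck_elim Cg.
have lin i u v : (forall x, is_derive x ('e i) u ('D_('e i) u x)) ->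
    (forall x, is_derive x ('e i) v ('D_('e i) v x)) ->
    'D_('e i) (fun x => a * u x + b * v x) = fun x => a * 'D_('e i) u x + b * 'D_('e i) v x.
  move=> ud vd; apply/funext => x.
  by have [_ ->] := is_derive_addR (is_derive_mull a (ud x)) (is_derive_mull b (vd x)).
have L : laplacian (fun x => a * f x + b * g x) = fun x => a * laplacian f x + b * laplacian g x.
  apply/funext => x; rewrite /laplacian !mulr_sumr -big_split /=; apply: eq_bigr => i _.
  have [fdd _] := Ck_elim (Cdf i); have [gdd _] := Ck_elim (Cdg i).
  by rewrite (lin i f g (fd i) (gd i)); exact: (congr1 (@^~ x) (lin i _ _ (fdd i) (gdd i))).
apply/funext => x; have := congr1 (@^~ x) L; rewrite /osc /= => ->.
by move: (laplacian f x) (laplacian g x) (quadratic_form A x) (f x) (g x) => *; ring.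
Qed.

Lemma smooth_lin (a b : R) f g : smooth f -> smooth g -> smooth (fun x => a * f x + b * g x).
Proof. by move=> Cf Cg k; apply: CkD; apply: CkM => //; exact: Ck_cst. Qed.

Lemma bounded_support_lin (a b : R) f g : bounded_support f -> bounded_support g ->
  bounded_support (fun x => a * f x + b * g x).
Proof.
move=> [r f0] [s g0]; exists (Num.max r s) => x; rewrite gt_max => /andP[/f0 -> /g0 ->].
by rewrite !mulr0 addr0.
Qed.

Lemma minimal_lin (a : C) p q : M p -> M q -> M (a *: p.1 + q.1, a *: p.2 + q.2).
Proof.
case: a => a b [f [g [[Cfr Cfi /compact_supportP[bfr bfi]] /oscE[gr gi] ->]]].
move=> [f' [g' [[Cfr' Cfi' /compact_supportP[bfr' bfi']] /oscE[gr' gi'] ->]]].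
exists ((a +i* b)%C *: f + f'), ((a +i* b)%C *: g + g').
(* Complex scaling mixes real and imaginary parts. The factors 1 give each part the form of two
   nested binary combinations, to which the lemmas on linear combinations apply twice. *)
have E (k k' : L2fun mu) : fre ((a +i* b)%C *: k + k') =
     (fun x => 1 * (a * fre k x + (- b) * fim k x) + 1 * fre k' x) /\
   fim ((a +i* b)%C *: k + k') =
     (fun x => 1 * (a * fim k x + b * fre k x) + 1 * fim k' x).
  split; apply/funext => x.
    by rewrite (L2fun_ptD _ _ _).1 (L2fun_ptZ _ _ _ _).1 !mul1r mulNr.
  by rewrite (L2fun_ptD _ _ _).2 (L2fun_ptZ _ _ _ _).2 !mul1r.
split; last by rewrite /= !L2classD !L2classZ.
  split.
  - rewrite -/(fre _) (E _ _).1; do 2 apply: smooth_lin => //.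
  - rewrite -/(fim _) (E _ _).2; do 2 apply: smooth_lin => //.
  apply/compact_supportP; split.
  - rewrite -/(fre _) (E _ _).1; do 2 apply: bounded_support_lin => //.
  - rewrite -/(fim _) (E _ _).2; do 2 apply: bounded_support_lin => //.
have lin3 (c d : R) k1 k2 k3 : smooth k1 -> smooth k2 -> smooth k3 ->
    osc (fun x => 1 * (c * k1 x + d * k2 x) + 1 * k3 x) =
    fun x => 1 * (c * osc k1 x + d * osc k2 x) + 1 * osc k3 x.
  move=> C1 C2 C3; rewrite (osc_lin 1 1 (smooth_lin c d C1 C2 2) (C3 2%N)).
  by rewrite (osc_lin c d (C1 2%N) (C2 2%N)).
apply/oscE; have [Er Ei] := E f f'; have [Er' Ei'] := E g g'.
rewrite Er Ei Er' Ei' gr gi gr' gi'.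
by rewrite (lin3 _ _ _ _ _ Cfr Cfi Cfr') (lin3 _ _ _ _ _ Cfi Cfr Cfi').
Qed.

Lemma minimal0 : M (0, 0).
Proof.
have b0 : bounded_support (fun _ : T => 0 : R) by exists 0.
have C0 : smooth (fun _ : T => 0 : R) by move=> k; exact: Ck_cst.
have E0 : osc (fun=> 0) = fun=> 0.
  by apply/funext => x; rewrite /osc laplacian0 mulr0 oppr0 addr0.
have s0 : sqrint mu (osc (fun=> 0)) by rewrite E0; exact: sqrint0.
have := minimal_realL2 sqrint0 s0 C0 b0.
have Z f (sf : sqrint mu f) : f = (fun=> 0) -> L2class (realL2 sf) = 0.
  move=> f0; rewrite -L2class0; apply/eq_L2class/nearW => x.
  by rewrite realL2E f0.
by rewrite !Z.
Qed.

End oscillator.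

(** * Hermite functions as eigenvectors and their totality *)

Section eigenfunctions.
Context {R : realType} {n : nat}.
Local Notation C := R[i].
Local Notation T := 'rV[R]_n.
Local Notation mu := (@lebesgue_rV R n).
Local Notation "'e i" := (delta_mx 0 i : T) (at level 0, i at level 0).
Variables (A : 'M[R]_n) (w : 'I_n -> R) (U : 'M[R]_n).
Hypothesis w0 : forall i, 0 < w i.
Hypothesis UU : U *m U^T = 1%:M.
Hypothesis AE : A = U^T *m diag_mx (\row_i (w i ^+ 2)) *m U.
Local Notation herm := (herm w U).
Local Notation M := (minimal_oscillator A).
Implicit Types (f g h : T -> R) (x : T) (m : 'I_n -> nat).

Lemma quadratic_form_rot x : quadratic_form A x = \sum_k w k ^+ 2 * rot U k x ^+ 2.
Proof.
have Aij i j : A i j = \sum_k U k i * w k ^+ 2 * U k j.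
  rewrite AE mxE; apply: eq_bigr => k _; congr (_ * _).
  by rewrite mul_mx_diag !mxE.
rewrite /quadratic_form; under eq_bigr => i _ do under eq_bigr => j _ do rewrite Aij 2!mulr_suml.
under eq_bigr => i _ do rewrite exchange_big.
rewrite exchange_big; apply: eq_bigr => k _ /=.
rewrite [rot U k x ^+ 2]expr2 mulrA {1}/rot mulr_sumr mulr_suml; apply: eq_bigr => i _.
by rewrite /rot mulr_sumr; apply: eq_bigr => j _; ring.
Qed.

Lemma osc_herm m x : osc A (herm m) x = level w m * herm m x.
Proof. by rewrite /osc quadratic_form_rot herm_eigen. Qed.

Lemma rapid2_herm m : rapid2 (herm m).
Proof.
have D1 i : 'D_('e i) (herm m) = fun y => \sum_k rot U k ('e i) * hermD w U m k y.
  by apply/funext => y; have [_ ->] := is_derive_herm w U m y ('e i).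
split => [||i|i]; [exact: Ck_herm|exact: herm_rapid| |].
  by rewrite D1; apply: rapid_sum => k; apply: rapidZ; exact: hermD_rapid.
have D2 : 'D_('e i) ('D_('e i) (herm m)) = fun y => \sum_k rot U k ('e i) *
   (\sum_j rot U j ('e i) * (w k * (m k)%:R * hermD w U (decm m k) j y +
                            (- 2^-1) * hermD w U (incm m k) j y)).
  rewrite D1; apply/funext => y.
  by have [_ ->] := is_derive_sumR (index_enum 'I_n)
    (fun k => is_derive_mull (rot U k ('e i)) (is_derive_hermD w U m k y ('e i))).
rewrite D2; apply: rapid_sum => k; apply: rapidZ; apply: rapid_sum => j; apply: rapidZ.
by apply: rapidD; apply: rapidZ; exact: hermD_rapid.
Qed.

Lemma smooth_herm m : smooth (herm m).
Proof. by move=> k; exact: Ck_herm. Qed.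

Definition hermL2 m : L2 mu := L2class (realL2 (rapid_sqrint (herm_rapid w0 UU m))).

Lemma hermL2_eigen m : harmonic_oscillator A (hermL2 m, (level w m)%:C%C *: hermL2 m).
Proof.
have := closure_realL2 (sf := rapid_sqrint (herm_rapid w0 UU m))
  (sg := rapid_sqrint (rapid_osc A (rapid2_herm m))) (smooth_herm m) (rapid2_herm m).
suff -> : (level w m)%:C%C *: hermL2 m =
  L2class (realL2 (rapid_sqrint (rapid_osc A (rapid2_herm m)))) by [].
rewrite -[LHS]L2classZ; apply/eq_L2class/nearW => x.
by rewrite realL2E osc_herm -[LHS]/(_ *: (realL2 _ x)) realL2E /= rmorphM.
Qed.

Lemma hermL2_sym u v m : M (u, v) -> ip v (hermL2 m) = (level w m)%:C%C * ip u (hermL2 m).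
Proof. exact: (minimal_sym _ (rapid2_herm m) (osc_herm m)). Qed.

Lemma ip_hermL2 m m' : ip (hermL2 m) (hermL2 m') = (\int[mu]_x (herm m x * herm m' x))%:C%C.
Proof.
rewrite ip_class /ipf !fre_realL2 !fim_realL2; apply/eqP; rewrite eq_complex /=.
apply/andP; split; apply/eqP.
  by apply: eq_Rintegral => x _; rewrite mulr0 addr0.
under eq_Rintegral do rewrite mulr0 mul0r subr0.
by rewrite Rintegral_cst // mul0r.
Qed.

Lemma herm0_gt0 x : 0 < herm (fun=> 0%N) x.
Proof. by apply: prodr_gt0 => i _; exact: expR_gt0. Qed.

(** The unit cube has measure 1. This excludes that the ground state, which is positive everywhere,
    vanishes almost everywhere. *)
Lemma lebesgue_rV_setT_neq0 : mu setT != 0%E.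
Proof.
have := @lebesgue_rV_box R n (fun=> `[0, 1]%classic) (fun=> measurable_itv _).
rewrite big1 => [|i _]; last by rewrite lebesgue_measure_itv /= lte_fin ltr01 sube0.
move=> E; rewrite gt_eqF // (@lt_le_trans _ _ 1%E) ?lte_fin // -E.
apply: le_measure => //; rewrite inE //.
exact: (measurable_box (fun=> measurable_itv _)).
Qed.

Lemma sqr_eq0_ae f : sqrint mu f -> \int[mu]_x (f x ^+ 2) = 0 -> {ae mu, forall x, f x = 0}.
Proof.
move=> [mf fi] f0; have mf2 : measurable_fun setT (fun x => (f x ^+ 2)%:E).
  by apply/measurable_EFinP; exact: measurable_funX.
have : (\int[mu]_x `|(f x ^+ 2)%:E| = 0)%E.
  have -> : (fun x => `|(f x ^+ 2)%:E|)%E = (fun x => (f x ^+ 2)%:E).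
    by apply/funext => x; rewrite abse_EFin ger0_norm ?sqr_ge0.
  by rewrite -(fineK (integrable_fin_num measurableT fi)) -[fine _]/(\int[mu]_x (f x ^+ 2)) f0.
move=> /(ae_eq_integral_abs mu measurableT mf2); apply: filterS => x /(_ I) /= [] /eqP.
by rewrite sqrf_eq0 => /eqP.
Qed.

(** The ladder identity multiplies the squared norm by 2 w_i m_i at each raising step, which reduces
    the claim to the ground state. *)
Lemma herm_sqr_gt0 m : 0 < \int[mu]_x (herm m x * herm m x).
Proof.
have [k] := ubnP (\sum_i m i)%N; elim: k => // k IH in m *.
case: (pickP (fun i => 0 < m i)%N) => [i mi|m0] mk.
  rewrite -(decmK mi) herm_ladder // incmK mulr_gt0 // ?IH //.
    by rewrite !mulr_gt0 // ltr0n decmK.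
  rewrite -ltnS (leq_trans _ mk) // ltnS.
  rewrite (bigD1 i) //= [X in (_ < X)%N](bigD1 i) //= /decm eqxx subn1.
  rewrite -(prednK mi) addSn ltnS /= leq_add2l leq_sum // => j ji.
  by rewrite leq_subr.
have -> : m = fun=> 0%N by apply/funext => i; apply/eqP; rewrite -leqn0 leqNgt m0.
under eq_Rintegral do rewrite -expr2.
rewrite lt_def Rintegral_ge0 ?andbT => [|x _]; last exact: sqr_ge0.
apply/eqP => h0.
have [N [mN N0 sub]] := sqr_eq0_ae (rapid_sqrint (herm_rapid w0 UU _)) h0.
have := lebesgue_rV_setT_neq0; apply/negP; rewrite negbK -[X in _ == X]N0; apply/eqP.
congr (mu _); apply/seteqP; split => // x _; apply: sub => /= hx.
by have := herm0_gt0 x; rewrite hx ltxx.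
Qed.

Lemma hermL2_neq0 m : hermL2 m != 0.
Proof.
apply/eqP => h0; have := ip_hermL2 m m; rewrite h0.
rewrite (ip0l (@ipZl _ _ _ mu)) => /eqP; rewrite eq_complex /= eqxx andbT eq_sym.
by rewrite gt_eqF // herm_sqr_gt0.
Qed.

(** The span of the Hermite functions is stable under multiplication by x_i: x_i is a combination of
    the y_k, and [herm_rot] expresses each w_k y_k by ladder moves. Hence the induction on the word,
    for all m at once. *)
Lemma word_herm_moments f : sqrint mu f -> (forall m, \int[mu]_x (f x * herm m x) = 0) ->
  forall t m, \int[mu]_x (f x * (word t x * herm m x)) = 0.
Proof.
move=> sf f0; have wr t m : rapid (fun x => word t x * herm m x).
  elim: t => [|i t IH]; rewrite /word.
    by under eq_fun do rewrite big_nil mul1r; exact: herm_rapid.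
  by under eq_fun do rewrite big_cons -mulrA; exact: rapid_coord.
have wi t m := sqrint_mul sf (rapid_sqrint (wr t m)).
elim=> [|i t IH] m; first by under eq_Rintegral do rewrite /word big_nil mul1r.
(* [true] selects the lowering term of [hermX], [false] the raising one; U k i / w k converts w_k
   y_k into the contribution of y_k to x_i. *)
pose c k (b : bool) := U k i / w k * (if b then w k * (m k)%:R else 2^-1).
have E x : f x * (word (i :: t) x * herm m x) = \sum_k \sum_(b : bool)
    c k b * (f x * (word t x * herm (if b then decm m k else incm m k) x)).
  rewrite /word big_cons -/(word t x) (rot_inv UU x i) mulr_suml mulr_suml mulr_sumr.
  apply: eq_bigr => k _; rewrite big_bool /c /=.
  have := herm_rot w U m k x; rewrite /hermX => h.
  have -> : f x * (U k i * rot U k x * word t x * herm m x) =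
    U k i / w k * (f x * (word t x * (w k * rot U k x * herm m x))).
    by field; rewrite gt_eqF.
  rewrite h; ring.
have ic k b : mu.-integrable setT (EFin \o
    fun x => c k b * (f x * (word t x * herm (if b then decm m k else incm m k) x))).
  exact: integrable_funZ.
under eq_Rintegral do rewrite E.
suff H (r : seq 'I_n) : mu.-integrable setT (EFin \o fun x => \sum_(k <- r) \sum_(b : bool)
      c k b * (f x * (word t x * herm (if b then decm m k else incm m k) x))) /\
   \int[mu]_x (\sum_(k <- r) \sum_(b : bool)
      c k b * (f x * (word t x * herm (if b then decm m k else incm m k) x))) = 0.
  by have [] := H (index_enum 'I_n).
elim: r => [|k r [IHi IHr]].
  have -> : (fun x => \sum_(k <- [::]) \sum_(b : bool)
      c k b * (f x * (word t x * herm (if b then decm m k else incm m k) x))) = fun=> 0.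
    by apply/funext => x; rewrite big_nil.
  split; last by rewrite Rintegral_cst // mul0r.
  exact: integrable0.
have -> : (fun x => \sum_(k <- k :: r) \sum_(b : bool)
      c k b * (f x * (word t x * herm (if b then decm m k else incm m k) x))) =
  fun x => (c k true * (f x * (word t x * herm (decm m k) x)) +
     c k false * (f x * (word t x * herm (incm m k) x))) + \sum_(k <- r) \sum_(b : bool)
      c k b * (f x * (word t x * herm (if b then decm m k else incm m k) x)).
  by apply/funext => x; rewrite big_cons big_bool.
have i1 := ic k true; have i2 := ic k false; have i12 := integrable_funD i1 i2.
split; first exact: integrable_funD.
rewrite RintegralD // IHr addr0 RintegralD // !RintegralZl //.
by rewrite !IH !mulr0 addr0.
Qed.

Lemma herm_total f : sqrint mu f -> (forall m, \int[mu]_x (f x * herm m x) = 0) ->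
  {ae mu, forall x, f x = 0}.
Proof.
move=> sf f0; have [mf _] := sf.
pose h := herm (fun=> 0%N); have rh : rapid h by exact: herm_rapid.
suff : null_moments mu (fun x => f x * h x).
  move=> /null_moments_ae0; apply: filterS => x /eqP.
  by rewrite mulf_eq0 (gt_eqF (herm0_gt0 x)) orbF => /eqP.
split.
- by apply: measurable_funM => //; exact: rapid_measurable.
(* The rate c + 1 leaves a spare factor exp(- l1 x), so [expR (c * l1 x) * h x] is square integrable
   and its product with [f] is integrable. *)
- move=> c; have [_ /(_ (c + 1))[B HB]] := rh.
  have se : sqrint mu (fun x => `|B| * expR (- l1 x)).
    apply: sqrintZ; have m1 : measurable_fun setT (fun x : T => expR (- l1 x)).
      by have := @measurable_exp_l1 R n (-1); under eq_fun do rewrite mulN1r.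
    split => //; apply: le_integrable_fun (@integrable_exp_l1 R n).
      exact: measurable_funX.
    move=> x; rewrite ger0_norm ?sqr_ge0 // expr2 ler_piMl ?expR_ge0 //.
    by rewrite -expR0 ler_expR oppr_le0 l1_ge0.
  have sch : sqrint mu (fun x => expR (c * l1 x) * h x).
    apply: sqrint_le se.
      by apply: measurable_funM; [exact: measurable_exp_l1|exact: rapid_measurable].
    move=> x; rewrite normrM (ger0_norm (expR_ge0 _)).
    apply: le_trans (ler_wpM2l (expR_ge0 _) (HB x)) _.
    rewrite mulrCA -expRD (_ : _ + _ = - l1 x); last by ring.
    by rewrite ler_wpM2r ?expR_ge0 ?ler_norm.
  have := sqrint_mul sf sch; apply: eq_integrable => // x _ /=.
  by congr EFin; ring.
- move=> t; rewrite -[RHS](word_herm_moments sf f0 t (fun=> 0%N)).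
  by apply: eq_Rintegral => x _; rewrite mulrCA.
Qed.

Lemma hermL2_total u : (forall m, ip u (hermL2 m) = 0) -> u = 0.
Proof.
move=> u0; rewrite -[u]L2reprK -L2class0; apply/eq_L2class.
have [sr si] := L2fun_sqrint (L2repr u).
have ipE m : \int[mu]_x (fre (L2repr u) x * herm m x) = 0 /\
    \int[mu]_x (fim (L2repr u) x * herm m x) = 0.
  have := u0 m; rewrite -[u]L2reprK ip_class /ipf fre_realL2 fim_realL2 L2reprK.
  move=> /eqP; rewrite eq_complex /= => /andP[/eqP h1 /eqP h2].
  by split; [rewrite -[RHS]h1|rewrite -[RHS]h2]; apply: eq_Rintegral => x _;
    rewrite mulr0 ?addr0 ?subr0.
have r0 := herm_total sr (fun m => (ipE m).1); have i0 := herm_total si (fun m => (ipE m).2).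
apply: filterS2 r0 i0 => x; rewrite /fre /fim => rx ix.
by apply/eqP; rewrite eq_complex rx ix !eqxx.
Qed.

End eigenfunctions.

(** * Discreteness of the levels and the spectrum *)

Section spectrum.
Context {R : realType} {n : nat}.
Local Notation C := R[i].
Local Notation mu := (@lebesgue_rV R n).
Variables (A : 'M[R]_n) (w : 'I_n -> R) (U : 'M[R]_n).
Hypothesis w0 : forall i, 0 < w i.
Hypothesis UU : U *m U^T = 1%:M.
Hypothesis AE : A = U^T *m diag_mx (\row_i (w i ^+ 2)) *m U.

Lemma level_ge m i : 2 * (m i)%:R * w i <= level w m.
Proof.
rewrite /level (bigD1 i) //= -[leLHS]addr0 lerD //.
  by rewrite natrD natrM ler_wpM2r ?lerDl // ltW.
by apply: sumr_ge0 => j _; rewrite mulr_ge0 // ltW.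
Qed.

(** Only finitely many multi-indices have level below Re z + 1, and every other level is at distance
    at least 1 from z; d is a minimum over a finite box containing the former. *)
Lemma level_gap (z : C) : (forall m, z <> (level w m)%:C%C) ->
  exists2 d : R, 0 < d & forall m, d <= sqm ((level w m)%:C%C - z).
Proof.
move=> zl; pose r := complex.Re z + 1.
(* By [level_ge], a level below r forces 2 m_i w_i < r, hence m_i < N for every i. *)
pose N := (\max_(i < n) Num.truncn (r / (2 * w i))).+1.
(* The default 1 of the minimum takes care of all levels that are at least Re z + 1. *)
pose D := \big[Num.min/(1 : R)]_(f : {ffun 'I_n -> 'I_N})
  sqm ((level w (fun i => f i : nat))%:C%C - z).
exists D => [|m].
  apply: lt_bigmin => // f _; rewrite lt_def sqm_ge0 andbT; apply/negP => /eqP h.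
  apply: (zl (fun i => f i : nat)); apply/eqP; rewrite eq_sym -subr_eq0.
  move: h; rewrite /sqm; case: (_ - z) => a b /= /eqP.
  by rewrite paddr_eq0 ?sqr_ge0 // !sqrf_eq0 eq_complex.
have [lt_r|le_r] := ltP (level w m) r; last first.
  apply: le_trans (bigmin_le_id _ _ _ _) _.
  have h : 1 <= complex.Re ((level w m)%:C%C - z).
    by move: le_r; rewrite /r; case: z {zl r N D} => a b /=; lra.
  rewrite /sqm; apply: (@le_trans _ _ (complex.Re ((level w m)%:C%C - z) ^+ 2)).
    by rewrite -[1](expr1n _ 2) ler_sqr ?nnegrE // (le_trans ler01).
  by rewrite lerDl sqr_ge0.
have mN i : (m i < N)%N.
  rewrite ltnS; apply: leq_trans (leq_bigmax i); rewrite -ltnS -(ltr_nat R).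
  apply: lt_trans (truncnS_gt _); rewrite ltr_pdivlMr ?mulr_gt0 // mulrA [_ * 2]mulrC.
  exact: le_lt_trans (level_ge _ _) lt_r.
have := bigmin_le (1 : R) [ffun i => Ordinal (mN i)]
  (fun f : {ffun 'I_n -> 'I_N} => sqm ((level w (fun i => f i : nat))%:C%C - z)).
rewrite (_ : (fun i => _) = m) //; by apply/funext => i; rewrite ffunE.
Qed.

(** The abstract theorem wants a sequence, so multi-indices, as finite functions, are enumerated
    through their countable codes. *)
Lemma resolvent_oscillator (z : C) : (forall m, z <> (level w m)%:C%C) ->
  resolvent_set (harmonic_oscillator A) z.
Proof.
move=> zl; have [d d0 gap] := level_gap zl.
pose idx k : option {ffun 'I_n -> nat} := pickle_inv k.
pose e k : L2 mu := if idx k is Some m then hermL2 w0 UU m else 0.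
(* Numbers that code nothing carry the zero vector; giving them an actual level keeps [gap] valid,
   and any value would satisfy the eigenvector relation at 0. *)
pose lam k : C := if idx k is Some m then (level w m)%:C%C else (level w (fun=> 0%N))%:C%C.
have ip0 (u : L2 mu) : ip u 0 = 0 := ip0r (@ipZl _ _ _ mu) (@ipC _ _ _ mu) u.
apply: (@resolvent_of_eigenbasis R (L2 mu) (@ip _ _ _ mu) (@ipDl _ _ _ mu) (@ipZl _ _ _ mu)
  (@ipC _ _ _ mu) (@normL2 _ _ _ mu) e _ (@L2_complete _ _ _ mu)
  (minimal_oscillator A) lam z d) => //.
- move=> i j ij; rewrite /e.
  have Ei := @pickle_invK {ffun 'I_n -> nat} i; have Ej := @pickle_invK {ffun 'I_n -> nat} j.
  rewrite -/(idx i) in Ei; rewrite -/(idx j) in Ej.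
  case: (idx i) Ei => [a /= ai|_]; last by rewrite (ip0l (@ipZl _ _ _ mu)).
  case: (idx j) Ej => [b /= bj|_]; last exact: ip0.
  rewrite ip_hermL2 herm_orth // => ab; move: ij; rewrite -ai -bj.
  by rewrite (_ : a = b) ?eqxx //; apply/ffunP => k; rewrite ab.
- exact: minimal_lin.
- exact: minimal0.
- move=> k; rewrite /e /lam; case: (idx k) => [m|]; first exact: hermL2_eigen.
  by rewrite scaler0; apply: subset_closure; exact: minimal0.
- move=> u v k Muv; rewrite /e /lam; case: (idx k) => [m|]; first exact: (hermL2_sym w0 UU AE).
  by rewrite !ip0 mulr0.
- move=> u u0; apply: (@hermL2_total _ _ w U w0 UU) => m.
  have := u0 (pickle (finfun m)); rewrite /e /idx pickleK_inv.
  by rewrite (_ : (finfun m : _ -> _) = m) //; apply/funext => i; rewrite ffunE.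
- by move=> k; rewrite /lam; case: (idx k) => [m|]; exact: gap.
Qed.

Lemma level_eigenvalue m : eigenvalues (harmonic_oscillator A) (level w m)%:C%C.
Proof.
by exists (hermL2 w0 UU m); [exact: hermL2_neq0|exact: hermL2_eigen].
Qed.

End spectrum.

(** For z in the resolvent set an eigenvector u solves the resolvent equation with f = 0, hence u =
    S 0 = 0. *)
Lemma eigenvalues_spectrum {K : numFieldType} {V : normedModType K} (G : set (V * V)) :
  eigenvalues G `<=` spectrum G.
Proof.
move=> z [u u0 Gu] [S [_ HS]]; move/eqP: u0; apply.
by rewrite ((HS u 0).1 _) ?raddf0 // add0r.
Qed.

Theorem proposition2 (R : realType) (n : nat) (A : 'M[R]_n) (w : 'I_n -> R) :
  (1 <= n)%N ->
  A^T = A ->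
  (forall x : 'rV[R]_n, x != 0 -> 0 < quadratic_form A x) ->
  (forall i, 0 < w i) ->
  char_poly A = \prod_(i < n) ('X - (w i ^+ 2)%:P) ->
  (spectrum (harmonic_oscillator A) `<=` eigenvalues (harmonic_oscillator A)) /\
  spectrum (harmonic_oscillator A) =
    [set (\sum_(i < n) (2 * m i + 1)%:R * w i)%:C%C | m in [set: 'I_n -> nat]].
Proof.
move=> _ AT _ w0 chA; have [U [UU AE]] := orthogonal_diagonalization AT chA.
have spec z : spectrum (harmonic_oscillator A) z -> exists m, z = (level w m)%:C%C.
  move=> sz; apply: contrapT => h; apply: sz; apply: (resolvent_oscillator w0 UU AE) => m zm.
  by apply: h; exists m.
split=> [z /spec[m ->]|]; first exact: (level_eigenvalue w0 UU AE).
apply/seteqP; split=> [z /spec[m ->]|_ [m _ <-]]; first by exists m.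
exact/eigenvalues_spectrum/(level_eigenvalue w0 UU AE m).
Qed.
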